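(* Let $A$ be a self-adjoint operator with compact resolvent and simple eigenvalues $0<\mu_1<\mu_2<\cdots$ in $\mathcal H$, with normalized eigenvectors $\{\psi_n\}_{n\in\mathbb N}$, and let $v$ be a bounded sesquilinear form on $\mathcal D_a=\operatorname{Dom}(A^{1/2})$. Suppose that there is a sequence $\{\omega_j\}_{j\in\mathbb N}\subset[0,\infty)$ such that $$|v(\psi_j,\psi_k)|\le \omega_j\omega_k\quad (j,k\in\mathbb N),\qquad \sum_{j=1}^\infty\frac{\omega_j^2}{\mu_j}<\infty,$$ that $\sum_{n=1}^\infty \mu_n^{-p}<\infty$ for some $p>0$, and that $$\sum_{\substack{j=1\\ j\ne n}}^\infty\frac{\omega_j^2}{|\mu_n-\mu_j|}+\frac{\omega_n^2}{r_n}\longrightarrow 0,\qquad n\to\infty .$$ Let $T$ be the m-sectorial operator associated with the form $t=a+v$. Then there exist $N_0\in\mathbb N$ and $h_1,h_2>0$ such that $$\sigma(T)\subset \Pi_0(N_0,h_1,h_2)\cup\bigcup_{k>N_0}\Pi_k,$$ the curves $\partial\Pi_0(N_0,h_1,h_2)$ and $\Gamma_k$, $k>N_0$, lie in the resolvent set of $T$, and such that there exists a boundedly invertible operator $W\in\mathcal B(\mathcal H)$ with $$S_0=W^{-1}S_0^0W,\qquad P_k=W^{-1}P_k^0W,\quad k>N_0,$$ where $S_0,P_k$ are the Riesz projections of $T$ and $S_0^0,P_k^0$ the Riesz projections of $A$ corresponding to $\Pi_0(N_0,h_1,h_2)$ and $\Pi_k$, respectively.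
   Context: $\mathbb N=\{1,2,3,\dots\}$. $\mathcal H$ is an infinite-dimensional separable Hilbert space; $\langle\cdot,\cdot\rangle$ and sesquilinear forms are linear in the first and antilinear in the second argument. $A$ is a self-adjoint operator in $\mathcal H$ with compact resolvent whose spectrum consists of simple eigenvalues $\{\mu_n\}_{n\in\mathbb N}\subset(0,\infty)$, ordered increasingly; $A\psi_n=\mu_n\psi_n$, $\|\psi_n\|=1$, so $\{\psi_n\}$ is an orthonormal basis of $\mathcal H$. $a(f,g)=\langle A^{1/2}f,A^{1/2}g\rangle$ is the form of $A$, and $\mathcal D_a$ is $\operatorname{Dom}(A^{1/2})$ with inner product $\langle A^{1/2}\cdot,A^{1/2}\cdot\rangle$. Under the first two conditions on $v$ and $\{\omega_j\}$ in the claim, the form $t=a+v$ with domain $\mathcal D_a$ is closed and sectorial; $T$ is the m-sectorial operator associated with it by the first representation theorem ($f\in\operatorname{Dom}(T)$, $Tf=h$ iff $f\in\mathcal D_a$ and $t(f,g)=\langle h,g\rangle$ for all $g\in\mathcal D_a$). It has compact resolvent. Gaps: $r_n^+=\mu_{n+1}-\mu_n$, $r_n^-=\mu_n-\mu_{n-1}$, and $r_n=\tfrac12\min\{r_n^-,r_n^+\}$ for $n>1$; $r_1=\tfrac12(\mu_2-\mu_1)$. Regions: $\Pi_0(N,h_1,h_2)=\{z\in\mathbb C: -h_1<\operatorname{Re}z\le\mu_N+r_N,\ |\operatorname{Im}z|\le h_2\}$; for $k\in\mathbb N$, $\Pi_k$ is the open disc of radius $r_k$ centred at $\mu_k$, and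 $\Gamma_k=\partial\Pi_k$. Riesz projections (contours positively oriented, $\Pi_0=\Pi_0(N_0,h_1,h_2)$): $$S_0^0=\frac1{2\pi i}\int_{\partial\Pi_0}(z-A)^{-1}dz,\quad P_k^0=\frac1{2\pi i}\int_{\Gamma_k}(z-A)^{-1}dz,$$ $$S_0=\frac1{2\pi i}\int_{\partial\Pi_0}(z-T)^{-1}dz,\quad P_k=\frac1{2\pi i}\int_{\Gamma_k}(z-T)^{-1}dz.$$ *)

(* Defs.v *)
From HB Require Import structures.
From mathcomp Require Import all_boot all_order all_algebra.
From mathcomp Require Import complex.
From mathcomp Require Import all_classical all_reals all_analysis.

Set Implicit Arguments.
Unset Strict Implicit.
Unset Printing Implicit Defensive.

Import Order.TTheory GRing.Theory Num.Def Num.Theory.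
Import numFieldNormedType.Exports.

Local Open Scope classical_set_scope.
Local Open Scope ring_scope.
Local Open Scope complex_scope.

(* Scalars are R[i] with R : realType. Norms live in R[i]: `|f| is a
   nonnegative real element of R[i], and real bounds are embedded by %:C.
   Num.conj is complex conjugation, so that dot : {dot H for Num.conj} is linear
   in its first and antilinear in its second argument. *)

Section Space.
Context {R : realType} {H : completeNormedModType R[i]}.

(* The (complete) norm of H is the one induced by the inner product. *)
Definition hilbert_dot (dot : {dot H for Num.conj}) : Prop :=
  forall f : H, `|f| ^+ 2 = dot f f.

Definition infinite_dimensional : Prop :=
  ~ exists (n : nat) (e : 'I_n -> H),
      forall f : H, exists c : 'I_n -> R[i], f = \sum_(i < n) c i *: e i.

Definition separable : Prop :=
  exists2 D : set H, countable D & dense D.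

Definition bounded_operator (B : H -> H) : Prop :=
  linear B /\ exists M : R, forall f, `|B f| <= M%:C * `|f|.

Definition compact_operator (B : H -> H) : Prop :=
  bounded_operator B /\ precompact (B @` [set f | `|f| <= 1]).

Definition boundedly_invertible (W Winv : H -> H) : Prop :=
  [/\ bounded_operator W, bounded_operator Winv, cancel W Winv & cancel Winv W].

End Space.

Arguments infinite_dimensional {R} H.
Arguments separable {R} H.

(* A linear operator with domain dom; the values of app outside dom are junk
   and are never used. *)
Record operator (R : realType) (H : completeNormedModType R[i]) := Operator {
  dom : set H;
  app :> H -> H;
  dom0 : dom 0;
  domP : forall (a : R[i]) f g, dom f -> dom g -> dom (a *: f + g);
  appP : forall (a : R[i]) f g, dom f -> dom g ->
    app (a *: f + g) = a *: app f + app g }.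

Section Operators.
Context {R : realType} {H : completeNormedModType R[i]}.
Variable dot : {dot H for Num.conj}.
Implicit Types (T A S : operator H) (D : set H) (t v : H -> H -> R[i]).

Definition is_resolvent T (z : R[i]) (B : H -> H) : Prop :=
  [/\ bounded_operator B,
      forall f, dom T (B f) /\ z *: B f - T (B f) = f &
      forall f, dom T f -> B (z *: f - T f) = f].

Definition resolvent_set T : set R[i] :=
  [set z | exists B, is_resolvent T z B].

Definition spectrum T : set R[i] := ~` resolvent_set T.

(* (z - T)^-1; meaningful for z in the resolvent set only *)
Definition resolvent T (z : R[i]) (f : H) : H :=
  xget 0 [set g | dom T g /\ z *: g - T g = f].

Definition compact_resolvent T : Prop :=
  exists z : R[i], resolvent_set T z /\ compact_operator (resolvent T z).

(* A = A^*, the right-hand side being the graph of the adjoint *)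
Definition self_adjoint A : Prop :=
  dense (dom A) /\
  forall g h, (dom A g /\ A g = h) <->
              (forall f, dom A f -> dot (A f) g = dot f h).

(* S = A^(1/2): the nonnegative self-adjoint operator with S^2 = A *)
Definition is_sqrt A S : Prop :=
  [/\ self_adjoint S,
      forall f, dom S f -> 0 <= dot (S f) f,
      dom A = [set f | dom S f /\ dom S (S f)] &
      forall f, dom A f -> A f = S (S f)].

(* mu_n is an eigenvalue with one-dimensional eigenspace spanned by the unit
   vector psi_n; for self-adjoint A this is simplicity of the eigenvalue. *)
Definition simple_eigenpair A (mu : R) (psi : H) : Prop :=
  [/\ dom A psi, A psi = mu%:C *: psi, `|psi| = 1 &
      forall f, dom A f -> A f = mu%:C *: f -> exists c : R[i], f = c *: psi].

Definition sesquilinear_on D v : Prop :=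
  (forall (a : R[i]) f1 f2 g, D f1 -> D f2 -> D g ->
     v (a *: f1 + f2) g = a * v f1 g + v f2 g) /\
  (forall (a : R[i]) f g1 g2, D f -> D g1 -> D g2 ->
     v f (a *: g1 + g2) = Num.conj a * v f g1 + v f g2).

(* boundedness on dom S equipped with the inner product <S f, S g> *)
Definition bounded_form S v : Prop :=
  exists M : R, forall f g, dom S f -> dom S g ->
    `|v f g| <= M%:C * (`|S f| * `|S g|).

Definition sqrt_form S : H -> H -> R[i] := fun f g => dot (S f) (S g).

(* T is the operator that the first representation theorem associates with
   the form t of domain D. *)
Definition associated_operator D t T : Prop :=
  forall f h, (dom T f /\ T f = h) <->
              (D f /\ forall g, D g -> t f g = dot h g).

End Operators.

Section ContourIntegrals.
Context {R : realType} {H : completeNormedModType R[i]}.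

(* Paths are parametrised by [0, 1]; a contour is a list of paths. *)
Definition tagged_partition (n : nat) (t s : nat -> R) : Prop :=
  [/\ t 0%N = 0, t n = 1 &
      forall i, (i < n)%N -> t i <= s i /\ s i <= t i.+1].

(* B is the integral of F(z) dz along gamma, as the limit in the operator norm
   of the sums  \sum_i (gamma(t_{i+1}) - gamma(t_i)) F(gamma(s_i)). *)
Definition path_integral (gamma : R -> R[i]) (F : R[i] -> H -> H) (B : H -> H)
    : Prop :=
  forall e : R, 0 < e -> exists2 d : R, 0 < d &
    forall (n : nat) (t s : nat -> R), tagged_partition n t s ->
      (forall i, (i < n)%N -> t i.+1 - t i < d) ->
      forall f : H,
        `|\sum_(i < n) (gamma (t i.+1) - gamma (t i)) *: F (gamma (s i)) f
          - B f| <= e%:C * `|f|.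

Fixpoint contour_integral (c : seq (R -> R[i])) (F : R[i] -> H -> H)
    (B : H -> H) : Prop :=
  if c is gamma :: c' then
    exists B1 B2 : H -> H, [/\ path_integral gamma F B1,
      contour_integral c' F B2 & forall f, B f = B1 f + B2 f]
  else forall f, B f = 0.

Fixpoint on_contour (c : seq (R -> R[i])) (z : R[i]) : Prop :=
  if c is gamma :: c' then
    (exists2 t : R, 0 <= t <= 1 & z = gamma t) \/ on_contour c' z
  else False.

Definition riesz_projection (T : operator H) (c : seq (R -> R[i]))
    (P : H -> H) : Prop :=
  on_contour c `<=` resolvent_set T /\
  exists2 I : H -> H, contour_integral c (resolvent T) I &
    forall f, P f = (0 +i* (2 * pi))^-1 *: I f.

Definition segment (a b : R[i]) : R -> R[i] := fun t => a + t%:C * (b - a).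

(* both positively oriented *)
Definition circle (c r : R) : seq (R -> R[i]) :=
  [:: fun t => (c + r * cos (2 * pi * t)) +i* (r * sin (2 * pi * t))].

Definition rectangle (x1 x2 y1 y2 : R) : seq (R -> R[i]) :=
  [:: segment (x1 +i* y1) (x2 +i* y1); segment (x2 +i* y1) (x2 +i* y2);
      segment (x2 +i* y2) (x1 +i* y2); segment (x1 +i* y2) (x1 +i* y1)].

End ContourIntegrals.

Section Regions.
Context {R : realType}.
(* Sequences indexed by {1, 2, 3, ...} are encoded as functions on nat with the
   index shifted by one: mu n stands for mu_{n+1}. *)
Variable mu : nat -> R.

Definition gap (n : nat) : R :=
  if n is m.+1 then Num.min (mu n - mu m) (mu n.+1 - mu n) / 2
  else (mu 1%N - mu 0%N) / 2.

Definition Pi0 (N : nat) (h1 h2 : R) : set R[i] :=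
  [set z | - h1 < complex.Re z <= mu N + gap N /\ `|complex.Im z| <= h2].

Definition PiD (k : nat) : set R[i] := [set z | `|z - (mu k)%:C| < (gap k)%:C].

Definition boundary (E : set R[i]) : set R[i] :=
  closure (E : set R[i]^o) `\` interior (E : set R[i]^o).

Definition Pi0_contour (N : nat) (h1 h2 : R) : seq (R -> R[i]) :=
  rectangle (- h1) (mu N + gap N) (- h2) h2.

Definition PiD_contour (k : nat) : seq (R -> R[i]) := circle (mu k) (gap k).

End Regions.

(* Main.v *)
Require Import Defs.
From HB Require Import structures.
From mathcomp Require Import all_boot all_order all_algebra.
From mathcomp Require Import complex.
From mathcomp Require Import all_classical all_reals all_analysis.
From mathcomp Require Import ring lra.

(** The matrix of the perturbation v in the eigenbasis of A is dominated by the rank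
   one matrix omega_j omega_k. Therefore, if the sum of the omega_k^2 / |z - mu_k| is
   at most 1/2, the point z belongs to the resolvent set of T, and the matrix of
   (z - T)^-1 - (z - A)^-1 is dominated by
   2 (omega_j / |z - mu_j|) (omega_k / |z - mu_k|); see [solves_exists] and
   [resolvent_diff]. The gap condition makes that sum small wherever the distances to
   the eigenvalues are comparable to those of the points of some circle Gamma_k with
   large k. This is so on all contours and outside of all regions ([annulus_near],
   [outer_near], [right_near]), which localises the spectrum.

   Integrating the domination over Gamma_k gives that the coordinate k of
   (P_k - P_k^0) f is at most 8 times the sum over i of
   omega_k omega_i |f_i| / |mu_k - mu_i|, with r_k as denominator for i = k; summed
   over k > N_0 these are controlled by Schur's test, whose row and column sums are
   those of the gap condition ([circle_diff], [schur_test]). On the rectangle the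
   integral of |dz| / |z - mu_j|^2 is O(1 / a_j), where a_j is the distance from mu_j
   to the right side, and the domination integrates to a rank one matrix of small norm
   ([rect_diff]). Consequently the operator

     W = S_0^0 S_0 + sum over k > N_0 of P_k^0 P_k

   satisfies |W - 1| <= 1/2 and is boundedly invertible ([dev_le], [neumann]). In both
   families the operators are projections whose mutual products vanish. So
   P_k^0 W = P_k^0 P_k = W P_k and S_0^0 W = W S_0, which is the similarity
   ([similarity]).

   The products of two Riesz projections are double integrals of products of
   resolvents. The resolvent identity and partial fractions turn them into single
   integrals weighted with winding numbers ([resolvent_product]). Neighbouring contours
   may touch, half way between two eigenvalues, and a contour meets itself in the proof
   of idempotence; so the first contour is shrunk a little, and the shrinking is undone
   by continuity ([resolvent_product_limit]). Integrals are limits of uniform Riemann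
   sums with rate 1/m, and winding numbers are computed for these sums: directly at the
   centre of a circle or rectangle, and elsewhere by moving the point along a segment,
   to the centre or to infinity ([cauchy_sum_segment]).

   On the side of A, the eigenvectors are complete because the resolvent is compact
   ([psi_total]), and A^(1/2) is diagonal with the largest possible domain
   ([sqrt_diagonal_root]). *)

Set Implicit Arguments.
Unset Strict Implicit.
Unset Printing Implicit Defensive.

Import Order.TTheory GRing.Theory Num.Def Num.Theory.
Import numFieldNormedType.Exports.

Local Open Scope classical_set_scope.
Local Open Scope ring_scope.
Local Open Scope complex_scope.

(** * Real-valued norms *)

(** Norms over R[i] take their values in R[i]; [nr] reads them as real numbers,
   so that estimates take place in an ordered field. *)
Definition nr (R : realType) (V : normedZmodType R[i]) (x : V) : R :=
  complex.Re `|x|.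

Section RealNorm.
Context {R : realType}.
Implicit Types (z w : R[i]) (x : R).

Lemma le_of_eq (x y : R) : x = y -> x <= y.
Proof. by move=> ->. Qed.

Lemma eq_ReIm z w : complex.Re z = complex.Re w -> complex.Im z = complex.Im w -> z = w.
Proof. by case: z w => [a b] [c d] /= -> ->. Qed.

Lemma sum_div_const (m : nat) x : \sum_(i < m.+1) x / m.+1%:R = x.
Proof. by rewrite sumr_const card_ord -[LHS]mulr_natr divfK ?pnatr_eq0. Qed.

Lemma real_complexD (x y : R) : (x + y)%:C = x%:C + y%:C.
Proof. exact: rmorphD. Qed.

Lemma real_complexM (x y : R) : (x * y)%:C = x%:C * y%:C.
Proof. exact: rmorphM. Qed.

Lemma ler_complex (x y : R) : (x%:C <= y%:C) = (x <= y).
Proof. by rewrite lecE /= eqxx. Qed.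

Lemma ltr_complex (x y : R) : (x%:C < y%:C) = (x < y).
Proof. by rewrite ltcE /= eqxx. Qed.

Section Generic.
Context {V : normedZmodType R[i]}.
Implicit Types u v : V.

Lemma nrE u : `|u| = (nr u)%:C.
Proof.
have : 0 <= `|u| by exact: normr_ge0.
by rewrite lecE /nr; case: `|u| => a b /= /andP[/eqP-> _].
Qed.

Lemma nr_ge0 u : 0 <= nr u.
Proof. by rewrite -ler_complex -nrE normr_ge0. Qed.

Lemma nr0 : nr (0 : V) = 0.
Proof. by rewrite /nr normr0. Qed.

Lemma nrN u : nr (- u) = nr u.
Proof. by rewrite /nr normrN. Qed.

Lemma nrB u v : nr (u - v) = nr (v - u).
Proof. by rewrite /nr distrC. Qed.

Lemma nrD u v : nr (u + v) <= nr u + nr v.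
Proof. by rewrite -ler_complex real_complexD -!nrE ler_normD. Qed.

Lemma nr_subr u v : nr (u - v) <= nr u + nr v.
Proof. by rewrite -(nrN v) nrD. Qed.

Lemma nr_triangle v u (t : V) : nr (u - t) <= nr (u - v) + nr (v - t).
Proof. by rewrite -[u - t](subrKA v) nrD. Qed.

Lemma nr_le_sub u v : nr u <= nr v + nr (u - v).
Proof. by rewrite -{1}(subrK v u) addrC nrD. Qed.

Lemma nr_eq0 u : nr u = 0 -> u = 0.
Proof. by move=> h; apply/eqP; rewrite -normr_eq0 nrE h. Qed.

Lemma nr_sum (I : Type) (r : seq I) (P : pred I) (F : I -> V) :
  nr (\sum_(i <- r | P i) F i) <= \sum_(i <- r | P i) nr (F i).
Proof.
elim/big_rec2: _ => [|i y1 y2 _ h]; first by rewrite nr0.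
by rewrite (le_trans (nrD _ _))// lerD2l.
Qed.

Lemma nr_le0 u : nr u <= 0 -> u = 0.
Proof. by move=> h; apply: nr_eq0; apply/eqP; rewrite eq_le h nr_ge0. Qed.

Lemma nr_small0 u : (forall e : R, 0 < e -> nr u <= e) -> u = 0.
Proof.
by move=> h; apply: nr_le0; apply/ler_addgt0Pr => e e0; rewrite add0r h.
Qed.

Lemma nr_small_eq u v : (forall e : R, 0 < e -> nr (u - v) <= e) -> u = v.
Proof. by move=> h; apply/eqP; rewrite -subr_eq0; apply/eqP; exact: nr_small0. Qed.

Lemma nr_le_lim u (M : R) :
  (forall e : R, 0 < e -> exists2 v, nr (u - v) <= e & nr v <= M) -> nr u <= M.
Proof.
move=> h; apply/ler_addgt0Pr => e /h[v uv vM].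
by rewrite (le_trans (nr_le_sub u v))// lerD.
Qed.

End Generic.
Hint Resolve nr_ge0 : core.

Lemma nrZ (V : normedModType R[i]) z (u : V) : nr (z *: u) = nr z * nr u.
Proof. by apply/(@complexI R); rewrite real_complexM -!nrE normrZ. Qed.

Lemma nrM z w : nr (z * w) = nr z * nr w.
Proof. by apply/(@complexI R); rewrite real_complexM -!nrE normrM. Qed.

Lemma nrV z : nr z^-1 = (nr z)^-1.
Proof. by apply/(@complexI R); rewrite fmorphV -!nrE normfV. Qed.

Lemma nrf_div z w : nr (z / w) = nr z / nr w.
Proof. by rewrite nrM nrV. Qed.

Lemma nr_real x : nr x%:C = `|x|.
Proof. by rewrite /nr normc_def /= expr0n /= addr0 sqrtr_sqr. Qed.

Lemma nr1 : nr (1 : R[i]) = 1.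
Proof. by rewrite -[1]/(1%:C) nr_real normr1. Qed.

Lemma nr_sqr z : nr z ^+ 2 = complex.Re z ^+ 2 + complex.Im z ^+ 2.
Proof. by apply/(@complexI R); rewrite rmorphXn /= -nrE -add_Re2_Im2. Qed.

Lemma nr_eq_sqr z x : 0 <= x -> complex.Re z ^+ 2 + complex.Im z ^+ 2 = x ^+ 2 -> nr z = x.
Proof. by move=> x0; rewrite -nr_sqr => /(pexpIrn (n := 2) isT); apply; rewrite nnegrE. Qed.

Lemma conj_real x : Num.conj x%:C = x%:C :> R[i].
Proof. by apply: eq_ReIm; rewrite /= ?oppr0. Qed.

Lemma nr_conj z : nr (Num.conj z) = nr z.
Proof. by rewrite /nr norm_conjC. Qed.

Lemma nr_Re z : `|complex.Re z| <= nr z.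
Proof.
rewrite -ler_sqr ?nnegrE//// nr_sqr real_normK ?num_real//.
by rewrite lerDl sqr_ge0.
Qed.

Lemma nr_Im z : `|complex.Im z| <= nr z.
Proof.
rewrite -ler_sqr ?nnegrE//// nr_sqr real_normK ?num_real//.
by rewrite lerDr sqr_ge0.
Qed.

Lemma nr_ReIm z : nr z <= `|complex.Re z| + `|complex.Im z|.
Proof.
rewrite -ler_sqr ?nnegrE ?addr_ge0// nr_sqr.
rewrite sqrrD !real_normK ?num_real// [leRHS]addrAC lerDl.
by rewrite mulrn_wge0// mulr_ge0.
Qed.

Lemma nr_neq0 z : 0 < nr z -> z != 0.
Proof. by rewrite -normr_gt0 nrE ltr_complex. Qed.

Lemma Re_unit_le (e z : R[i]) : nr e = 1 -> complex.Re (Num.conj e * z) <= nr z.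
Proof.
move=> e1; have := nr_Re (Num.conj e * z).
by rewrite nrM nr_conj e1 mul1r => /(le_trans (ler_norm _)).
Qed.

Lemma nr_cauchy_lim (H : completeNormedModType R[i]) (u : nat -> H) :
  (forall e : R, 0 < e -> exists N : nat, forall m n,
      (N <= m)%N -> (N <= n)%N -> nr (u m - u n) <= e) ->
  exists l, forall e : R, 0 < e -> exists N : nat, forall n,
      (N <= n)%N -> nr (l - u n) <= e.
Proof.
move=> cau; have cu : cvg (u @ \oo).
  apply/cauchy_cvgP/cauchy_exP => e e0.
  have [e' e'0 e'e] : exists2 e' : R, 0 < e' & e'%:C < e.
    move: e0; rewrite ltcE => /andP[/eqP ie re]; exists (complex.Re e / 2).
      by rewrite divr_gt0.
    by rewrite ltcE /= ie eqxx /= ltr_pdivrMr// ltr_pMr// ltr1n.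
  have [N hN] := cau _ e'0.
  exists (u N); exists N => // n /= Nn; rewrite -ball_normE /=.
  by rewrite (le_lt_trans _ e'e)// nrE ler_complex hN.
exists (lim (u @ \oo)) => e e0.
have /cvgrPdist_le /(_ e%:C) := cu; rewrite -[0]/(0%:C) ltr_complex => /(_ e0).
case=> N _ hN; exists N => n Nn.
by rewrite -ler_complex -nrE; exact: hN.
Qed.

End RealNorm.

#[global] Hint Extern 0 (is_true (0 <= nr _)) => exact: nr_ge0 : core.

(** * Riemann sums along contours *)

Section RiemannSums.
Context {R : realType} {V : normedModType R[i]}.
Implicit Types (gamma : R -> R[i]) (phi : R -> V) (t s : nat -> R).

Definition lipschitz_path (K : R) gamma : Prop :=
  forall x y, 0 <= x <= 1 -> 0 <= y <= 1 ->
    nr (gamma x - gamma y) <= K * `|x - y|.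

Definition riemann_sum gamma phi (n : nat) t s : V :=
  \sum_(i < n) (gamma (t i.+1) - gamma (t i)) *: phi (s i).

(** The point of [a, b] closest to x. *)
Definition clamp (a b x : R) : R := Num.max a (Num.min x b).

Lemma clamp_le (a b x y : R) : x <= y -> clamp a b x <= clamp a b y.
Proof.
move=> xy; rewrite /clamp ge_max le_max lexx/= le_max.
by rewrite le_min !ge_min xy lexx /= orbT orbT.
Qed.

Lemma clamp_lo (a b x : R) : a <= b -> x <= a -> clamp a b x = a.
Proof.
move=> ab xa; rewrite /clamp; apply/max_idPl.
by rewrite ge_min xa.
Qed.

Lemma clamp_hi (a b x : R) : a <= b -> b <= x -> clamp a b x = b.
Proof.
by move=> ab bx; rewrite /clamp (min_idPr bx); apply/max_idPr.
Qed.

Lemma clamp_in (a b x : R) : a <= b -> a <= clamp a b x <= b.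
Proof.
by move=> ab; rewrite /clamp le_max lexx /= ge_max ab /= ge_min lexx orbT.
Qed.

Lemma tagged_partition_mono n t s : tagged_partition n t s ->
  forall i, (i < n)%N -> t i <= t i.+1.
Proof. by case=> _ _ h i /h[]; exact: le_trans. Qed.

Lemma tagged_partition_in01 n t s : tagged_partition n t s ->
  forall i, (i <= n)%N -> 0 <= t i <= 1.
Proof.
move=> H; have [t0 tn _] := H; have mono := tagged_partition_mono H.
have lo i : (i <= n)%N -> 0 <= t i.
  elim: i => [|i ih] lin; first by rewrite t0.
  by rewrite (le_trans (ih (ltnW lin)))// mono.
have hi k : (k <= n)%N -> t (n - k)%N <= 1.
  elim: k => [|k ih] kn; first by rewrite subn0 tn.
  rewrite (le_trans _ (ih (ltnW kn)))//.
  have -> : (n - k)%N = (n - k.+1).+1 by rewrite subnS prednK// subn_gt0.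
  by rewrite mono// ltn_subrL/= (leq_ltn_trans _ kn).
by move=> i lin; rewrite lo//= -(subKn lin) hi// leq_subr.
Qed.

Lemma sum_clamp gamma n t s (x : R) : tagged_partition n t s -> 0 <= x <= 1 ->
  \sum_(i < n) (gamma (clamp (t i) (t i.+1) x) - gamma (t i))
  = gamma x - gamma 0.
Proof.
move=> H /andP[x0 x1]; have [t0 tn _] := H; have mono := tagged_partition_mono H.
suff h m : (m <= n)%N ->
    \sum_(i < m) (gamma (clamp (t i) (t i.+1) x) - gamma (t i))
    = gamma (Num.min x (t m)) - gamma 0.
  by rewrite h// tn (min_idPl x1).
elim: m => [|m ih] mn; first by rewrite big_ord0 t0 (min_idPr x0) subrr.
rewrite big_ord_recr/= ih ?(ltnW mn)//.
have tm := mono _ mn.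
have [xt|tx] := leP x (t m).
  by rewrite clamp_lo// (min_idPl (le_trans xt tm)) subrr addr0.
rewrite /clamp.
have -> : Num.max (t m) (Num.min x (t m.+1)) = Num.min x (t m.+1).
  by apply/max_idPr; rewrite le_min (ltW tx) tm.
by rewrite [LHS]addrC subrKA.
Qed.

(** Both sums are refined to the overlaps of the two partitions. On the overlap
   of an interval of one with an interval of the other, the two tags are at
   distance at most the sum of the mesh sizes. *)
Lemma riemann_sum_compare gamma phi (K L d d' : R) n t s n' t' s' :
  0 <= K -> 0 <= L ->
  lipschitz_path K gamma ->
  (forall x y, 0 <= x <= 1 -> 0 <= y <= 1 -> nr (phi x - phi y) <= L * `|x - y|) ->
  tagged_partition n t s -> tagged_partition n' t' s' ->
  (forall i, (i < n)%N -> t i.+1 - t i <= d) ->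
  (forall i, (i < n')%N -> t' i.+1 - t' i <= d') ->
  nr (riemann_sum gamma phi n t s - riemann_sum gamma phi n' t' s')
    <= K * L * (d + d').
Proof.
move=> K0 L0 gK phiL H H' hd hd'.
have m := tagged_partition_mono H; have m' := tagged_partition_mono H'.
have i01 := tagged_partition_in01 H; have i01' := tagged_partition_in01 H'.
have [t0 tn hs] := H; have [t0' tn' hs'] := H'.
pose c i x := clamp (t i) (t i.+1) x.
pose p i k := gamma (c i (t' k.+1)) - gamma (c i (t' k)).
have row i : (i < n)%N -> \sum_(k < n') p i k = gamma (t i.+1) - gamma (t i).
  move=> lin; rewrite -(big_mkord xpredT (p i)).
  rewrite (telescope_sumr (fun k => gamma (c i (t' k))))//.
  have /andP[ti0 _] := i01 i (ltnW lin).
  have /andP[_ ti1] := i01 i.+1 lin.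
  by rewrite t0' tn' /c clamp_hi ?m// clamp_lo ?m.
have col k : (k < n')%N -> \sum_(i < n) p i k = gamma (t' k.+1) - gamma (t' k).
  move=> kn; transitivity ((gamma (t' k.+1) - gamma 0) - (gamma (t' k) - gamma 0)).
    rewrite -(sum_clamp gamma H (i01' k.+1 kn)).
    rewrite -(sum_clamp gamma H (i01' k (ltnW kn))) -sumrB.
    by apply: eq_bigr => i _; rewrite /p /c; ring.
  by ring.
have -> : riemann_sum gamma phi n t s - riemann_sum gamma phi n' t' s' =
    \sum_(i < n) \sum_(k < n') p i k *: (phi (s i) - phi (s' k)).
  transitivity (\sum_(i < n) (\sum_(k < n') p i k *: phi (s i)
      - \sum_(k < n') p i k *: phi (s' k))); last first.
    by apply: eq_bigr => i _; rewrite -sumrB; apply: eq_bigr => k _;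
      rewrite scalerBr.
  rewrite sumrB; congr (_ - _).
    by rewrite /riemann_sum; apply: eq_bigr => i _; rewrite -scaler_suml row.
  rewrite exchange_big /riemann_sum; apply: eq_bigr => k _.
  by rewrite -scaler_suml col.
have key (i : 'I_n) (k : 'I_n') :
    nr (p i k *: (phi (s i) - phi (s' k))) <=
    K * L * (d + d') * (c i (t' k.+1) - c i (t' k)).
  have tin := ltn_ord i; have tkn := ltn_ord k.
  have mi := m _ tin; have mk := m' _ tkn.
  have zero : c i (t' k.+1) = c i (t' k) ->
    nr (p i k *: (phi (s i) - phi (s' k))) <=
    K * L * (d + d') * (c i (t' k.+1) - c i (t' k)).
    by move=> e; rewrite /p e !subrr scale0r nr0 mulr0.
  have [h1|h1] := leP (t i.+1) (t' k).
    by apply: zero; rewrite /c !clamp_hi// (le_trans h1).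
  have [h2|h2] := leP (t' k.+1) (t i).
    by apply: zero; rewrite /c !clamp_lo// (le_trans mk).
  have [s1 s2] := hs _ tin; have [s1' s2'] := hs' _ tkn.
  have cle : c i (t' k) <= c i (t' k.+1) by exact: clamp_le.
  have := i01 _ tin; have := i01 _ (ltnW tin).
  have := i01' _ tkn; have := i01' _ (ltnW tkn).
  move=> /andP[q1 q2] /andP[q3 q4] /andP[q5 q6] /andP[q7 q8].
  rewrite nrZ.
  have /andP[b1 b2] := clamp_in (t' k) mi.
  have /andP[b3 b4] := clamp_in (t' k.+1) mi.
  have g1 : nr (p i k) <= K * (c i (t' k.+1) - c i (t' k)).
    rewrite (le_trans (gK _ _ _ _))//.
    - by rewrite (le_trans q5 b3) (le_trans b4 q8).
    - by rewrite (le_trans q5 b1) (le_trans b2 q8).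
    - by rewrite ger0_norm ?subr_ge0.
  have g2 : nr (phi (s i) - phi (s' k)) <= L * (d + d').
    rewrite (le_trans (phiL _ _ _ _))//.
    - by rewrite (le_trans q5 s1) (le_trans s2 q8).
    - by rewrite (le_trans q1 s1') (le_trans s2' q4).
    - rewrite ler_wpM2l// ler_norml.
      have := hd _ tin; have := hd' _ tkn; lra.
  rewrite (le_trans (ler_pM (nr_ge0 _) (nr_ge0 _) g1 g2))//.
  by apply: le_of_eq; ring.
rewrite (le_trans (nr_sum _ _ _))//.
apply: (@le_trans _ _ (\sum_(i < n) K * L * (d + d') * (t i.+1 - t i))).
  apply: ler_sum => i _; rewrite (le_trans (nr_sum _ _ _))//.
  rewrite (le_trans (ler_sum _ (fun k _ => key i k)))// -mulr_sumr.
  rewrite -(big_mkord xpredT (fun k => c i (t' k.+1) - c i (t' k))).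
  rewrite (telescope_sumr (fun k => c i (t' k)))//.
  have tin := ltn_ord i; have mi := m _ tin.
  have /andP[ti0 _] := i01 i (ltnW tin).
  have /andP[_ ti1] := i01 i.+1 tin.
  by rewrite t0' tn' /c clamp_hi// clamp_lo.
rewrite -mulr_sumr -(big_mkord xpredT (fun i => t i.+1 - t i)).
by rewrite telescope_sumr// t0 tn subr0 mulr1.
Qed.

Definition node (m i : nat) : R := i%:R / m.+1%:R.

Lemma node_partition m : tagged_partition m.+1 (node m) (node m).
Proof.
split; rewrite /node ?mul0r ?divff// => i im; split => //.
by rewrite ler_pM2r ?invr_gt0// ler_nat.
Qed.

Lemma node_in01 m i : (i <= m.+1)%N -> 0 <= node m i <= 1.
Proof. exact: (tagged_partition_in01 (node_partition m)). Qed.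

Lemma node_step m i : node m i.+1 - node m i = m.+1%:R^-1.
Proof. by rewrite /node -mulrBl -natrB// subSnn mul1r. Qed.

Definition step gamma (m i : nat) : R[i] :=
  gamma (node m i.+1) - gamma (node m i).

(** The left Riemann sum of the uniform partition into m + 1 intervals. *)
Definition contour_sum (c : seq (R -> R[i])) (G : R[i] -> V) (m : nat) : V :=
  \sum_(gamma <- c) \sum_(i < m.+1) step gamma m i *: G (gamma (node m i)).

Lemma step_le K gamma m i : lipschitz_path K gamma -> (i < m.+1)%N ->
  nr (step gamma m i) <= K / m.+1%:R.
Proof.
move=> gK im; rewrite (le_trans (gK _ _ _ _)) ?node_in01// ?(ltnW im)//.
by rewrite node_step ger0_norm.
Qed.

End RiemannSums.

Lemma archi_inv (R : realType) (C e : R) : 0 < e ->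
  exists N : nat, forall n, (N <= n)%N -> C / n.+1%:R <= e.
Proof.
move=> e0; exists (Num.bound (`|C| / e)) => n Nn.
rewrite ler_pdivrMr// mulrC -ler_pdivrMr//.
rewrite (@le_trans _ _ (`|C| / e))// ?ler_pM2r ?invr_gt0// ?ler_norm//.
rewrite ltW// (lt_le_trans (archi_boundP _)) ?divr_ge0 ?(ltW e0)//.
by rewrite ler_nat (leq_trans Nn).
Qed.

Lemma archi_le0 (R : realType) (C x : R) :
  (forall n : nat, x <= C / n.+1%:R) -> x <= 0.
Proof.
move=> h; apply/ler_addgt0Pr => e /(archi_inv C)[N hN]; rewrite add0r.
exact: le_trans (h N) (hN N (leqnn N)).
Qed.

Section ContourIntegral.
Context {R : realType} {H : completeNormedModType R[i]}.
Implicit Types (gamma : R -> R[i]) (c : seq (R -> R[i])) (F : R[i] -> H -> H).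

(** [B] is the limit of the uniform Riemann sums in the operator norm, with
   rate 1/m. The rate survives under a second integral sign, as in the products
   of Riesz projections. *)
Definition contour_limit c F (B : H -> H) : Prop :=
  exists C : R, forall m f,
    nr (contour_sum c (F^~ f) m - B f) <= C / m.+1%:R * nr f.

Lemma path_integral_exists gamma F (K L : R) : 0 <= K -> 0 <= L ->
  lipschitz_path K gamma ->
  (forall f x y, 0 <= x <= 1 -> 0 <= y <= 1 ->
     nr (F (gamma x) f - F (gamma y) f) <= L * nr f * `|x - y|) ->
  exists B, path_integral gamma F B /\ contour_limit [:: gamma] F B.
Proof.
move=> K0 L0 gK FL.
pose S m f := riemann_sum gamma (fun x => F (gamma x) f) m.+1 (node m) (node m).
have cmp n t s d m f : tagged_partition n t s ->
    (forall i, (i < n)%N -> t i.+1 - t i <= d) ->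
    nr (riemann_sum gamma (fun x => F (gamma x) f) n t s - S m f) <=
    K * L * nr f * (d + m.+1%:R^-1).
  move=> ts hd; rewrite -(mulrA K).
  apply: (riemann_sum_compare K0 _ gK (FL f) ts (node_partition m) hd).
    by rewrite mulr_ge0.
  by move=> i _; rewrite node_step.
have mesh k i : (i < k.+1)%N -> node k i.+1 - node k i <= k.+1%:R^-1 :> R.
  by rewrite node_step.
have lims f : exists l, forall e : R, 0 < e ->
    exists N : nat, forall n, (N <= n)%N -> nr (l - S n f) <= e.
  apply: nr_cauchy_lim => e e0.
  have [N hN] := archi_inv (K * L * nr f * 2) e0.
  exists N => m n Nm Nn.
  rewrite (le_trans (cmp _ _ _ _ _ _ (node_partition m) (mesh m)))//.
  rewrite (le_trans _ (hN N (leqnn N)))// -[leRHS]mulrA.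
  rewrite ler_wpM2l ?mulr_ge0//.
  rewrite mulr_natl mulr2n.
  by rewrite lerD// lef_pV2 ?posrE// ler_nat.
pose B f := sval (cid (lims f)).
have BP n t s d f : tagged_partition n t s ->
    (forall i, (i < n)%N -> t i.+1 - t i <= d) ->
    nr (riemann_sum gamma (fun x => F (gamma x) f) n t s - B f)
      <= K * L * nr f * d.
  move=> ts hd; apply/ler_addgt0Pr => e e0.
  have e20 : 0 < e / 2 by rewrite divr_gt0.
  have [N1 hN1] := svalP (cid (lims f)) _ e20.
  have [N2 hN2] := archi_inv (K * L * nr f) e20.
  pose N := maxn N1 N2.
  rewrite (le_trans (nr_triangle (S N f) _ _))//.
  have b1 := cmp _ _ _ _ N f ts hd.
  have b2 := hN1 N (leq_maxl _ _).
  have b3 := hN2 N (leq_maxr _ _).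
  rewrite nrB in b2; rewrite mulrDr in b1; rewrite /B.
  apply: (le_trans (lerD b1 b2)); rewrite -addrA lerD2l [leRHS]splitr lerD2r.
  exact: b3.
exists B; split.
  move=> e e0; exists (e / (K * L + 1)).
    by rewrite divr_gt0// ltr_wpDl// mulr_ge0.
  move=> n t s ts hd f; rewrite !nrE -real_complexM ler_complex.
  have KL0 : 0 <= K * L by rewrite mulr_ge0.
  rewrite (le_trans (BP _ _ _ (e / (K * L + 1)) f ts _))//.
    by move=> i /hd /ltW.
  rewrite mulrAC ler_wpM2r// mulrCA ler_piMr ?(ltW e0)//.
  by rewrite ler_pdivrMr ?mul1r ?lerDl// ltr_wpDl.
exists (K * L) => m f; rewrite /contour_sum big_seq1.
have := BP _ _ _ _ f (node_partition m) (mesh m).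
by rewrite mulrAC.
Qed.

Lemma on_contourP c (z : R[i]) : on_contour c z <->
  exists gamma, gamma \in c /\ exists2 t : R, 0 <= t <= 1 & z = gamma t.
Proof.
elim: c => [|g c ih] /=; first by split => // -[? []].
rewrite ih; split.
  case=> [[t t1 ->]|[g' [g'c h]]].
    by exists g; rewrite mem_head; split => //; exists t.
  by exists g'; rewrite inE g'c orbT.
move=> [g' []]; rewrite inE => /orP[/eqP-> h|g'c h]; first by left.
by right; exists g'.
Qed.

(** A Lipschitz integrand along Lipschitz paths suffices; the sums over any two
   partitions then differ by a multiple of their meshes, by
   [riemann_sum_compare]. *)
Lemma contour_integral_exists c F (K L : R) : 0 <= K -> 0 <= L ->
  (forall gamma, gamma \in c -> lipschitz_path K gamma) ->
  (forall z w f, on_contour c z -> on_contour c w ->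
     nr (F z f - F w f) <= L * nr f * nr (z - w)) ->
  exists B, contour_integral c F B /\ contour_limit c F B.
Proof.
move=> K0 L0; elim: c => [|g c ih] cK FL.
  exists (fun=> 0); split => //=; exists 0 => m f.
  by rewrite /contour_sum big_nil subrr nr0 !mul0r.
have [|z w f zc wc|B2 [B2i [C2 B2l]]] := ih.
- by move=> g' g'c; apply: cK; rewrite inE g'c orbT.
- by apply: FL; right.
have gK : lipschitz_path K g by apply: cK; rewrite mem_head.
have [|f x y x1 y1|B1 [B1i [C1 B1l]]] :=
    @path_integral_exists g F K (L * K) K0 _ gK.
- exact: mulr_ge0.
- rewrite (le_trans (FL _ _ _ _ _))//; [by left; exists x|by left; exists y|].
  by rewrite mulrAC [leRHS]mulrAC ler_wpM2r// -mulrA ler_wpM2l// gK.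
exists (fun f => B1 f + B2 f); split; first by exists B1, B2.
exists (C1 + C2) => m f; rewrite /contour_sum big_cons opprD addrACA.
rewrite (le_trans (nrD _ _))// !mulrDl lerD//; last exact: B2l.
by have := B1l m f; rewrite /contour_sum big_seq1.
Qed.

Lemma contour_sum_le c (G : R[i] -> H) (K M : R) m : 0 <= K -> 
  (forall gamma, gamma \in c -> lipschitz_path K gamma) ->
  (forall z, on_contour c z -> nr (G z) <= M) ->
  nr (contour_sum c G m) <= K * (size c)%:R * M.
Proof.
move=> K0 cK GM; rewrite /contour_sum (le_trans (nr_sum _ _ _))//.
rewrite -mulrA mulrCA -sum1_size natr_sum mulr_suml big_seq [leRHS]big_seq.
apply: ler_sum => g gc; rewrite mul1r (le_trans (nr_sum _ _ _))//.
rewrite (@le_trans _ _ (\sum_(i < m.+1) K / m.+1%:R * M))//.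
  apply: ler_sum => i _; rewrite nrZ ler_pM//.
    by apply: step_le => //; exact: cK.
  apply: GM; apply/on_contourP; exists g; split => //.
  by exists (node m i) => //; rewrite node_in01// ltnW.
rewrite sumr_const card_ord -[leLHS]mulr_natr mulrAC divfK ?pnatr_eq0//.
Qed.

End ContourIntegral.

(** * Winding numbers *)

(* [field] reads m.+1%:R as 1 + m%:R; here it has to be an indeterminate. *)
Ltac field_nat R m :=
  let q := fresh in let q0 := fresh in
  have := negbT (pnatr_eq0 R m.+1); generalize (m.+1%:R : R); intros q q0;
  field; rewrite ?q0 ?gt_eqF.
Ltac field_nat2 R m n :=
  let q := fresh in let q0 := fresh in
  have := negbT (pnatr_eq0 R n.+1); generalize (n.+1%:R : R); intros q q0;
  let q' := fresh in let q'0 := fresh in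
  have := negbT (pnatr_eq0 R m.+1); generalize (m.+1%:R : R); intros q' q'0;
  field; rewrite ?q0 ?q'0 ?gt_eqF.

Section Winding.
Context {R : realType}.
Implicit Types (gamma : R -> R[i]) (c : seq (R -> R[i])) (z w : R[i]).

(** The Riemann sum of 2 pi i times the winding number of c about w. *)
Definition cauchy_sum c (m : nat) w : R[i] :=
  \sum_(gamma <- c) \sum_(i < m.+1) step gamma m i / (gamma (node m i) - w).

Definition lipschitz_contour (K : R) c : Prop :=
  forall gamma, gamma \in c -> lipschitz_path K gamma.

(** The end points are a rearrangement of the starting points; stated by sums,
   this is the form in which telescoping sums over the contour vanish. *)
Definition closed_contour c : Prop :=
  forall g : R[i] -> R[i], \sum_(gamma <- c) (g (gamma 1) - g (gamma 0)) = 0.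

Lemma on_node c gamma m i : gamma \in c -> (i <= m.+1)%N ->
  on_contour c (gamma (node m i)).
Proof.
move=> gc im; apply/on_contourP; exists gamma; split => //.
by exists (node m i) => //; exact: node_in01.
Qed.

Lemma double_sum_le (M : R) c m (a : (R -> R[i]) -> 'I_m.+1 -> R[i]) :
  (forall gamma (i : 'I_m.+1), gamma \in c -> (i < m.+1)%N ->
      nr (a gamma i) <= M / m.+1%:R) ->
  nr (\sum_(gamma <- c) \sum_(i < m.+1) a gamma i) <= (size c)%:R * M.
Proof.
move=> h; rewrite (le_trans (nr_sum _ _ _))//.
rewrite -sum1_size natr_sum mulr_suml big_seq [leRHS]big_seq.
apply: ler_sum => g gc; rewrite mul1r (le_trans (nr_sum _ _ _))//.
rewrite (@le_trans _ _ (\sum_(i < m.+1) M / m.+1%:R))//.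
  by apply: ler_sum => i _; exact: h.
by rewrite sum_div_const.
Qed.

(** The integral of dz/(z - w)^2 over a closed contour vanishes because
   (z' - z)/((z - w)(z' - w)) telescopes; hence the Cauchy integral is constant
   to first order in w. *)
Lemma cauchy_sum_local c (K d : R) m w w' : 0 <= K -> 0 < d ->
  lipschitz_contour K c -> closed_contour c ->
  (forall z, on_contour c z -> d <= nr (z - w)) ->
  (forall z, on_contour c z -> d <= nr (z - w')) ->
  nr (cauchy_sum c m w - cauchy_sum c m w') <=
  (size c)%:R * (K * nr (w - w') * (K / m.+1%:R + nr (w - w')) / d ^+ 3).
Proof.
move=> K0 d0 cK cc dw dw'.
have ne u : (forall z, on_contour c z -> d <= nr (z - u)) ->
    forall z, on_contour c z -> z - u != 0.
  by move=> h z /h dz; apply: nr_neq0; exact: lt_le_trans dz.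
pose b gamma i := step gamma m i * (w - w') /
  ((gamma (node m i) - w) * (gamma (node m i.+1) - w)).
have b0 : \sum_(gamma <- c) \sum_(i < m.+1) b gamma i = 0.
  apply: etrans (cc (fun z => (w - w') * - (z - w)^-1)).
  apply: eq_big_seq => g gc.
  have -> : g 1 = g (node m m.+1) by rewrite /node divff ?pnatr_eq0.
  have -> : g 0 = g (node m 0) by rewrite /node mul0r.
  rewrite -(telescope_sumr (fun i => (w - w') * - (g (node m i) - w)^-1))//.
  rewrite big_mkord; apply: eq_bigr => i _; rewrite /b /step.
  have n1 := ne _ dw _ (on_node gc (ltn_ord i)).
  have n2 := ne _ dw _ (on_node gc (ltnW (ltn_ord i))).
  by field; rewrite n1 n2.
rewrite -[X in nr X]subr0 -b0 /cauchy_sum -!sumrB.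
rewrite [X in nr X](_ : _ = \sum_(gamma <- c) \sum_(i < m.+1)
   (step gamma m i / (gamma (node m i) - w)
      - step gamma m i / (gamma (node m i) - w') - b gamma i)); last first.
  by apply: eq_bigr => g _; rewrite !sumrB.
apply: double_sum_le => g i gc im.
have n1 := ne _ dw _ (on_node gc im).
have n2 := ne _ dw _ (on_node gc (ltnW im)).
have n3 := ne _ dw' _ (on_node gc (ltnW im)).
rewrite [X in nr X](_ : _ = step g m i * (w - w') *
    (step g m i - (w - w')) / ((g (node m i) - w) *
    (g (node m i) - w') * (g (node m i.+1) - w))); last first.
  by rewrite /b /step; field; rewrite n1 n2 n3.
rewrite nrf_div !nrM.
have s1 := step_le (cK _ gc) im.
have l1 := dw _ (on_node gc im).
have l2 := dw _ (on_node gc (ltnW im)).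
have l3 := dw' _ (on_node gc (ltnW im)).
have den : d ^+ 3 <= nr (g (node m i) - w) * nr (g (node m i) - w') *
     nr (g (node m i.+1) - w).
  by rewrite !exprS expr0 mulr1 mulrA !ler_pM ?mulr_ge0 ?(ltW d0).
rewrite (@le_trans _ _ (K / m.+1%:R * nr (w - w') *
   (K / m.+1%:R + nr (w - w')) / d ^+ 3))//; last first.
  by apply: le_of_eq; field_nat R m.
apply: ler_pM; rewrite ?mulr_ge0 ?invr_ge0 ?mulr_ge0//.
  apply: ler_pM; rewrite ?mulr_ge0//.
    by rewrite ler_wpM2r.
  by rewrite (le_trans (nr_subr _ _))// lerD2r.
by rewrite lef_pV2 ?posrE ?exprn_gt0// (lt_le_trans _ den)// exprn_gt0.
Qed.

(** Subdividing the segment, the terms of [cauchy_sum_local] that are quadratic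
   in the distance disappear in the limit and those of order 1/m remain. *)
Lemma cauchy_sum_segment c (K d : R) m w w' : 0 <= K -> 0 < d ->
  lipschitz_contour K c -> closed_contour c ->
  (forall z (x : R), on_contour c z -> 0 <= x <= 1 ->
     d <= nr (z - (w + x%:C * (w' - w)))) ->
  nr (cauchy_sum c m w' - cauchy_sum c m w) <=
  (size c)%:R * (K * nr (w' - w) * (K / m.+1%:R) / d ^+ 3).
Proof.
move=> K0 d0 cK cc dw.
set D := nr (w' - w).
rewrite -subr_le0; apply: (@archi_le0 _ ((size c)%:R * (K * D * D / d ^+ 3))).
move=> n; rewrite lerBlDr.
pose p (k : nat) := w + (node n k)%:C * (w' - w).
have p0 : p 0%N = w by rewrite /p /node mul0r mul0r addr0.
have pn : p n.+1 = w' by rewrite /p /node divff ?pnatr_eq0// mul1r addrC subrK.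
rewrite -{1}p0 -{1}pn -(telescope_sumr (fun k => cauchy_sum c m (p k)))// big_mkord.
rewrite (le_trans (nr_sum _ _ _))//.
have st k : nr (p k.+1 - p k) = D / n.+1%:R.
  have -> : p k.+1 - p k = (node n k.+1 - node n k)%:C * (w' - w).
    by rewrite /p rmorphB /=; ring.
  by rewrite node_step nrM nr_real ger0_norm// mulrC.
have le1 (k : 'I_n.+1) : nr (cauchy_sum c m (p k.+1) - cauchy_sum c m (p k)) <=
    (size c)%:R * (K * (D / n.+1%:R) * (K / m.+1%:R + D / n.+1%:R) / d ^+ 3).
  rewrite -(st k); apply: cauchy_sum_local => // z zc; apply: dw => //.
    exact: node_in01.
  by rewrite node_in01// ltnW.
rewrite (le_trans (ler_sum _ (fun k _ => le1 k)))// sumr_const card_ord.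
rewrite -[leLHS]mulr_natr; apply: le_of_eq.
by field_nat2 R m n.
Qed.

(** A point separated from the contour by a line can be moved to infinity
   without coming closer to the contour. *)
Lemma cauchy_sum_exterior c (K s e : R) : 0 <= K -> 0 < s -> 0 < e ->
  lipschitz_contour K c -> closed_contour c ->
  exists M : nat, forall m, (M <= m)%N -> forall w u : R[i], nr u = 1 ->
    (forall z, on_contour c z -> s <= complex.Re (Num.conj u * (w - z))) ->
    nr (cauchy_sum c m w) <= e.
Proof.
move=> K0 s0 e0 cK cc.
pose D := 2 * (size c)%:R * K / e.
have D0 : 0 <= D by rewrite !mulr_ge0// invr_ge0 ltW.
have e20 : 0 < e / 2 by rewrite divr_gt0.
have [M hM] := archi_inv ((size c)%:R * (K * D * K / s ^+ 3)) e20.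
exists M => m Mm w u u1 sep.
have uu : Num.conj u * u = 1.
  by rewrite mulrC -normCK nrE u1 expr1n.
have far (x : R) z : on_contour c z -> 0 <= x -> s + x <= nr (z - (w + x%:C * u)).
  move=> zc x0; rewrite nrB (le_trans _ (Re_unit_le _ u1))//.
  have -> : Num.conj u * (w + x%:C * u - z) = Num.conj u * (w - z) + x%:C.
    rewrite [LHS](_ : _ = Num.conj u * (w - z) + x%:C * (Num.conj u * u)); last by ring.
    by rewrite uu mulr1.
  by rewrite raddfD /= lerD2r sep.
rewrite (le_trans (nr_le_sub _ (cauchy_sum c m (w + D%:C * u))))// [leRHS]splitr lerD//.
  rewrite (@le_trans _ _ ((size c)%:R * (K / (s + D))))//.
    apply: double_sum_le => g i gc im; rewrite nrf_div mulrAC.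
    rewrite ler_pM ?invr_ge0//; first by apply: step_le => //; exact: cK.
    have h := far D _ (on_node gc (ltnW im)) D0.
    by rewrite lef_pV2 ?posrE// ?(lt_le_trans _ h)// ltr_wpDr.
  rewrite mulrA ler_pdivrMr ?ltr_wpDr//.
  rewrite [e / 2 * _]mulrDr (_ : e / 2 * D = (size c)%:R * K); last first.
    by rewrite /D; field; rewrite gt_eqF.
  by rewrite lerDr mulr_ge0 ?(ltW s0)// ltW// divr_gt0.
rewrite nrB (le_trans (cauchy_sum_segment m K0 s0 cK cc (w := w) _))//; last first.
  rewrite addrAC subrr add0r nrM nr_real u1 mulr1 ger0_norm//.
  rewrite (le_trans _ (hM m Mm))//; apply: le_of_eq.
  by field_nat R m.
move=> z x zc /andP[x0 x1].
rewrite addrAC subrr add0r mulrA -real_complexM.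
by apply: le_trans (far (x * D) z zc _); rewrite ?lerDl mulr_ge0.
Qed.

(** Winding numbers are needed uniformly in w, because w runs through the other
   contour of a double integral; the bounds of [cauchy_sum_segment] depend only
   on the distances. *)
Lemma cauchy_sum_interior c (K D s e : R) (a w0 : R[i]) : 0 <= K -> 0 < s -> 0 < e ->
  0 <= D -> lipschitz_contour K c -> closed_contour c ->
  (forall e : R, 0 < e -> exists M : nat, forall m, (M <= m)%N ->
     nr (cauchy_sum c m w0 - a) <= e) ->
  exists M : nat, forall m, (M <= m)%N -> forall w : R[i], nr (w - w0) <= D ->
    (forall z (x : R), on_contour c z -> 0 <= x <= 1 ->
     s <= nr (z - (w0 + x%:C * (w - w0)))) ->
    nr (cauchy_sum c m w - a) <= e.
Proof.
move=> K0 s0 e0 D0 cK cc h0.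
have e20 : 0 < e / 2 by rewrite divr_gt0.
have [M1 hM1] := h0 _ e20.
have [M2 hM2] := archi_inv ((size c)%:R * (K * D * K / s ^+ 3)) e20.
exists (maxn M1 M2) => m; rewrite geq_max => /andP[m1 m2] w wD sep.
rewrite (le_trans (nr_triangle (cauchy_sum c m w0) _ _))// [leRHS]splitr lerD//.
  rewrite (le_trans (cauchy_sum_segment m K0 s0 cK cc sep))//.
  rewrite (le_trans _ (hM2 m m2))//.
  rewrite [leRHS](_ : _ = (size c)%:R * (K * D * (K / m.+1%:R) / s ^+ 3)); last first.
    by field_nat R m.
  rewrite ler_wpM2l// ler_wpM2r ?invr_ge0 ?exprn_ge0 ?(ltW s0)//.
  by rewrite ler_wpM2r ?divr_ge0// ler_wpM2l.
exact: hM1.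
Qed.

End Winding.

(** ** Circles and rectangles *)

Section Taylor.
Context {R : realType}.
Implicit Types f df : R -> R.

Lemma mvt f df (a b : R) : (forall x : R, is_derive x 1 f (df x)) -> a <= b ->
  exists2 x, a <= x <= b & f b - f a = df x * (b - a).
Proof.
move=> fdf ab.
have [|x] := @MVT_segment R f df a b ab (fun x _ => fdf x).
  apply: continuous_subspaceT => x; apply/differentiable_continuous.
  by apply/derivable1_diffP; have [] := fdf x.
by rewrite in_itv /= => xab e; exists x.
Qed.

Lemma derive_lipschitz f df (M a b : R) : (forall x : R, is_derive x 1 f (df x)) ->
  (forall x, `|df x| <= M) -> `|f a - f b| <= M * `|a - b|.
Proof.
move=> fdf dM; wlog ab : a b / b <= a => [h|].
  have [/h//|/ltW/h] := leP b a.
  by rewrite distrC [`|b - a|]distrC.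
have [x _ ->] := mvt fdf ab.
by rewrite normrM ler_wpM2r.
Qed.

Lemma taylor1 f df (L a b : R) : (forall x : R, is_derive x 1 f (df x)) ->
  (forall x y, `|df x - df y| <= L * `|x - y|) -> a <= b ->
  `|f b - f a - df a * (b - a)| <= L * (b - a) ^+ 2.
Proof.
move=> fdf dL ab; have [x /andP[ax xb] ->] := mvt fdf ab.
rewrite -mulrBl normrM (ger0_norm (x := b - a)) ?subr_ge0//.
rewrite expr2 mulrA ler_wpM2r ?subr_ge0// (le_trans (dL _ _))//.
have L0 : 0 <= L.
  by have := dL 1 0; rewrite subr0 normr1 mulr1; exact: le_trans.
by rewrite ler_wpM2l// ger0_norm ?subr_ge0// lerD2r.
Qed.

Lemma riemann_sum_derive f df (L a b : R) m : (forall x : R, is_derive x 1 f (df x)) ->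
  (forall x y, `|df x - df y| <= L * `|x - y|) -> a <= b ->
  `|\sum_(i < m.+1) df (a + node m i * (b - a)) * ((b - a) / m.+1%:R) - (f b - f a)|
    <= L * (b - a) ^+ 2 / m.+1%:R.
Proof.
move=> fdf dL ab.
pose p i := a + node m i * (b - a).
have p0 : p 0%N = a by rewrite /p /node !mul0r addr0.
have pn : p m.+1 = b by rewrite /p /node divff ?pnatr_eq0// mul1r addrC subrK.
have ps i : p i.+1 - p i = (b - a) / m.+1%:R.
  have -> : p i.+1 - p i = (node m i.+1 - node m i) * (b - a) by rewrite /p; ring.
  by rewrite node_step mulrC.
have -> : f b - f a = \sum_(i < m.+1) (f (p i.+1) - f (p i)).
  rewrite -(big_mkord xpredT (fun i => f (p i.+1) - f (p i))).
  by rewrite (telescope_sumr (fun i => f (p i)))// p0 pn.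
rewrite -sumrB.
rewrite (le_trans (ler_norm_sum _ _ _))//.
have le1 (i : 'I_m.+1) : `|df (p i) * ((b - a) / m.+1%:R) - (f (p i.+1) - f (p i))|
    <= L * ((b - a) / m.+1%:R) ^+ 2.
  rewrite distrC -(ps i); apply: taylor1 => //.
  by rewrite -subr_ge0 ps divr_ge0 ?subr_ge0.
rewrite (le_trans (ler_sum _ (fun k _ => le1 k)))// sumr_const card_ord.
rewrite -[leLHS]mulr_natr; apply: le_of_eq.
by field_nat R m.
Qed.

End Taylor.

Section Circle.
Context {R : realType}.

Definition two_pi_i : R[i] := 0 +i* (2 * pi).

Lemma imag_muln (h : R) n : (0 +i* h) *+ n = 0 +i* (h *+ n).
Proof.
elim: n => [|n ih] //; rewrite !mulrS ih.
by apply: eq_ReIm; rewrite /= ?addr0.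
Qed.

Lemma cos_lipschitz (x y : R) : `|cos x - cos y| <= `|x - y|.
Proof.
rewrite -[leRHS]mul1r; apply: (derive_lipschitz _ _ (df := fun x => - sin x)).
by move=> t; rewrite normrN; have := sin_geN1 t; have := sin_le1 t; rewrite ler_norml => -> ->.
Qed.

Lemma sin_lipschitz (x y : R) : `|sin x - sin y| <= `|x - y|.
Proof.
rewrite -[leRHS]mul1r; apply: (derive_lipschitz _ _ (df := fun x => cos x)).
by move=> t; have := cos_geN1 t; have := cos_le1 t; rewrite ler_norml => -> ->.
Qed.

Lemma circle_lipschitz (c r : R) : 0 <= r ->
  lipschitz_contour (4 * pi * r) (circle c r).
Proof.
move=> r0 g; rewrite inE => /eqP-> x y _ _.
rewrite (le_trans (nr_ReIm _))//=.
have -> : c + r * cos (2 * pi * x) - (c + r * cos (2 * pi * y))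
   = r * (cos (2 * pi * x) - cos (2 * pi * y)) by ring.
rewrite -mulrBr !normrM (ger0_norm r0) -mulrDr.
have h1 := cos_lipschitz (2 * pi * x) (2 * pi * y).
have h2 := sin_lipschitz (2 * pi * x) (2 * pi * y).
have := lerD h1 h2.
rewrite -mulrBr normrM (ger0_norm (x := 2 * pi)) ?mulr_ge0 ?pi_ge0// => h.
have := ler_wpM2l r0 h => /le_trans; apply.
by apply: le_of_eq; ring.
Qed.

Lemma circle_closed (c r : R) : closed_contour (circle c r).
Proof.
move=> g; rewrite big_seq1 !mulr1 !mulr0 mulr_natl cos2pi sin2pi cos0 sin0.
exact: subrr.
Qed.

Lemma on_circle (c r : R) z : 0 <= r -> on_contour (circle c r) z ->
  nr (z - c%:C) = r.
Proof.
move=> r0 [[t _ ->]|//]; apply: nr_eq_sqr => //=; rewrite subr0 (addrC c) addrK.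
by rewrite !exprMn -mulrDr cos2Dsin2 mulr1.
Qed.

(** On a circle the quotient of a step by the radius vector is
   exp (i t) - 1 = i t + O(t^2), where t = 2 pi / (m + 1). *)
Lemma circle_winding_center (c r e : R) : 0 < r -> 0 < e ->
  exists M : nat, forall m, (M <= m)%N ->
    nr (cauchy_sum (circle c r) m c%:C - two_pi_i) <= e.
Proof.
move=> r0 e0; have [M hM] := archi_inv (2 * (2 * pi) ^+ 2) e0.
exists M => m /hM; apply: le_trans.
rewrite /cauchy_sum big_seq1.
pose h : R := 2 * pi / m.+1%:R.
have -> : two_pi_i = \sum_(i < m.+1) 0 +i* h.
  rewrite sumr_const card_ord imag_muln /two_pi_i; congr (_ +i* _).
  by rewrite -[RHS]mulr_natr /h divfK ?pnatr_eq0.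
rewrite -sumrB (le_trans (nr_sum _ _ _))//.
pose u x : R[i] := cos (2 * pi * x) +i* sin (2 * pi * x).
have u1 x : nr (u x) = 1.
  by apply: nr_eq_sqr; rewrite //= cos2Dsin2 expr1n.
have h0 : 0 <= h by rewrite divr_ge0 ?mulr_ge0 ?pi_ge0.
have le1 (i : 'I_m.+1) : nr (step (fun t => (c + r * cos (2 * pi * t)) +i*
     (r * sin (2 * pi * t))) m i / ((c + r * cos (2 * pi * node m i)) +i*
     (r * sin (2 * pi * node m i)) - c%:C) - 0 +i* h) <= 2 * h ^+ 2.
  have -> : (c + r * cos (2 * pi * node m i)) +i*
     (r * sin (2 * pi * node m i)) - c%:C = r%:C * u (node m i).
    by apply: eq_ReIm => /=; ring.
  have -> : step (fun t => (c + r * cos (2 * pi * t)) +i*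
     (r * sin (2 * pi * t))) m i = r%:C * (u (node m i.+1) - u (node m i)).
    by apply: eq_ReIm => /=; ring.
  have un : u (node m i) != 0 by apply: nr_neq0; rewrite u1.
  have rn : r%:C != 0 :> R[i] by apply: nr_neq0; rewrite nr_real normr_gt0 gt_eqF.
  rewrite -mulf_div divff// mul1r.
  rewrite [X in nr X](_ : _ = (u (node m i.+1) - u (node m i)
      - 0 +i* h * u (node m i)) / u (node m i)); last by field.
  rewrite nrf_div u1 divr1 (le_trans (nr_ReIm _))//=.
  rewrite [leRHS](_ : _ = h ^+ 2 + h ^+ 2); last by ring.
  have hh : 2 * pi * node m i.+1 - 2 * pi * node m i = h.
    by rewrite -mulrBr node_step.
  have hl : (2 * pi * node m i : R) <= 2 * pi * node m i.+1.
    by rewrite ler_wpM2l ?mulr_ge0 ?pi_ge0// -subr_ge0 node_step invr_ge0.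
  set x := 2 * pi * node m i in hh hl *.
  set y := 2 * pi * node m i.+1 in hh hl *.
  rewrite -[h ^+ 2]mul1r -hh lerD//.
    rewrite [X in `|X|](_ : _ = cos y - cos x - (- sin x) * (y - x)); last by rewrite hh; ring.
    apply: (taylor1 (df := fun x => - sin x)) => // x' y'.
    by rewrite mul1r -opprD normrN sin_lipschitz.
  rewrite [X in `|X|](_ : _ = sin y - sin x - cos x * (y - x)); last by rewrite hh; ring.
  apply: (taylor1 (df := cos)) => // x' y'.
  by rewrite mul1r cos_lipschitz.
rewrite (le_trans (ler_sum _ (fun k _ => le1 k)))// sumr_const card_ord.
rewrite -[leLHS]mulr_natr; apply: le_of_eq; rewrite /h.
by field_nat R m.
Qed.

End Circle.

Section Rectangle.
Context {R : realType}.

Lemma segment_lipschitz (p q : R[i]) K : nr (q - p) <= K ->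
  lipschitz_path K (segment p q).
Proof.
move=> pqK x y _ _; rewrite /segment.
have -> : p + x%:C * (q - p) - (p + y%:C * (q - p)) = (x - y)%:C * (q - p).
  by rewrite rmorphB /=; ring.
by rewrite nrM nr_real mulrC ler_wpM2r.
Qed.

Lemma rectangle_lipschitz (x1 x2 y1 y2 : R) : x1 <= x2 -> y1 <= y2 ->
  lipschitz_contour ((x2 - x1) + (y2 - y1)) (rectangle x1 x2 y1 y2).
Proof.
move=> x12 y12 g; rewrite !inE => /or4P[]/eqP->; apply: segment_lipschitz;
  rewrite (le_trans (nr_ReIm _))//= !subrr normr0 ?addr0 ?add0r.
- by rewrite ger0_norm ?subr_ge0// lerDl subr_ge0.
- by rewrite ger0_norm ?subr_ge0// lerDr subr_ge0.
- by rewrite distrC ger0_norm ?subr_ge0// lerDl subr_ge0.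
- by rewrite distrC ger0_norm ?subr_ge0// lerDr subr_ge0.
Qed.

Lemma segment0 (p q : R[i]) : segment p q 0 = p.
Proof. by rewrite /segment mul0r addr0. Qed.

Lemma segment1 (p q : R[i]) : segment p q 1 = q.
Proof. by rewrite /segment mul1r addrC subrK. Qed.

Lemma rectangle_closed (x1 x2 y1 y2 : R) : closed_contour (rectangle x1 x2 y1 y2).
Proof.
move=> g; rewrite !big_cons big_nil !segment0 !segment1; ring.
Qed.

Lemma on_rectangle (x1 x2 y1 y2 : R) z : x1 <= x2 -> y1 <= y2 ->
  on_contour (rectangle x1 x2 y1 y2) z ->
  [/\ x1 <= complex.Re z <= x2, y1 <= complex.Im z <= y2 &
   [|| complex.Re z == x1, complex.Re z == x2, complex.Im z == y1 |
    complex.Im z == y2]].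
Proof.
move=> x12 y12 [|[|[|[|//]]]] [t /andP[t0 t1] ->] /=; rewrite !subrr;
  rewrite !(mulr0, mul0r, subr0, addr0, add0r, lexx, eqxx, orbT) /=; split => //;
  rewrite ?x12 ?y12//; nra.
Qed.

Lemma atan_inv (x : R) : 0 < x -> atan x + atan x^-1 = pi / 2.
Proof.
move=> x0; have [_ tx] := atan_def x.
have ax0 : 0 < atan x by rewrite -[ltLHS](@atan0 R) lt_atan.
have ax1 := atan_ltpi2 x.
rewrite (_ : x^-1 = tan (pi / 2 - atan x)); last first.
  rewrite /tan -(opprB (atan x)) sinN cosN sinBpihalf cosBpihalf opprK.
  by rewrite -invf_div -{1}tx.
rewrite tanK; first by rewrite addrC subrK.
by rewrite in_itv /=; apply/andP; split; nra.
Qed.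

Lemma lip_atan' (x y : R) :
  `|(1 + x ^+ 2)^-1 - (1 + y ^+ 2)^-1| <= 1 * `|x - y|.
Proof.
have px : 0 < 1 + x ^+ 2 by rewrite ltr_wpDr ?sqr_ge0.
have py : 0 < 1 + y ^+ 2 by rewrite ltr_wpDr ?sqr_ge0.
have -> : (1 + x ^+ 2)^-1 - (1 + y ^+ 2)^-1 =
   - (x - y) * (x + y) / ((1 + x ^+ 2) * (1 + y ^+ 2)).
  by field; rewrite !gt_eqF.
rewrite normrM normfV (gtr0_norm (mulr_gt0 px py)) ler_pdivrMr ?mulr_gt0//.
rewrite normrM normrN mul1r ler_wpM2l// ler_norml.
have := sqr_ge0 (x - 1); have := sqr_ge0 (x + 1); have := sqr_ge0 (y - 1).
have := sqr_ge0 (y + 1); have := sqr_ge0 (x * y); rewrite !expr2.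
by move=> ? ? ? ? ?; apply/andP; split; nra.
Qed.

(** The side of a rectangle, seen from the centre, subtends the angle
   2 atan t, t being the ratio of half the side to its distance; after division
   by that distance every side becomes the segment from 1 - i t to 1 + i t. *)
Definition side_sum (t : R) (m : nat) : R[i] :=
  \sum_(i < m.+1) (0 +i* (2 * t / m.+1%:R)) / (1 +i* (- t + node m i * (2 * t))).

Lemma side_sum_atan (t : R) m : 0 <= t ->
  nr (side_sum t m - 0 +i* (2 * atan t)) <= 8 * t ^+ 2 / m.+1%:R.
Proof.
move=> t0; have tt : - t <= t by lra.
have h1 := @riemann_sum_derive R atan _ 1 _ _ m (@is_derive1_atan R) lip_atan' tt.
have Re_sum (F : 'I_m.+1 -> R[i]) : complex.Re (\sum_i F i) = \sum_i complex.Re (F i).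
  exact: raddf_sum.
have Im_sum (F : 'I_m.+1 -> R[i]) : complex.Im (\sum_i F i) = \sum_i complex.Im (F i).
  exact: raddf_sum.
have e : t - - t = 2 * t by ring.
rewrite (le_trans (nr_ReIm _))// /side_sum !raddfB /= Re_sum Im_sum.
have term (u d : R) : (0 +i* d) / (1 +i* u) =
    (u / (1 + u ^+ 2) * d) +i* ((1 + u ^+ 2)^-1 * d).
  have pu : 0 < 1 + u ^+ 2 by rewrite ltr_wpDr ?sqr_ge0.
  have u0 : 1 +i* u != 0 :> R[i] by rewrite eq_complex /= oner_eq0.
  apply: (mulIf u0); rewrite divfK//.
  apply: eq_ReIm => /=; field;
    by rewrite gt_eqF.
under eq_bigr do rewrite term /=.
under [X in _ + `|X - _|]eq_bigr do rewrite term /=.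
rewrite atanN !e mul1r (_ : atan t - - atan t = 2 * atan t) in h1; last by ring.
rewrite [leRHS](_ : _ = (2 * t) ^+ 2 / m.+1%:R + (2 * t) ^+ 2 / m.+1%:R).
  apply: lerD => //; rewrite subr0 -mulr_suml.
  pose u i : R := - t + node m i * (2 * t); pose phi x : R := x / (1 + x ^+ 2).
  (* phi is odd, and reflection turns left ends of intervals into right ends. *)
  have flip (i : 'I_m.+1) : phi (u (rev_ord i)) = - phi (u i.+1).
    have nE : node m (m - i) = 1 - node m i.+1 :> R.
      rewrite /node.
      have -> : (m - i)%:R = m.+1%:R - i.+1%:R :> R by rewrite -natrB// subSS.
      by rewrite mulrBl divff ?pnatr_eq0.
    have -> : u (rev_ord i) = - u i.+1 by rewrite /u /= subSS nE; ring.
    by rewrite /phi sqrrN mulNr.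
  have S2 : 2 * (\sum_(i < m.+1) phi (u i)) = phi (- t) - phi t.
    rewrite mulr_natl mulr2n {2}(reindex_inj rev_ord_inj) -big_split /=.
    rewrite (eq_bigr (fun i : 'I_m.+1 => - (phi (u i.+1) - phi (u i)))); last first.
      by move=> i _; rewrite flip opprB.
    rewrite sumrN -(big_mkord xpredT (fun i => phi (u i.+1) - phi (u i))).
    rewrite (telescope_sumr (fun i => phi (u i)))// opprB.
    by congr (phi _ - phi _); rewrite /u /node ?divff ?pnatr_eq0//; ring.
  have -> : \sum_(i < m.+1) phi (u i) = - (t / (1 + t ^+ 2)).
    by move: S2; rewrite /phi sqrrN mulNr; lra.
  have pt : 0 < 1 + t ^+ 2 by rewrite ltr_wpDr ?sqr_ge0.
  rewrite normrM normrN !ger0_norm ?divr_ge0 ?mulr_ge0 ?(ltW pt)// expr2 -[leRHS]mulrA.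
  rewrite ler_wpM2r ?divr_ge0 ?mulr_ge0// ler_pdivrMr//.
  have := mulr_ge0 t0 (sqr_ge0 t); lra.
by field_nat R m.
Qed.

Lemma rectangle_center_sum (x1 x2 y1 y2 : R) m : x1 < x2 -> y1 < y2 ->
  cauchy_sum (rectangle x1 x2 y1 y2) m (((x1 + x2) / 2) +i* ((y1 + y2) / 2)) =
  2 * side_sum ((y2 - y1) / (x2 - x1)) m + 2 * side_sum ((x2 - x1) / (y2 - y1)) m.
Proof.
move=> x12 y12; set w := _ +i* _.
have a0 : x2 - x1 != 0 by rewrite gt_eqF// subr_gt0.
have b0 : y2 - y1 != 0 by rewrite gt_eqF// subr_gt0.
have side (p q k : R[i]) (t : R) : k != 0 ->
    q - p = k * (0 +i* (2 * t)) -> p - w = k * (1 +i* - t) ->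
    \sum_(i < m.+1) step (segment p q) m i / (segment p q (node m i) - w) =
    side_sum t m.
  move=> k0 qp pw; apply: eq_bigr => i _.
  have -> : step (segment p q) m i = k * (0 +i* (2 * t / m.+1%:R)).
    rewrite /step /segment.
    rewrite [LHS](_ : _ = (node m i.+1 - node m i)%:C * (q - p)); last first.
      by rewrite rmorphB /=; ring.
    rewrite node_step qp mulrCA; congr (_ * _).
    by apply: eq_ReIm => /=; ring.
  have -> : segment p q (node m i) - w = k * (1 +i* (- t + node m i * (2 * t))).
    rewrite /segment addrAC pw qp mulrCA -mulrDr; congr (_ * _).
    by apply: eq_ReIm => /=; ring.
  by rewrite -mulf_div divff// mul1r.
have neC (x y : R) : x != 0 -> (x +i* y) != 0 :> R[i].
  by move=> h; rewrite eq_complex /= negb_and h.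
have neC' (x y : R) : y != 0 -> (x +i* y) != 0 :> R[i].
  by move=> h; rewrite eq_complex /= negb_and h orbT.
have ha : (x2 - x1) / 2 != 0 by rewrite mulf_neq0// invr_eq0 pnatr_eq0.
have hb : (y2 - y1) / 2 != 0 by rewrite mulf_neq0// invr_eq0 pnatr_eq0.
rewrite /cauchy_sum !big_cons big_nil.
rewrite (side _ _ (0 +i* - ((y2 - y1) / 2)) ((x2 - x1) / (y2 - y1))).
rewrite (side _ _ (((x2 - x1) / 2) +i* 0) ((y2 - y1) / (x2 - x1))).
rewrite (side _ _ (0 +i* ((y2 - y1) / 2)) ((x2 - x1) / (y2 - y1))).
rewrite (side _ _ ((- ((x2 - x1) / 2)) +i* 0) ((y2 - y1) / (x2 - x1))).
by ring.
all: first [by apply: neC; rewrite ?oppr_eq0|by apply: neC'; rewrite ?oppr_eq0|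
  by apply: eq_ReIm => /=; field; rewrite ?a0 ?b0].
Qed.

(** The angles of the four sides add up to 2 pi because atan t + atan (1/t) is
   pi / 2. *)
Lemma rectangle_winding_center (x1 x2 y1 y2 e : R) : x1 < x2 -> y1 < y2 -> 0 < e ->
  exists M : nat, forall m, (M <= m)%N ->
    nr (cauchy_sum (rectangle x1 x2 y1 y2) m
      (((x1 + x2) / 2) +i* ((y1 + y2) / 2)) - two_pi_i) <= e.
Proof.
move=> x12 y12 e0.
set t := (y2 - y1) / (x2 - x1); set t' := (x2 - x1) / (y2 - y1).
have t0 : 0 < t by rewrite divr_gt0 ?subr_gt0.
have tt' : t^-1 = t' by rewrite /t invf_div.
have t'0 : 0 < t' by rewrite -tt' invr_gt0.
have [M hM] := archi_inv (16 * t ^+ 2 + 16 * t' ^+ 2) e0.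
exists M => m /hM; apply: le_trans; rewrite rectangle_center_sum// -/t -/t'.
have -> : two_pi_i = 2 * (0 +i* (2 * atan t)) + 2 * (0 +i* (2 * atan t')) :> R[i].
  have := atan_inv t0; rewrite tt' => h.
  by apply: eq_ReIm => /=; lra.
rewrite opprD addrACA -!mulrBr (le_trans (nrD _ _))// !nrM.
have n2 : nr (2 : R[i]) = 2.
  by rewrite -[2]/(2%:R) -(rmorph_nat (real_complex R)) nr_real ger0_norm.
rewrite n2; have h1 := side_sum_atan m (ltW t0).
have h2 := side_sum_atan m (ltW t'0).
rewrite [leRHS](_ : _ = 2 * (8 * t ^+ 2 / m.+1%:R) + 2 * (8 * t' ^+ 2 / m.+1%:R)).
  by rewrite lerD// ler_wpM2l.
by field_nat R m.
Qed.

End Rectangle.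

(** * Products of contour integrals of a resolvent *)

Section Linear.
Context {R : realType} {H : completeNormedModType R[i]}.
Implicit Types (B : H -> H).

Lemma linear_fun0 B : linear B -> B 0 = 0.
Proof. by move=> lB; have := lB (-1) 0 0; rewrite addr0 scaler0 scaleN1r addNr. Qed.

Lemma linear_funD B f g : linear B -> B (f + g) = B f + B g.
Proof. by move=> lB; have := lB 1 f g; rewrite !scale1r. Qed.

Lemma linear_funZ B a f : linear B -> B (a *: f) = a *: B f.
Proof. by move=> lB; have := lB a f 0; rewrite (linear_fun0 lB) !addr0. Qed.

Lemma linear_funB B f g : linear B -> B (f - g) = B f - B g.
Proof. by move=> lB; rewrite linear_funD// -scaleN1r linear_funZ// scaleN1r. Qed.

Lemma linear_fun_sum B (I : Type) (r : seq I) (P : pred I) (F : I -> H) : linear B ->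
  B (\sum_(i <- r | P i) F i) = \sum_(i <- r | P i) B (F i).
Proof.
move=> lB; apply: (big_morph B (id1 := 0) (op1 := +%R)) => [x y|].
  exact: linear_funD.
exact: linear_fun0.
Qed.

End Linear.

Section ContourSum.
Context {R : realType} {H : completeNormedModType R[i]}.
Implicit Types (gamma : R -> R[i]) (c : seq (R -> R[i])) (G : R[i] -> H).

Lemma eq_contour_sum c G G' m : (forall z, on_contour c z -> G z = G' z) ->
  contour_sum c G m = contour_sum c G' m.
Proof.
move=> GG'; apply: eq_big_seq => g gc; apply: eq_bigr => i _.
by rewrite GG'//; apply: on_node => //; rewrite ltnW.
Qed.

Lemma contour_sumD c G G' m :
  contour_sum c (fun z => G z + G' z) m = contour_sum c G m + contour_sum c G' m.
Proof.
rewrite -big_split; apply: eq_bigr => g _; rewrite -big_split.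
by apply: eq_bigr => i _; rewrite scalerDr.
Qed.

Lemma contour_sumB c G G' m :
  contour_sum c (fun z => G z - G' z) m = contour_sum c G m - contour_sum c G' m.
Proof.
rewrite -sumrB; apply: eq_bigr => g _; rewrite -sumrB; apply: eq_bigr => i _.
by rewrite scalerBr.
Qed.

Lemma contour_sumZ c (a : R[i]) G m :
  contour_sum c (fun z => a *: G z) m = a *: contour_sum c G m.
Proof.
rewrite scaler_sumr; apply: eq_bigr => g _; rewrite scaler_sumr.
by apply: eq_bigr => i _; rewrite !scalerA mulrC.
Qed.

Lemma contour_sum_linear c (B : H -> H) G m : linear B ->
  B (contour_sum c G m) = contour_sum c (fun z => B (G z)) m.
Proof.
move=> lB; rewrite linear_fun_sum//; apply: eq_bigr => g _.
by rewrite linear_fun_sum//; apply: eq_bigr => i _; rewrite linear_funZ.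
Qed.

Lemma contour_sum_exchange c c' (G : R[i] -> R[i] -> H) m :
  contour_sum c (fun z => contour_sum c' (G z) m) m =
  contour_sum c' (fun w => contour_sum c (G^~ w) m) m.
Proof.
rewrite /contour_sum.
under eq_bigr do under eq_bigr do rewrite scaler_sumr.
under eq_bigr do rewrite exchange_big /=.
rewrite exchange_big /=; apply: eq_bigr => g' _.
under eq_bigr do under eq_bigr do rewrite scaler_sumr.
under eq_bigr do rewrite exchange_big /=.
rewrite exchange_big /=; apply: eq_bigr => i _.
rewrite scaler_sumr; apply: eq_bigr => g _.
rewrite scaler_sumr; apply: eq_bigr => j _.
by rewrite !scalerA mulrC.
Qed.

Lemma contour_sum_cauchy c (w : R[i]) (v : H) m :
  contour_sum c (fun z => (z - w)^-1 *: v) m = cauchy_sum c m w *: v.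
Proof.
rewrite scaler_suml; apply: eq_bigr => g _; rewrite scaler_suml.
by apply: eq_bigr => i _; rewrite scalerA.
Qed.

End ContourSum.

Section Resolvents.
Context {R : realType} {H : completeNormedModType R[i]}.
Implicit Types (gamma : R -> R[i]) (c : seq (R -> R[i])) (F : R[i] -> H -> H).

Definition bounded_resolvent (E : set R[i]) F (M : R) : Prop :=
  [/\ 0 <= M, forall z, E z -> linear (F z),
      forall z w f, E z -> E w -> F z f - F w f = (w - z) *: F z (F w f) &
      forall z f, E z -> nr (F z f) <= M * nr f].

Lemma bounded_resolvent_lipschitz E F M z w f : bounded_resolvent E F M ->
  E z -> E w -> nr (F z f - F w f) <= M ^+ 2 * nr f * nr (z - w).
Proof.
move=> [M0 _ Fid FM] Ez Ew; rewrite Fid// nrZ nrB mulrC ler_wpM2r//.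
by rewrite (le_trans (FM _ _ Ez))// expr2 -mulrA ler_wpM2l// FM.
Qed.

Lemma resolvent_integral_exists E F M K c : 0 <= K -> bounded_resolvent E F M ->
  lipschitz_contour K c -> on_contour c `<=` E ->
  exists B, contour_integral c F B /\ contour_limit c F B.
Proof.
move=> K0 FM cK cE; have [M0 _ _ _] := FM.
apply: (@contour_integral_exists _ _ c F K (M ^+ 2)) => //.
  exact: exprn_ge0.
by move=> z w f zc wc; apply: (bounded_resolvent_lipschitz _ FM); exact: cE.
Qed.

(** Partial fractions: by the resolvent identity the double integral of
   F(z) F(w) splits into two integrals whose weights are winding numbers. *)
Lemma resolvent_product E F M K c c' B B' (a b : R[i]) : 0 <= K ->
  bounded_resolvent E F M ->
  lipschitz_contour K c -> lipschitz_contour K c' ->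
  on_contour c `<=` E -> on_contour c' `<=` E ->
  (forall z w, on_contour c z -> on_contour c' w -> w != z) ->
  contour_limit c F B -> contour_limit c' F B' ->
  (forall e : R, 0 < e -> exists N : nat, forall m, (N <= m)%N ->
     (forall z, on_contour c z -> nr (cauchy_sum c' m z - a) <= e) /\
     (forall w, on_contour c' w -> nr (cauchy_sum c m w - b) <= e)) ->
  forall f, B (B' f) = a *: B f + b *: B' f.
Proof.
move=> K0 FM cK cK' cE cE' ne [C BC] [C' BC'] wind f.
have [M0 Flin Fid Fle] := FM.
have sumE m : contour_sum c (F^~ (contour_sum c' (F^~ f) m)) m =
    contour_sum c (fun z => cauchy_sum c' m z *: F z f) m +
    contour_sum c' (fun w => cauchy_sum c m w *: F w f) m.
  transitivity (contour_sum c (fun z =>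
      contour_sum c' (fun w => (w - z)^-1 *: F z f) m -
      contour_sum c' (fun w => (w - z)^-1 *: F w f) m) m).
    apply: eq_contour_sum => z zc; rewrite contour_sum_linear; last exact/Flin/cE.
    rewrite -contour_sumB; apply: eq_contour_sum => w wc.
    rewrite -scalerBr Fid; [|exact: cE|exact: cE'].
    by rewrite scalerA mulVf ?scale1r// subr_eq0 ne.
  rewrite contour_sumB; congr (_ + _).
    by apply: eq_contour_sum => z _; rewrite contour_sum_cauchy.
  rewrite contour_sum_exchange -[LHS]scaleN1r -contour_sumZ; apply: eq_contour_sum => w _.
  rewrite -contour_sum_cauchy -contour_sumZ; apply: eq_contour_sum => z _.
  by rewrite scalerA mulN1r -invrN opprB.
have dev d d' (x : R[i]) e m : lipschitz_contour K d -> on_contour d `<=` E -> 0 <= e ->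
    (forall z, on_contour d z -> nr (cauchy_sum d' m z - x) <= e) ->
    nr (contour_sum d (fun z => cauchy_sum d' m z *: F z f) m -
        x *: contour_sum d (F^~ f) m) <= K * (size d)%:R * (e * (M * nr f)).
  move=> dK dE e0 h; rewrite -contour_sumZ -contour_sumB.
  apply: contour_sum_le => // z zd.
  by rewrite -scalerBl nrZ ler_pM ?h//; apply/Fle/dE.
apply: nr_small_eq => e e0.
set Q := C * nr (B' f) + K * (size c)%:R * M * C' * nr f
       + nr a * (C * nr f) + nr b * (C' * nr f).
set P := K * (size c)%:R * (M * nr f) + K * (size c')%:R * (M * nr f).
have P0 : 0 <= P by rewrite addr_ge0// ?mulr_ge0.
have e20 : 0 < e / 2 by rewrite divr_gt0.
pose e' := e / 2 / (P + 1).
have e'0 : 0 < e' by rewrite divr_gt0// ltr_wpDl.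
have [N1 hN1] := wind _ e'0; have [N2 hN2] := archi_inv Q e20.
pose m := maxn N1 N2.
have [w1 w2] := hN1 m (leq_maxl _ _); have q := hN2 m (leq_maxr _ _).
set S := contour_sum c (F^~ f) m; set S' := contour_sum c' (F^~ f) m.
have t1 : nr (B (B' f) - contour_sum c (F^~ (B' f)) m) <= C / m.+1%:R * nr (B' f).
  by rewrite nrB.
have t2 : nr (contour_sum c (F^~ (B' f)) m - contour_sum c (F^~ S') m)
    <= K * (size c)%:R * (M * (C' / m.+1%:R * nr f)).
  rewrite -contour_sumB; apply: contour_sum_le => // z /cE Ez.
  rewrite -linear_funB ?(le_trans (Fle _ _ _))//; last exact: Flin.
  by rewrite ler_wpM2l// nrB BC'.
have t3 := dev _ _ _ _ _ cK cE (ltW e'0) w1.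
have t4 := dev _ _ _ _ _ cK' cE' (ltW e'0) w2.
have t5 : nr (a *: S - a *: B f) <= nr a * (C / m.+1%:R * nr f).
  by rewrite -scalerBr nrZ ler_wpM2l ?BC.
have t6 : nr (b *: S' - b *: B' f) <= nr b * (C' / m.+1%:R * nr f).
  by rewrite -scalerBr nrZ ler_wpM2l ?BC'.
rewrite -/S in t3; rewrite -/S' in t4; have sE := sumE m; rewrite -/S' in sE.
have u1 := nr_triangle (contour_sum c (F^~ (B' f)) m) (B (B' f)) (a *: B f + b *: B' f).
have u2 := nr_triangle (contour_sum c (F^~ S') m) (contour_sum c (F^~ (B' f)) m)
  (a *: B f + b *: B' f).
have sE' : contour_sum c (F^~ S') m - (a *: B f + b *: B' f) =
   (contour_sum c (fun z => cauchy_sum c' m z *: F z f) m - a *: B f) +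
   (contour_sum c' (fun w => cauchy_sum c m w *: F w f) m - b *: B' f).
  by rewrite sE opprD addrACA.
rewrite sE' in u2.
set Y := contour_sum c (fun z => _ *: _) m in t3 u2.
set Y' := contour_sum c' (fun z => _ *: _) m in t4 u2.
have u3 := nrD (Y - a *: B f) (Y' - b *: B' f).
have u4 := nr_triangle (a *: S) Y (a *: B f).
have u5 := nr_triangle (b *: S') Y' (b *: B' f).
apply: (le_trans u1); apply: (le_trans (lerD t1 u2)).
have e'P : e' * P <= e / 2.
  rewrite /e' -mulrA ler_piMr ?(ltW e20)// mulrC ler_pdivrMr ?mul1r ?lerDl//.
  by rewrite ltr_wpDl.
have big : C / m.+1%:R * nr (B' f) + (K * (size c)%:R * (M * (C' / m.+1%:R * nr f))
  + (K * (size c)%:R * (e' * (M * nr f)) + nr a * (C / m.+1%:R * nr f)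
  + (K * (size c')%:R * (e' * (M * nr f)) + nr b * (C' / m.+1%:R * nr f))))
  = Q / m.+1%:R + e' * P by rewrite /Q /P; ring.
rewrite [leRHS]splitr; apply: le_trans (lerD q e'P); rewrite -big.
rewrite lerD2l lerD// (le_trans u3)// lerD//.
  by rewrite (le_trans u4)// lerD.
by rewrite (le_trans u5)// lerD.
Qed.

End Resolvents.

Section Shrinking.
Context {R : realType} {H : completeNormedModType R[i]}.
Implicit Types (gamma : R -> R[i]) (c : seq (R -> R[i])) (F : R[i] -> H -> H).

(** Closeness in the Lipschitz norm: it bounds the difference of the steps of two
   Riemann sums by the mesh, so that the sums are close uniformly in the mesh. *)
Fixpoint near_contours (d : R) c c' : Prop :=
  match c, c' with
  | [::], [::] => True
  | g :: c1, g' :: c1' => [/\ lipschitz_path d (fun t => g t - g' t),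
      forall t, 0 <= t <= 1 -> nr (g t - g' t) <= d & near_contours d c1 c1']
  | _, _ => False
  end.

Lemma near_contour_sum E F M K d c c' f m : 0 <= K ->
  bounded_resolvent E F M -> lipschitz_contour K c' ->
  on_contour c `<=` E -> on_contour c' `<=` E -> near_contours d c c' ->
  nr (contour_sum c (F^~ f) m - contour_sum c' (F^~ f) m) <=
  d * ((size c')%:R * (M + K * M ^+ 2)) * nr f.
Proof.
move=> K0 FM; have [M0 _ _ Fle] := FM.
elim: c c' => [|g c ih] [|g' c']//= cK cE cE'.
  by rewrite /contour_sum !big_nil subrr nr0 !mul0r mulr0 mul0r.
case=> gg' dgg' cc'; rewrite /contour_sum !big_cons opprD addrACA.
have g'K : lipschitz_path K g' by apply: cK; rewrite mem_head.
have d0 : 0 <= d by apply: le_trans (nr_ge0 _) (dgg' 0 _); rewrite lexx ler01.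
rewrite (le_trans (nrD _ _))// -natr1 (addrC _ 1) mulrDl mul1r mulrDr mulrDl lerD//; last first.
  apply: ih => // [p pc'|z zc|z zc].
  - by apply: cK; rewrite inE pc' orbT.
  - by apply: cE; right.
  - by apply: cE'; right.
rewrite -sumrB (le_trans (nr_sum _ _ _))//.
rewrite (@le_trans _ _ (\sum_(i < m.+1) (d * (M + K * M ^+ 2) * nr f) / m.+1%:R))//; last first.
  by rewrite sum_div_const.
apply: ler_sum => i _.
have i1 : 0 <= (node m i : R) <= 1 by rewrite node_in01// ltnW.
have i2 : 0 <= (node m i.+1 : R) <= 1 by rewrite node_in01.
have Eg : E (g (node m i)) by apply: cE; left; exists (node m i).
have Eg' : E (g' (node m i)) by apply: cE'; left; exists (node m i).
rewrite -(subrKA (step g' m i *: F (g (node m i)) f)) -scalerBl -scalerBr.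
rewrite (le_trans (nrD _ _))// !nrZ.
have h1 : nr (step g m i - step g' m i) <= d / m.+1%:R.
  rewrite [X in nr X](_ : _ = (g (node m i.+1) - g' (node m i.+1)) -
    (g (node m i) - g' (node m i))); last by rewrite /step; ring.
  by rewrite (le_trans (gg' _ _ _ _))// node_step ger0_norm.
have h2 := Fle _ f Eg.
have h3 := step_le g'K (ltn_ord i).
have h4 : nr (F (g (node m i)) f - F (g' (node m i)) f) <= M ^+ 2 * nr f * d.
  rewrite (le_trans (bounded_resolvent_lipschitz _ FM _ _))//.
  by rewrite ler_wpM2l ?mulr_ge0 ?exprn_ge0// dgg'.
rewrite [leRHS](_ : _ = d / m.+1%:R * (M * nr f) +
   K / m.+1%:R * (M ^+ 2 * nr f * d)); last by ring.
by rewrite lerD// ler_pM.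
Qed.

(** The contours c and c' may touch. Every small deformation of c is off c',
   and its integral depends continuously on the deformation; so the product
   formula survives in the limit. *)
Lemma resolvent_product_limit E F M K D s0 c c' (cs : R -> seq (R -> R[i])) B B'
    (a : R[i]) : 0 <= K -> 0 < s0 ->
  bounded_resolvent E F M ->
  lipschitz_contour K c -> lipschitz_contour K c' ->
  on_contour c `<=` E -> on_contour c' `<=` E ->
  (forall s, 0 < s <= s0 -> [/\ lipschitz_contour K (cs s),
     on_contour (cs s) `<=` E, near_contours (s * D) (cs s) c,
     (forall z w, on_contour (cs s) z -> on_contour c' w -> w != z) &
     forall e : R, 0 < e -> exists N : nat, forall m, (N <= m)%N ->
       (forall z, on_contour (cs s) z -> nr (cauchy_sum c' m z - a) <= e) /\
       (forall w, on_contour c' w -> nr (cauchy_sum (cs s) m w) <= e)]) ->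
  contour_limit c F B -> contour_limit c' F B' ->
  forall f, B (B' f) = a *: B f.
Proof.
move=> K0 s00 FM cK cK' cE cE' hs [C BC] B'l f.
set P := (size c)%:R * (M + K * M ^+ 2).
have Bs s : 0 < s <= s0 -> exists Bs, [/\ forall g, nr (Bs g - B g) <= s * D * P * nr g &
    Bs (B' f) = a *: Bs f].
  move=> /hs[cKs csE near ne wind].
  have [I [_ Il]] := resolvent_integral_exists K0 FM cKs csE.
  exists I; split; last first.
    rewrite (resolvent_product (a := a) (b := 0) K0 FM cKs cK' csE cE' ne Il B'l).
      by rewrite scale0r addr0.
    by move=> e /wind[N hN]; exists N => m /hN[h1 h2]; split => // w /h2; rewrite subr0.
  move=> g; have [C' Il'] := Il.
  rewrite -subr_le0; apply: (@archi_le0 _ (C' * nr g + C * nr g)) => n.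
  rewrite lerBlDr (le_trans (nr_triangle (contour_sum (cs s) (F^~ g) n) _ _))//.
  rewrite mulrDl -addrA lerD//; first by rewrite nrB mulrAC.
  rewrite (le_trans (nr_triangle (contour_sum c (F^~ g) n) _ _))// [leLHS]addrC lerD//.
    by rewrite mulrAC.
  exact: (near_contour_sum g n K0 FM cK csE cE near).
apply: nr_small_eq => e e0.
set Q := D * P * nr (B' f) + nr a * (D * P * nr f).
pose s := Num.min s0 (e / (`|Q| + 1)).
have q1 : 0 < `|Q| + 1 by rewrite ltr_wpDl.
have s1 : 0 < s <= s0 by rewrite lt_min s00 divr_gt0//= ge_min lexx.
have [I [h1 h2]] := Bs _ s1.
rewrite (le_trans (nr_triangle (I (B' f)) _ _))//.
have := h1 (B' f); rewrite nrB h2 -scalerBr nrZ => t1.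
have t2 := ler_wpM2l (nr_ge0 a) (h1 f).
rewrite (le_trans (lerD t1 t2))//.
rewrite (_ : _ + _ = s * Q); last by rewrite /Q; ring.
have s0' : 0 <= s by have /andP[/ltW] := s1.
rewrite (le_trans (ler_wpM2l s0' (ler_norm Q)))//.
rewrite (@le_trans _ _ (e / (`|Q| + 1) * `|Q|))//.
  by rewrite ler_wpM2r// ge_min lexx orbT.
by rewrite mulrAC ler_pdivrMr// ler_wpM2l ?(ltW e0)// lerDl.
Qed.

End Shrinking.

(** * Orthonormal expansions *)

Lemma nondecreasing_bounded_cauchy (R : realType) (S : nat -> R) (M e : R) :
  {homo S : m n / (m <= n)%N >-> m <= n} -> (forall n, S n <= M) -> 0 < e ->
  exists N : nat, forall m n, (N <= m)%N -> (N <= n)%N -> `|S m - S n| <= e.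
Proof.
move=> Sm SM e0; have hs : has_sup (range S).
  split; first by exists (S 0%N), 0%N.
  by exists M => _ [n _ <-].
have [_ [N _ <-] hN] := sup_adherent e0 hs.
have up n : S n <= sup (range S) by apply: ub_le_sup; [exact: hs.2|exists n].
exists N => m n /Sm h1 /Sm h2; have := up m; have := up n.
rewrite ler_norml; lra.
Qed.

Lemma sum_cauchy_schwarz (R : realType) (a b : nat -> R) n :
  (\sum_(k < n) a k * b k) ^+ 2 <= (\sum_(k < n) a k ^+ 2) * (\sum_(k < n) b k ^+ 2).
Proof.
elim: n => [|n ih]; first by rewrite !big_ord0 expr0n mulr0.
rewrite !big_ord_recr /=; move: ih; set s := \sum_(_ < _) _.
have : 0 <= \sum_(k < n) a k ^+ 2 by apply: sumr_ge0 => i _; exact: sqr_ge0.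
have : 0 <= \sum_(k < n) b k ^+ 2 by apply: sumr_ge0 => i _; exact: sqr_ge0.
move: (\sum_(k < n) a k ^+ 2) (\sum_(k < n) b k ^+ 2) (a n) (b n) => A B x y B0 A0 h.
have P0 : 0 <= A * y ^+ 2 + B * x ^+ 2 by rewrite addr_ge0// mulr_ge0// sqr_ge0.
have q : (2 * s * (x * y)) ^+ 2 <= (A * y ^+ 2 + B * x ^+ 2) ^+ 2.
  have h1 : (2 * s * (x * y)) ^+ 2 <= 4 * (A * B) * (x * y) ^+ 2.
    rewrite [leLHS](_ : _ = s ^+ 2 * (4 * (x * y) ^+ 2)); last by ring.
    rewrite [leRHS](_ : _ = (A * B) * (4 * (x * y) ^+ 2)); last by ring.
    by rewrite ler_wpM2r// mulr_ge0// sqr_ge0.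
  apply: (le_trans h1); rewrite -subr_ge0.
  rewrite [leRHS](_ : _ = (A * y ^+ 2 - B * x ^+ 2) ^+ 2); last by ring.
  exact: sqr_ge0.
have q' : 2 * s * (x * y) <= A * y ^+ 2 + B * x ^+ 2.
  apply: (le_trans (ler_norm _)).
  by rewrite -ler_sqr ?nnegrE// real_normK ?num_real.
rewrite [leLHS](_ : _ = s ^+ 2 + (2 * s * (x * y)) + x ^+ 2 * y ^+ 2); last by ring.
rewrite [leRHS](_ : _ = A * B + (A * y ^+ 2 + B * x ^+ 2) + x ^+ 2 * y ^+ 2); last by ring.
by rewrite lerD// lerD.
Qed.

Lemma sum_cauchy_schwarz_le (R : realType) (a b : nat -> R) n (x y : R) :
  0 <= x -> 0 <= y ->
  \sum_(k < n) a k ^+ 2 <= x ^+ 2 -> \sum_(k < n) b k ^+ 2 <= y ^+ 2 ->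
  \sum_(k < n) a k * b k <= x * y.
Proof.
move=> x0 y0 ax bx; apply: (le_trans (ler_norm _)).
rewrite -ler_sqr ?nnegrE ?mulr_ge0// real_normK ?num_real//.
apply: (le_trans (sum_cauchy_schwarz _ _ _)); rewrite exprMn ler_pM//.
  by apply: sumr_ge0 => i _; exact: sqr_ge0.
by apply: sumr_ge0 => i _; exact: sqr_ge0.
Qed.

Lemma geometric_cauchy_lim (R : realType) (H : completeNormedModType R[i])
    (u : nat -> H) (C : R) : 0 <= C ->
  (forall m, nr (u m.+1 - u m) <= C * 2^-1 ^+ m) ->
  exists l, forall m, nr (l - u m) <= C * 2 * 2^-1 ^+ m.
Proof.
move=> C0 h.
have tail m k : nr (u (m + k)%N - u m) <= C * 2 * (2^-1 ^+ m - 2^-1 ^+ (m + k)).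
  elim: k => [|k ih]; first by rewrite addn0 !subrr nr0 mulr0.
  rewrite addnS (le_trans (nr_triangle (u (m + k)%N) _ _))//.
  rewrite (le_trans (lerD (h _) ih))// exprS; lra.
have tail' m k : nr (u (m + k)%N - u m) <= C * 2 * 2^-1 ^+ m.
  rewrite (le_trans (tail _ _))// ler_wpM2l ?mulr_ge0// lerBlDr lerDl.
  by rewrite exprn_ge0.
have small (e : R) : 0 < e -> exists N : nat, C * 2 * 2^-1 ^+ N <= e.
  move=> /(archi_inv (C * 2))[N hN]; exists N.
  apply: le_trans (hN N (leqnn N)); rewrite ler_wpM2l ?mulr_ge0//.
  rewrite exprVn lef_pV2 ?posrE ?exprn_gt0// -natrX ler_nat.
  exact: ltn_expl.
have [e e0|l hl] := @nr_cauchy_lim R H u.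
  have e20 : 0 < e / 2 by rewrite divr_gt0.
  have [N hN] := small _ e20.
  exists N => m n Nm Nn; rewrite (le_trans (nr_triangle (u N) _ _))//.
  have := tail' N (m - N)%N; have := tail' N (n - N)%N; rewrite !subnKC//.
  rewrite (nrB (u N)); lra.
exists l => m; apply/ler_addgt0Pr => e /hl[N hN].
rewrite (le_trans (nr_triangle (u (m + N)%N) _ _))// addrC lerD//.
by apply: hN; rewrite leq_addl.
Qed.

Section Hilbert.
Context {R : realType} {H : completeNormedModType R[i]}.
Variables (dot : {dot H for Num.conj}) (dotE : hilbert_dot dot).
Implicit Types (f g h : H) (a b : R[i]).

Lemma dotDl f g h : dot (f + g) h = dot f h + dot g h.
Proof. exact: linearDl. Qed.
Lemma dotZl a f h : dot (a *: f) h = a * dot f h.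
Proof. exact: linearZl_LR. Qed.
Lemma dotC f g : dot f g = Num.conj (dot g f).
Proof. by rewrite (hermC dot) expr0 mul1r. Qed.
Lemma dotZr a f h : dot f (a *: h) = Num.conj a * dot f h.
Proof. by rewrite dotC dotZl rmorphM /= -dotC. Qed.
Lemma dot0l f : dot 0 f = 0.
Proof. by rewrite -(scale0r 0) dotZl mul0r. Qed.
Lemma dot0r f : dot f 0 = 0.
Proof. by rewrite dotC dot0l rmorph0. Qed.
Lemma dotNl f g : dot (- f) g = - dot f g.
Proof. by rewrite -scaleN1r dotZl mulN1r. Qed.
Lemma dotNr f g : dot f (- g) = - dot f g.
Proof. by rewrite dotC dotNl rmorphN /= -dotC. Qed.
Lemma dotBl f g h : dot (f - g) h = dot f h - dot g h.
Proof. by rewrite dotDl dotNl. Qed.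
Lemma dotBr f g h : dot f (g - h) = dot f g - dot f h.
Proof. by rewrite dotC dotBl rmorphB /= -!dotC. Qed.
Lemma dot_suml (I : Type) (r : seq I) (P : pred I) (F : I -> H) h :
  dot (\sum_(i <- r | P i) F i) h = \sum_(i <- r | P i) dot (F i) h.
Proof.
apply: (big_morph (fun f => dot f h) (id1 := 0) (op1 := +%R)) => [x y|].
  exact: dotDl.
exact: dot0l.
Qed.

Lemma dot_nr f : dot f f = (nr f ^+ 2)%:C.
Proof. by rewrite -dotE nrE -rmorphXn. Qed.

Lemma nr_sqr_dot f : nr f ^+ 2 = complex.Re (dot f f).
Proof. by rewrite dot_nr. Qed.

Lemma nr_sqrB f g : nr (f - g) ^+ 2 =
  nr f ^+ 2 + nr g ^+ 2 - 2 * complex.Re (dot f g).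
Proof.
rewrite !nr_sqr_dot dotBl !dotBr (dotC g f).
case: (dot f f) (dot g g) (dot f g) => [x1 y1] [x2 y2] [x3 y3] /=; ring.
Qed.

Lemma dot_cauchy_schwarz f g : nr (dot f g) <= nr f * nr g.
Proof.
have [g0|g0] := eqVneq (nr g) 0.
  by rewrite (nr_eq0 g0) dot0r !nr0 mulr0.
have pg : 0 < nr g by rewrite lt_neqAle eq_sym g0 nr_ge0.
pose a := dot f g / (nr g ^+ 2)%:C.
have pg2 : 0 < nr g ^+ 2 by rewrite exprn_gt0.
have h : dot f (a *: g) = ((nr (dot f g) ^+ 2) / nr g ^+ 2)%:C.
  rewrite dotZr /a rmorphM /= fmorphV /= conj_real.
  rewrite mulrAC [_ * dot f g]mulrC -normCK nrE -rmorphXn /=.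
  by rewrite [RHS]rmorphM /= [in RHS]fmorphV.
have := sqr_ge0 (nr (f - a *: g)).
rewrite nr_sqrB h /= nrZ nrf_div nr_real ger0_norm ?(ltW pg2)// => q.
rewrite -ler_sqr ?nnegrE ?mulr_ge0//.
rewrite [leRHS]exprMn -ler_pdivrMr//; move: q; rewrite exprMn expr_div_n.
have -> : nr (dot f g) ^+ 2 / nr g ^+ 2 ^+ 2 * nr g ^+ 2 = nr (dot f g) ^+ 2 / nr g ^+ 2.
  by field.
lra.
Qed.

Section Orthonormal.
Variables (e : nat -> H) (e_on : forall i j, dot (e i) (e j) = (i == j)%:R).
Implicit Types (c : nat -> R[i]).

Lemma nr_basis j : nr (e j) = 1.
Proof.
by apply: (pexpIrn (n := 2)); rewrite ?nnegrE// nr_sqr_dot e_on eqxx expr1n.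
Qed.

Lemma coord_nr f j : nr (dot f (e j)) <= nr f.
Proof. by rewrite (le_trans (dot_cauchy_schwarz _ _))// nr_basis mulr1. Qed.

Definition expansion c (n : nat) : H := \sum_(j < n) c j *: e j.

Lemma dot_expansion c n j : dot (expansion c n) (e j) = if (j < n)%N then c j else 0.
Proof.
rewrite dot_suml; under eq_bigr do rewrite dotZl e_on.
have [jn|nj] := ltnP j n.
  rewrite (bigD1 (Ordinal jn))//= eqxx mulr1 big1 ?addr0// => i.
  by rewrite -val_eqE /= => /negbTE->; rewrite mulr0.
rewrite big1// => i _; rewrite [_ == _](_ : _ = false) ?mulr0//.
by apply/negbTE; rewrite neq_ltn (leq_trans (ltn_ord i) nj).
Qed.

Lemma nr_expansionB c m n : (m <= n)%N ->
  nr (expansion c n - expansion c m) ^+ 2 =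
  \sum_(j < n) nr (c j) ^+ 2 - \sum_(j < m) nr (c j) ^+ 2.
Proof.
move=> mn; rewrite nr_sqrB.
have nn k : nr (expansion c k) ^+ 2 = \sum_(j < k) nr (c j) ^+ 2.
  rewrite nr_sqr_dot {1}/expansion dot_suml raddf_sum /=.
  apply: eq_bigr => j _; rewrite dotZl dotC dot_expansion ltn_ord.
  by rewrite -normCK nrE -rmorphXn.
have -> : complex.Re (dot (expansion c n) (expansion c m)) = \sum_(j < m) nr (c j) ^+ 2.
  rewrite dotC {1}/expansion dot_suml rmorph_sum raddf_sum /=.
  apply: eq_bigr => j _; rewrite -dotC dotZr dot_expansion.
  by rewrite (leq_trans (ltn_ord j) mn) mulrC -normCK nrE -rmorphXn.
rewrite !nn; ring.
Qed.

Definition truncation f n : H := expansion (fun j => dot f (e j)) n.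

Lemma bessel f n : \sum_(j < n) nr (dot f (e j)) ^+ 2 <= nr f ^+ 2.
Proof.
set c := fun j => dot f (e j).
have := sqr_ge0 (nr (f - expansion c n)); rewrite nr_sqrB.
have := nr_expansionB c (leq0n n).
rewrite {2}/expansion big_ord0 subr0 [X in _ - X]big_ord0 subr0 => ->.
have -> : complex.Re (dot f (expansion c n)) = \sum_(j < n) nr (c j) ^+ 2.
  rewrite dotC {1}/expansion dot_suml rmorph_sum raddf_sum /=.
  apply: eq_bigr => j _; rewrite -dotC dotZr.
  by rewrite mulrC -normCK nrE -rmorphXn.
rewrite /c; lra.
Qed.

Lemma truncation_nr f p : nr (truncation f p) <= nr f.
Proof.
rewrite -ler_sqr ?nnegrE//.
have := nr_expansionB (fun j => dot f (e j)) (leq0n p).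
rewrite {2}/expansion big_ord0 subr0 [X in _ - X]big_ord0 subr0 /truncation => ->.
exact: bessel.
Qed.

Lemma expansion_cauchy c (M : R) : (forall n, \sum_(j < n) nr (c j) ^+ 2 <= M) ->
  forall d : R, 0 < d -> exists N : nat, forall m n, (N <= m)%N -> (N <= n)%N ->
    nr (expansion c m - expansion c n) <= d.
Proof.
move=> cM d d0; pose S n := \sum_(j < n) nr (c j) ^+ 2.
have Sm : {homo S : m n / (m <= n)%N >-> m <= n}.
  move=> m n mn; rewrite -subr_ge0 -nr_expansionB//; exact: sqr_ge0.
have [N hN] := nondecreasing_bounded_cauchy Sm cM (exprn_gt0 2 d0).
exists N => m n Nm Nn; wlog nm : m n Nm Nn / (n <= m)%N => [hw|].
  have [/hw|/ltnW/hw] := leqP n m; first exact.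
  by rewrite nrB; exact.
rewrite -ler_sqr ?nnegrE ?(ltW d0)// nr_expansionB//.
exact: le_trans (ler_norm _) (hN _ _ Nm Nn).
Qed.

Lemma riesz_fischer c (M : R) : (forall n, \sum_(j < n) nr (c j) ^+ 2 <= M) ->
  exists f, (forall j, dot f (e j) = c j) /\
    forall d : R, 0 < d -> exists N : nat, forall n, (N <= n)%N ->
      nr (f - expansion c n) <= d.
Proof.
move=> cM; have [f fl] := nr_cauchy_lim (expansion_cauchy cM).
exists f; split => // j; apply/eqP; rewrite -subr_eq0; apply/eqP.
apply: nr_small0 => d d0; have [N hN] := fl _ d0.
have := hN (maxn N j.+1) (leq_maxl _ _); set n := maxn _ _ => h.
have -> : c j = dot (expansion c n) (e j) by rewrite dot_expansion leq_maxr.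
rewrite -dotBl (le_trans (dot_cauchy_schwarz _ _))//.
by rewrite nr_basis mulr1.
Qed.

Hypothesis e_total : forall f, (forall j, dot f (e j) = 0) -> f = 0.

Lemma coord_ext f g : (forall j, dot f (e j) = dot g (e j)) -> f = g.
Proof.
move=> h; apply/eqP; rewrite -subr_eq0; apply/eqP; apply: e_total => j.
by rewrite dotBl h subrr.
Qed.

Lemma truncation_cvg f (d : R) : 0 < d -> exists N : nat, forall n, (N <= n)%N ->
  nr (f - truncation f n) <= d.
Proof.
have [g [gf gl]] := @riesz_fischer (fun j => dot f (e j)) _ (bessel f).
by move: gl; rewrite (coord_ext gf) => gl; exact: gl.
Qed.

Lemma parseval_le f (M : R) : 0 <= M ->
  (forall n, \sum_(j < n) nr (dot f (e j)) ^+ 2 <= M ^+ 2) -> nr f <= M.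
Proof.
move=> M0 h; apply: nr_le_lim => d /(truncation_cvg f)[N /(_ N (leqnn N)) hN].
exists (truncation f N) => //.
rewrite -ler_sqr ?nnegrE//.
have := nr_expansionB (fun j => dot f (e j)) (leq0n N).
by rewrite {2}/expansion big_ord0 subr0 [X in _ - X]big_ord0 subr0 => ->.
Qed.

Lemma coord_exists c (M : R) : 0 <= M -> (forall n, \sum_(j < n) nr (c j) ^+ 2 <= M ^+ 2) ->
  exists f, (forall j, dot f (e j) = c j) /\ nr f <= M.
Proof.
move=> M0 cM; have [f [fE _]] := riesz_fischer cM; exists f; split => //.
by apply: parseval_le => // n; under eq_bigr do rewrite fE.
Qed.

Lemma diagonal_map (c : nat -> R[i]) (C : R) f : 0 <= C -> (forall j, nr (c j) <= C) ->
  exists g, (forall j, dot g (e j) = c j * dot f (e j)) /\ nr g <= C * nr f.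
Proof.
move=> C0 cC; apply: coord_exists => [|n]; first by rewrite mulr_ge0.
rewrite exprMn (le_trans _ (ler_wpM2l (sqr_ge0 C) (bessel f n)))// mulr_sumr ler_sum// => j _.
by rewrite nrM exprMn ler_wpM2r ?sqr_ge0// ler_sqr ?nnegrE.
Qed.

End Orthonormal.
End Hilbert.

(** The equation f + D f = g is solved by iterating f = g - D f. *)
Lemma neumann (R : realType) (H : completeNormedModType R[i]) (D : H -> H) :
  linear D -> (forall f, nr (D f) <= 2^-1 * nr f) ->
  exists Winv, boundedly_invertible (fun f => f + D f) Winv.
Proof.
move=> lD Dle.
have inj f : f + D f = 0 -> f = 0.
  move=> /eqP; rewrite addr_eq0 => /eqP fD; apply: nr_le0.
  have := Dle f; have := nr_ge0 f; rewrite -(nrN (D f)) -fD; lra.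
have surj g : exists f, f + D f = g.
  pose u m := iter m (fun f => g - D f) 0.
  have uS m : u m.+1 = g - D (u m) by [].
  have [m|l ul] := @geometric_cauchy_lim R H u (nr g) (nr_ge0 g).
    elim: m => [|m ih].
      by rewrite uS /u /= (linear_fun0 lD) !subr0 expr0 mulr1.
    rewrite uS (uS m) opprD opprK addrACA subrr add0r addrC -(linear_funB _ _ lD).
    rewrite (le_trans (Dle _))// nrB exprS mulrCA ler_wpM2l//.
  exists l; apply/eqP; rewrite -subr_eq0; apply/eqP/nr_le0; apply: (@archi_le0 _ (nr g * 4)) => m.
  have half : 2^-1 ^+ m <= m.+1%:R^-1 :> R.
    by rewrite exprVn lef_pV2 ?posrE ?exprn_gt0// -natrX ler_nat; exact: ltn_expl.
  have -> : l + D l - g = (l - u m.+1) + D (l - u m).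
    rewrite uS (linear_funB _ _ lD) opprB [RHS]addrC (addrCA l) subrKA.
    by rewrite -addrA addrCA.
  rewrite (le_trans (nrD _ _))// (le_trans (lerD (ul _) (Dle _)))//.
  have := ul m; rewrite exprS => h.
  rewrite (@le_trans _ _ (nr g * 4 * 2^-1 ^+ m))//.
    have p : 0 <= nr g * 2^-1 ^+ m by rewrite mulr_ge0 ?exprn_ge0.
    have h2 : 2^-1 * nr (l - u m) <= 2^-1 * (nr g * 2 * 2^-1 ^+ m).
      by rewrite ler_wpM2l.
    move: h2 p; lra.
  by rewrite ler_wpM2l// mulr_ge0.
pose Winv g := sval (cid (surj g)).
have WP g : Winv g + D (Winv g) = g := svalP (cid (surj g)).
have lW : linear (fun f => f + D f).
  move=> a f g; rewrite (linear_funD _ _ lD) (linear_funZ _ _ lD) addrACA.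
  by rewrite scalerDr.
have winj f f' : f + D f = f' + D f' -> f = f'.
  move=> e; apply/eqP; rewrite -subr_eq0; apply/eqP; apply: inj.
  by rewrite (linear_funB _ _ lD) addrACA -opprD e subrr.
have lWinv : linear Winv.
  by move=> a f g; apply: winj; rewrite WP (lW a) !WP.
exists Winv; split.
- split => //; exists 2 => f; rewrite !nrE -real_complexM ler_complex.
  rewrite (le_trans (nrD _ _))//; have := Dle f; have := nr_ge0 f; lra.
- split => //; exists 2 => f; rewrite !nrE -real_complexM ler_complex.
  have := nr_le_sub (Winv f) (Winv f + D (Winv f)).
  rewrite opprD addrA subrr sub0r nrN WP; have := Dle (Winv f); lra.
- by move=> f; apply: winj; rewrite WP.
- exact: WP.
Qed.

(** * Operators and completeness of the eigenvectors *)

Section OperatorBasics.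
Context {R : realType} {H : completeNormedModType R[i]}.
Implicit Types (T : operator H) (f g : H).

Lemma domZ T a f : dom T f -> dom T (a *: f).
Proof. by move=> df; have := domP a df (dom0 T); rewrite addr0. Qed.
Lemma domD T f g : dom T f -> dom T g -> dom T (f + g).
Proof. by move=> df dg; have := domP 1 df dg; rewrite scale1r. Qed.
Lemma domB T f g : dom T f -> dom T g -> dom T (f - g).
Proof. by move=> df dg; rewrite -scaleN1r; apply/domD/domZ. Qed.
Lemma dom_sum T (n : nat) (F : nat -> H) : (forall i, dom T (F i)) ->
  dom T (\sum_(i < n) F i).
Proof.
move=> dF; elim: n => [|n ih]; first by rewrite big_ord0; exact: dom0.
by rewrite big_ord_recr; exact: domD.
Qed.

Lemma app0 T : T 0 = 0.
Proof.
have := Defs.appP (-1) (dom0 T) (dom0 T).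
by rewrite scaler0 addr0 scaleN1r addNr.
Qed.
Lemma appZ T a f : dom T f -> T (a *: f) = a *: T f.
Proof. by move=> df; have := Defs.appP a df (dom0 T); rewrite app0 !addr0. Qed.
Lemma appD T f g : dom T f -> dom T g -> T (f + g) = T f + T g.
Proof. by move=> df dg; have := Defs.appP 1 df dg; rewrite !scale1r. Qed.
Lemma appB T f g : dom T f -> dom T g -> T (f - g) = T f - T g.
Proof.
move=> df dg; rewrite -scaleN1r appD ?appZ ?scaleN1r//.
by rewrite -scaleN1r; exact: domZ.
Qed.
Lemma app_sum T (n : nat) (F : nat -> H) : (forall i, dom T (F i)) ->
  T (\sum_(i < n) F i) = \sum_(i < n) T (F i).
Proof.
move=> dF; elim: n => [|n ih]; first by rewrite !big_ord0 app0.
by rewrite !big_ord_recr /= appD ?ih//; exact: dom_sum.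
Qed.

Lemma is_resolvent_inj T z B g g' : is_resolvent T z B ->
  dom T g -> dom T g' -> z *: g - T g = z *: g' - T g' -> g = g'.
Proof. by case=> _ _ K dg dg' e; rewrite -(K _ dg) e K. Qed.

Lemma resolventE T z B f : is_resolvent T z B -> resolvent T z f = B f.
Proof.
move=> Br; have [_ BK _] := Br; have [d e] := BK f.
rewrite /resolvent; case: xgetP => [g _ [dg eg]|/(_ (B f)) []]; last by [].
by apply: (is_resolvent_inj Br dg d); rewrite eg e.
Qed.

Lemma resolvent_identity T z w f : resolvent_set T z -> resolvent_set T w ->
  resolvent T z f - resolvent T w f = (w - z) *: resolvent T z (resolvent T w f).
Proof.
move=> [B Br] [B' Br']; rewrite !(resolventE _ Br) !(resolventE _ Br').
have [[lB _] _ BT] := Br; have [_ TB' _] := Br'.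
have [dg eg] := TB' f; set g := B' f in dg eg *.
have -> : f = (z *: g - T g) + (w - z) *: g.
  by rewrite scalerBl addrC addrA subrK eg.
by rewrite (linear_funD _ _ lB) BT// (linear_funZ _ _ lB) addrAC subrr add0r.
Qed.

Lemma bounded_operator_nr (B : H -> H) : bounded_operator B ->
  exists2 M : R, 0 <= M & forall f, nr (B f) <= M * nr f.
Proof.
case=> _ [M hM]; exists `|M| => // f.
have := hM f; rewrite !nrE -real_complexM ler_complex => /le_trans; apply.
by rewrite ler_wpM2r// ler_norm.
Qed.

End OperatorBasics.

(** What is used of A in the study of T: its square root S is diagonal in the
   basis psi, contains the basis vectors in its domain as a core, and has the
   largest domain that this allows. *)
Record diagonal_root (R : realType) (H : completeNormedModType R[i])
    (dot : {dot H for Num.conj}) (mu : nat -> R) (psi : nat -> H) (S : operator H)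
    : Prop := DiagonalRoot {
  root_orthonormal : forall i j, dot (psi i) (psi j) = (i == j)%:R;
  root_total : forall f, (forall j, dot f (psi j) = 0) -> f = 0;
  root_dom : forall n, dom S (psi n);
  root_coord : forall f n, dom S f ->
    dot (S f) (psi n) = (Num.sqrt (mu n))%:C * dot f (psi n);
  root_truncation : forall f (d : R), dom S f -> 0 < d -> exists n,
    nr (f - truncation dot psi f n) <= d /\ nr (S (f - truncation dot psi f n)) <= d;
  root_exists : forall (a : nat -> R[i]) (M : R), 0 <= M ->
    (forall n, \sum_(j < n) mu j * nr (a j) ^+ 2 <= M ^+ 2) ->
    exists f, [/\ dom S f, forall j, dot f (psi j) = a j & nr (S f) <= M] }.

Section Spectral.
Context {R : realType} {H : completeNormedModType R[i]}.
Variables (dot : {dot H for Num.conj}) (dotE : hilbert_dot dot).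
Variables (A : operator H) (mu : nat -> R) (psi : nat -> H).
Hypotheses (A_sa : self_adjoint dot A) (A_compact : compact_resolvent A)
    (mu_pos : forall n, 0 < mu n) (mu_incr : forall n, mu n < mu n.+1)
    (A_spectrum : spectrum A = [set z | exists n, z = (mu n)%:C])
    (A_simple : forall n, simple_eigenpair A (mu n) (psi n)).

Lemma mu_lt m n : (m < n)%N -> mu m < mu n.
Proof. by apply: (homo_ltn lt_trans). Qed.

Lemma mu_le m n : (m <= n)%N -> mu m <= mu n.
Proof. by rewrite leq_eqVlt => /orP[/eqP->//|/mu_lt/ltW]. Qed.

Lemma self_adjoint_sym (S : operator H) f g : self_adjoint dot S -> dom S f -> dom S g ->
  dot (S f) g = dot f (S g).
Proof. by case=> _ h df dg; apply: (h g (S g)).1. Qed.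

Lemma nr_psi n : nr (psi n) = 1.
Proof. by rewrite /nr; have [_ _ -> _] := A_simple n. Qed.

Lemma psi_orthonormal i j : dot (psi i) (psi j) = (i == j)%:R.
Proof.
have [<-|ij] := eqVneq i j.
  by rewrite (dot_nr dotE) nr_psi expr1n.
have [di ei _ _] := A_simple i; have [dj ej _ _] := A_simple j.
have := self_adjoint_sym A_sa di dj.
rewrite ei ej dotZl dotZr conj_real => /eqP; rewrite -subr_eq0 -mulrBl mulf_eq0.
rewrite -rmorphB fmorph_eq0 subr_eq0 => /orP[/eqP e|/eqP//].
by case: (ltngtP i j) ij => // /mu_lt; rewrite e ltxx.
Qed.

Lemma eigenvalue_mu w (x : R) : w != 0 -> dom A w -> A w = x%:C *: w ->
  exists n (c : R[i]), w = c *: psi n.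
Proof.
move=> w0 dw ew.
have : spectrum A x%:C.
  move=> [B Br]; have [[lB _] _ BK] := Br; have := BK _ dw; rewrite ew subrr.
  by rewrite (linear_fun0 lB) => /esym/eqP; apply/negP.
rewrite A_spectrum => -[n xn]; exists n; have [_ _ _ hs] := A_simple n.
by apply: hs => //; rewrite ew xn.
Qed.

(** The resolvent K of A at 0 is compact and self-adjoint, and it maps the
   orthogonal complement N of the eigenvectors to itself. If N is not trivial, let
   b > 0 be the norm of K on N. The images K g of almost maximising unit vectors
   have a cluster point g0 with K (K g0) = b^2 g0, and then g0 or K g0 + b g0 is an
   eigenvector of K, hence of A, in N. But every eigenvector of A is a multiple of
   some psi_n. *)
Lemma psi_total f : (forall j, dot f (psi j) = 0) -> f = 0.
Proof.
move=> f_orth; apply: contrapT => /eqP f_neq0.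
have [K Kr] : resolvent_set A 0.
  apply: contrapT => h0; have : spectrum A 0 by [].
  rewrite A_spectrum => -[n /esym/eqP]; rewrite -[0]/(0%:C) eq_complex /= eqxx andbT.
  by rewrite gt_eqF.
have [Kb AK KA] := Kr; have [lK _] := Kb.
have [M M0 KM] := bounded_operator_nr Kb.
have AKf g : A (K g) = - g.
  by have [_] := AK g; rewrite scale0r sub0r => e; rewrite -[in RHS]e opprK.
have dK g : dom A (K g) by have [] := AK g.
have Ksym g h : dot (K g) h = dot g (K h).
  rewrite -[h in LHS]opprK -(AKf h) dotNr -(self_adjoint_sym A_sa (dK g) (dK h)).
  by rewrite AKf dotNl opprK.
pose N := [set g : H | forall j, dot g (psi j) = 0].
have KN g : N g -> N (K g).
  move=> Ng j; have [dj ej _ _] := A_simple j.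
  have := KA _ dj; rewrite ej scale0r sub0r -scaleNr (linear_funZ _ _ lK) => e.
  have /eqP := Ng j; rewrite -[in X in X == _]e dotZr -Ksym mulf_eq0.
  case/orP => [|/eqP//].
  by rewrite -rmorphN conj_real fmorph_eq0 oppr_eq0 gt_eqF.
have NZ (a : R[i]) : forall g : H, N g -> N (a *: g).
  by move=> g Ng j; rewrite dotZl Ng mulr0.
have ND : forall g h : H, N g -> N h -> N (g + h).
  by move=> g h Ng Nh j; rewrite dotDl Ng Nh addr0.
pose V : set R := (fun h => nr (K h)) @` [set h | N h /\ nr h <= 1].
have V0 : V 0.
  exists 0; rewrite ?(linear_fun0 lK) ?nr0//; split; last by rewrite nr0.
  by move=> j; rewrite dot0l.
have Vs : has_sup V.
  split; first by exists 0.
  exists M => _ [g [_ g1] <-]; rewrite (le_trans (KM g))//.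
  by rewrite -[leRHS]mulr1 ler_wpM2l.
pose b := sup V.
have Vb g : N g -> nr g <= 1 -> nr (K g) <= b.
  by move=> Ng g1; apply: ub_le_sup; [exact: Vs.2|exists g].
have Kb' g : N g -> nr (K g) <= b * nr g.
  move=> Ng; have [g0|g0] := eqVneq (nr g) 0.
    by rewrite (nr_eq0 g0) (linear_fun0 lK) nr0 mulr0.
  have pg : 0 < nr g by rewrite lt_neqAle eq_sym g0 nr_ge0.
  have := Vb ((nr g)^-1%:C *: g) (NZ _ _ Ng).
  rewrite (linear_funZ _ _ lK) !nrZ nr_real ger0_norm ?invr_ge0// mulVf// lexx.
  by move=> /(_ erefl); rewrite mulrC ler_pdivrMr.
have b0 : 0 < b.
  rewrite lt_neqAle eq_sym; apply/andP; split; last by apply: ub_le_sup; [exact: Vs.2|exact: V0].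
  apply/eqP => b0; have := Kb' _ f_orth; rewrite b0 mul0r => k0.
  have Kf0 : K f = 0 by apply: nr_le0.
  have := AKf f; rewrite Kf0 app0 => /esym/eqP; rewrite oppr_eq0.
  exact/negP.
(* The compact resolvent Bz may be taken at another point z; K = Bz (z K + 1). *)
have [z [[Bz Bzr] [_ Bzc]]] := A_compact.
have [Bzb BzK KBz] := Bzr; have [lBz _] := Bzb.
have KBzE g : K g = Bz (z *: K g + g).
  by have := KBz _ (dK g); rewrite AKf opprK => ->.
pose L := (nr z * M + 1).
have L0 : 0 < L by rewrite ltr_wpDl// mulr_ge0.
have KL g : K g = L%:C *: Bz (L^-1%:C *: (z *: K g + g)).
  rewrite (linear_funZ _ _ lBz) scalerA -KBzE -real_complexM divff ?gt_eqF//.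
  by rewrite scale1r.
pose P (e : R) : set H := (fun h => Bz (L^-1%:C *: (z *: K h + h))) @`
   [set h | [/\ N h, nr h <= 1 & b - e <= nr (K h)]].
pose FF := filter_from [set e : R | 0 < e] P.
have FFp : ProperFilter FF.
  apply: filter_from_proper.
    apply: filter_from_filter; first by exists 1 => /=.
    move=> e e' /= e0 e'0; exists (Num.min e e') => /=; first by rewrite lt_min e0.
    move=> _ [g [Ng g1 gb] <-]; split; exists g => //; split => //;
      rewrite (le_trans _ gb)// lerD2l lerN2 ge_min lexx ?orbT//.
  move=> e /= e0; have [_ [g [Ng g1] <-] bg] := sup_adherent e0 Vs.
  by exists (Bz (L^-1%:C *: (z *: K g + g))), g => //; split => //; exact: ltW.
pose Im := resolvent A z @` [set f | `|f| <= 1].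
have FIm : FF (closure Im).
  exists 1 => //= _ [g [Ng g1 _] <-]; apply: subset_closure.
  exists (L^-1%:C *: (z *: K g + g)); last by rewrite (resolventE _ Bzr).
  rewrite /= nrE -[1]/(1%:C) ler_complex nrZ nr_real ger0_norm ?invr_ge0 ?(ltW L0)//.
  rewrite mulrC ler_pdivrMr// mul1r (le_trans (nrD _ _))// lerD// nrZ.
  rewrite ler_wpM2l// (le_trans (KM _))// -[leRHS]mulr1 ler_wpM2l//.
rewrite precompactE in Bzc.
have [p [_ clp]] := Bzc _ FFp FIm.
pose g0 := L%:C *: p.
have approx (e : R) : 0 < e -> exists g, [/\ N g, nr g <= 1, b - e <= nr (K g) &
    nr (K g - g0) <= e].
  move=> e0; have eL : 0 < e / L by rewrite divr_gt0.
  have nb : nbhs p (ball p (e / L)%:C).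
    by apply: nbhsx_ballx; rewrite -[0]/(0%:C) ltr_complex.
  have FP : FF (P e) by exists e.
  have [_ [[g [Ng g1 gb] <-]]] := clp _ _ FP nb.
  rewrite -ball_normE /= nrE ltr_complex => /ltW h.
  exists g; split => //; rewrite KL /g0 -scalerBr nrZ nr_real ger0_norm ?(ltW L0)//.
  by rewrite mulrC -ler_pdivlMr// nrB.
have g0_ge (e : R) : 0 < e -> b - e - e <= nr g0.
  move=> /approx[g [Ng g1 gb gd]].
  have := nr_le_sub (K g) g0; lra.
have g0n : g0 != 0.
  apply/eqP => e; have e40 : 0 < b / 4 by rewrite divr_gt0.
  have := g0_ge _ e40; rewrite e nr0; lra.
have Ng0 : N g0.
  move=> j; apply: nr_small0 => e /approx[g [Ng g1 _ gd]].
  have -> : dot g0 (psi j) = - dot (K g - g0) (psi j).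
    by rewrite dotBl (KN _ Ng) sub0r opprK.
  rewrite nrN (le_trans (dot_cauchy_schwarz dotE _ _))//.
  by rewrite nr_psi mulr1.
have KKg0 : K (K g0) = (b ^+ 2)%:C *: g0.
  apply: nr_small_eq => e e0.
  pose Q := M ^+ 2 + M + b ^+ 2.
  have Q0 : 0 < Q by rewrite ltr_wpDl ?exprn_gt0// addr_ge0 ?exprn_ge0.
  pose d := e / Q.
  have d0 : 0 < d by rewrite divr_gt0.
  pose d' := Num.min (Num.min b d) (d ^+ 2 / (2 * b ^+ 3)).
  have d'0 : 0 < d'.
    rewrite !lt_min b0 d0 /=; apply: divr_gt0; first exact: exprn_gt0.
    by apply: mulr_gt0 => //; exact: exprn_gt0.
  have [g [Ng g1 gb gd]] := approx _ d'0.
  have d'b : d' <= b by rewrite !ge_min lexx.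
  have d'd : d' <= d by rewrite !ge_min lexx !orbT.
  have d'd2 : 2 * b ^+ 3 * d' <= d ^+ 2.
    by rewrite mulrC -ler_pdivlMr ?mulr_gt0 ?exprn_gt0// ge_min lexx orbT.
  (* |K K g - b^2 g|^2 = |K K g|^2 - 2 b^2 |K g|^2 + b^4 |g|^2, where |K g| >= b - d'. *)
  have near : nr (K (K g) - (b ^+ 2)%:C *: g) <= d.
    rewrite -ler_sqr ?nnegrE ?(ltW d0)// (nr_sqrB dotE) dotZr.
    rewrite conj_real Ksym (dot_nr dotE) -real_complexM /= nrZ nr_real.
    rewrite ger0_norm ?exprn_ge0 ?(ltW b0)//.
    have k1 := Kb' _ (KN _ Ng); have k2 := Kb' _ Ng.
    have s1 : nr (K (K g)) ^+ 2 <= b ^+ 2 * nr (K g) ^+ 2.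
      by rewrite -exprMn ler_pXn2r// ?nnegrE ?mulr_ge0 ?(ltW b0).
    have s2 : (b ^+ 2 * nr g) ^+ 2 <= b ^+ 2 * b ^+ 2.
      rewrite exprMn [X in X * _]expr2 ler_piMr ?mulr_ge0 ?exprn_ge0 ?(ltW b0)//.
      by rewrite exprn_ile1.
    have s3 : b ^+ 2 * (b ^+ 2 - 2 * b * d') <= b ^+ 2 * nr (K g) ^+ 2.
      rewrite ler_wpM2l ?exprn_ge0 ?(ltW b0)//.
      have t : (b - d') ^+ 2 <= nr (K g) ^+ 2.
        by rewrite ler_pXn2r// ?nnegrE ?subr_ge0.
      have := sqr_ge0 d'; move: t; rewrite !expr2; lra.
    move: s1 s2 s3 d'd2; rewrite !exprS !expr0 !mulr1; lra.
  have lK2 : K (K g0) - (b ^+ 2)%:C *: g0 = - K (K (K g - g0)) +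
      K (K (K g) - (b ^+ 2)%:C *: g) + (b ^+ 2)%:C *: (K g - g0).
    rewrite !(linear_funB _ _ lK) (linear_funZ _ g lK) scalerBr.
    move: (K (K (K g))) (K (K g0)) ((b ^+ 2)%:C *: K g) ((b ^+ 2)%:C *: g0) => u v w x.
    by rewrite opprB !subrKA.
  rewrite lK2 (le_trans (nrD _ _))//.
  have t1 := nrD (- K (K (K g - g0))) (K (K (K g) - (b ^+ 2)%:C *: g)).
  have t2 : nr (- K (K (K g - g0))) <= M ^+ 2 * d.
    rewrite nrN (le_trans (KM _))// expr2 -mulrA ler_wpM2l// (le_trans (KM _))//.
    by rewrite ler_wpM2l// (le_trans gd).
  have t3 : nr (K (K (K g) - (b ^+ 2)%:C *: g)) <= M * d.
    by rewrite (le_trans (KM _))// ler_wpM2l.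
  have t4 : nr ((b ^+ 2)%:C *: (K g - g0)) <= b ^+ 2 * d.
    rewrite nrZ nr_real ger0_norm ?exprn_ge0 ?(ltW b0)// ler_wpM2l ?exprn_ge0 ?(ltW b0)//.
    exact: le_trans d'd.
  rewrite (_ : e = M ^+ 2 * d + M * d + b ^+ 2 * d).
    by rewrite lerD// (le_trans t1)// lerD.
  by rewrite -!mulrDl /d /Q mulrC divfK ?gt_eqF.
have noeig w (k : R) : N w -> w != 0 -> k != 0 -> K w = k%:C *: w -> False.
  move=> Nw w0 k0 Kw.
  have wK : w = K (k^-1%:C *: w).
    by rewrite (linear_funZ _ _ lK) Kw scalerA -real_complexM mulVf// scale1r.
  have [n [c wc]] : exists n (c : R[i]), w = c *: psi n.
    apply: (@eigenvalue_mu w (- k^-1)) => //; first by rewrite wK; exact: dK.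
    by rewrite [in LHS]wK AKf rmorphN scaleNr.
  have := Nw n; rewrite wc dotZl psi_orthonormal eqxx mulr1 => c0.
  by move: w0; rewrite wc c0 scale0r eqxx.
have [h0|h0] := eqVneq (K g0 + b%:C *: g0) 0.
  apply: (noeig g0 (- b)) => //; first by rewrite oppr_eq0 gt_eqF.
  by apply/eqP; rewrite rmorphN scaleNr -addr_eq0 h0.
apply: (noeig (K g0 + b%:C *: g0) b) => //.
- by apply: ND; [exact: KN|exact: NZ].
- by rewrite gt_eqF.
- rewrite (linear_funD _ _ lK) (linear_funZ b%:C g0 lK) KKg0 scalerDr scalerA addrC.
  by rewrite expr2 real_complexM.
Qed.


(** * The square root of A and its form domain *)

Variables (S : operator H) (A_sqrt : is_sqrt dot A S).

(** S commutes with A, so it preserves the line spanned by psi_n; there S^2 = mu_n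
   and S is nonnegative. *)
Lemma sqrt_psi n : dom S (psi n) /\ S (psi n) = (Num.sqrt (mu n))%:C *: psi n.
Proof.
have [S_sa S_pos dA AS] := A_sqrt.
have [dn en n1 hn] := A_simple n.
have [d1 d2] : [set f | dom S f /\ dom S (S f)] (psi n) by rewrite -dA.
have SS : S (S (psi n)) = (mu n)%:C *: psi n by rewrite -AS.
have dAS : dom A (S (psi n)) by rewrite dA; split; rewrite ?SS//; exact: domZ.
have eAS : A (S (psi n)) = (mu n)%:C *: S (psi n).
  by rewrite AS// SS appZ.
split => //; have [c cE] := hn _ dAS eAS; rewrite cE; congr (_ *: _).
have psi0 : psi n != 0.
  by apply/eqP => e; have := n1; rewrite e normr0 => /eqP; rewrite eq_sym oner_eq0.
have c2 : c ^+ 2 = (mu n)%:C.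
  have : (c ^+ 2 - (mu n)%:C) *: psi n = 0.
    by rewrite scalerBl -SS cE appZ// cE scalerA expr2 subrr.
  by move/eqP; rewrite scaler_eq0 (negbTE psi0) orbF subr_eq0 => /eqP.
have c0 : 0 <= c.
  have := S_pos _ d1; rewrite cE dotZl psi_orthonormal eqxx mulr1; exact.
have cR : c = (complex.Re c)%:C.
  by move: c0; rewrite lecE /= => /andP[/eqP ic _]; case: (c) ic => a b /= ->.
have rc0 : 0 <= complex.Re c by move: c0; rewrite lecE => /andP[].
rewrite cR; congr (_%:C).
have := c2; rewrite cR -rmorphXn => /complexI /= <-.
by rewrite sqrtr_sqr ger0_norm.
Qed.

Lemma dot_sqrt f n : dom S f -> dot (S f) (psi n) = (Num.sqrt (mu n))%:C * dot f (psi n).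
Proof.
move=> df; have [S_sa _ _ _] := A_sqrt; have [dp ep] := sqrt_psi n.
by rewrite (self_adjoint_sym S_sa df dp) ep dotZr conj_real.
Qed.

Lemma sqrt_mu_sqr n : Num.sqrt (mu n) ^+ 2 = mu n.
Proof. by rewrite sqr_sqrtr// ltW. Qed.

(** If f has the coordinates a and g the coordinates sqrt(mu_j) a_j, then
   <S h, f> = <h, g> for all h in the domain of S; as S is self-adjoint, f is in
   its domain. *)
Lemma dom_sqrt_coords (a : nat -> R[i]) (M : R) : 0 <= M ->
  (forall n, \sum_(j < n) mu j * nr (a j) ^+ 2 <= M ^+ 2) ->
  exists f, [/\ dom S f, forall j, dot f (psi j) = a j & nr (S f) <= M].
Proof.
move=> M0 aM.
have [n|g [gE gM]] := @coord_exists _ _ _ dotE _ psi_orthonormal psi_total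
    (fun j => (Num.sqrt (mu j))%:C * a j) M M0.
  rewrite (le_trans _ (aM n))// ler_sum// => j _.
  by rewrite nrM nr_real exprMn real_normK ?num_real// sqrt_mu_sqr.
have [n|f [fE _]] := @riesz_fischer _ _ _ dotE _ psi_orthonormal a (M ^+ 2 / mu 0%N).
  rewrite ler_pdivlMr// (le_trans _ (aM n))// mulr_suml ler_sum// => j _.
  by rewrite mulrC ler_wpM2r ?sqr_ge0// mu_le.
have [S_sa S_pos dA AS] := A_sqrt.
have [_ /(_ f g)[_ hfg]] := S_sa.
have [df Sf] : dom S f /\ S f = g.
  apply: hfg => h dh; apply: nr_small_eq => e e0.
  pose Q := nr f + nr g + 1.
  have Q0 : 0 < Q by rewrite ltr_wpDl// addr_ge0.
  have e1 : 0 < e / Q by rewrite divr_gt0.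
  have [N1 h1] := truncation_cvg dotE psi_orthonormal psi_total h e1.
  have [N2 h2] := truncation_cvg dotE psi_orthonormal psi_total (S h) e1.
  pose n := maxn N1 N2.
  have {h1} := h1 n (leq_maxl _ _); have {h2} := h2 n (leq_maxr _ _).
  set hn := truncation _ _ h n; set Shn := truncation _ _ _ n => h2 h1.
  have eq : dot Shn f = dot hn g.
    rewrite /Shn /hn /truncation /expansion !(dot_suml dot).
    apply: eq_bigr => j _; rewrite !dotZl dot_sqrt//.
    rewrite (dotC dot _ f) (dotC dot _ g) gE fE rmorphM /= conj_real; ring.
  have -> : dot (S h) f - dot h g = dot (S h - Shn) f + - dot (h - hn) g.
    by rewrite !dotBl eq; ring.
  rewrite (le_trans (nrD _ _))// nrN.
  have t1 := dot_cauchy_schwarz dotE (S h - Shn) f.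
  have t2 := dot_cauchy_schwarz dotE (h - hn) g.
  have t3 := ler_wpM2r (nr_ge0 f) h2; have t4 := ler_wpM2r (nr_ge0 g) h1.
  rewrite (le_trans (lerD (le_trans t1 t3) (le_trans t2 t4)))// -mulrDr.
  rewrite mulrAC ler_pdivrMr// ler_wpM2l ?(ltW e0)// /Q; lra.
by exists f; rewrite Sf.
Qed.

Lemma dom_truncation f n : dom S (truncation dot psi f n).
Proof.
apply: (@dom_sum _ _ S n (fun j => dot f (psi j) *: psi j)) => j.
by apply: domZ; have [] := sqrt_psi j.
Qed.

Lemma sqrt_truncation f n : dom S f -> S (truncation dot psi f n) = truncation dot psi (S f) n.
Proof.
move=> df; rewrite /truncation /expansion (@app_sum _ _ S n (fun j => dot f (psi j) *: psi j)); last first.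
  by move=> j; apply: domZ; have [] := sqrt_psi j.
apply: eq_bigr => j _; have [dj ej] := sqrt_psi j.
by rewrite appZ// ej dot_sqrt// scalerA mulrC.
Qed.

Lemma sqrt_truncation_cvg f (d : R) : dom S f -> 0 < d -> exists n,
  nr (f - truncation dot psi f n) <= d /\ nr (S (f - truncation dot psi f n)) <= d.
Proof.
move=> df d0.
have [N1 h1] := truncation_cvg dotE psi_orthonormal psi_total f d0.
have [N2 h2] := truncation_cvg dotE psi_orthonormal psi_total (S f) d0.
exists (maxn N1 N2); split; first by apply: h1; rewrite leq_maxl.
rewrite appB//; last exact: dom_truncation.
by rewrite sqrt_truncation//; apply: h2; rewrite leq_maxr.
Qed.

Lemma sqrt_diagonal_root : diagonal_root dot mu psi S.
Proof.
split; [exact: psi_orthonormal|exact: psi_total|by move=> n; have [] := sqrt_psi n|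
  by move=> f n; exact: dot_sqrt|exact: sqrt_truncation_cvg|exact: dom_sqrt_coords].
Qed.

(** A is the operator associated with its own form, so that the theory of the
   perturbed operator contains that of A. *)
Lemma A_associated : associated_operator dot (dom S)
  (fun f g => sqrt_form dot S f g + 0) A.
Proof.
have [S_sa S_pos dA AS] := A_sqrt.
move=> f h; split.
  move=> [df <-]; have [d1 d2] : [set f | dom S f /\ dom S (S f)] f by rewrite -dA.
  by split => // g dg; rewrite addr0 /sqrt_form AS// (self_adjoint_sym S_sa d2 dg).
move=> [df hg].
have [_ /(_ (S f) h)[_ K]] := S_sa.
have [dSf SSf] : dom S (S f) /\ S (S f) = h.
  apply: K => g dg; rewrite dotC [RHS]dotC; congr Num.conj.
  by rewrite -hg// addr0.
have dAf : dom A f by rewrite dA.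
by rewrite AS.
Qed.

End Spectral.

(** * Winding numbers and deformations of circles and rectangles *)

Section WindingNumbers.
Context {R : realType}.
Implicit Types (z w : R[i]).

Lemma Re_mul_conj z w : complex.Re (Num.conj z * w) =
  complex.Re z * complex.Re w + complex.Im z * complex.Im w.
Proof. by case: z w => [a b] [c d] /=; ring. Qed.

(** The tangent to the concentric circle through w separates w from the circle. *)
Lemma circle_exterior (c r s e : R) : 0 <= r -> 0 < s -> 0 < e ->
  exists N : nat, forall m, (N <= m)%N -> forall w, r + s <= nr (w - c%:C) ->
    nr (cauchy_sum (circle c r) m w) <= e.
Proof.
move=> r0 s0 e0.
have K0 : 0 <= 4 * pi * r by rewrite !mulr_ge0 ?pi_ge0.
have [N hN] := cauchy_sum_exterior K0 s0 e0 (@circle_lipschitz R c r r0) (@circle_closed R c r).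
exists N => m /hN h w wr.
have wp : 0 < nr (w - c%:C) by rewrite (lt_le_trans _ wr)// ltr_wpDl.
have u1 : nr ((nr (w - c%:C))^-1%:C * (w - c%:C)) = 1.
  by rewrite nrM nr_real ger0_norm ?invr_ge0// mulVf// gt_eqF.
apply: (h _ _ u1) => z /(on_circle r0) zr.
have zs : w - z = (w - c%:C) - (z - c%:C) by ring.
rewrite zs mulrBr raddfB /= lerBrDr.
have h1 := Re_unit_le (z - c%:C) u1; rewrite zr in h1.
have -> : complex.Re (Num.conj ((nr (w - c%:C))^-1%:C * (w - c%:C)) * (w - c%:C)) =
    nr (w - c%:C).
  rewrite Re_mul_conj; have := nr_sqr (w - c%:C).
  set x := nr _ in wp *; case: (w - c%:C) => a b /= h2.
  rewrite !mul0r subr0 addr0 -!mulrA -mulrDr -!expr2 -h2 expr2 mulKf ?gt_eqF//.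
rewrite (le_trans _ wr)// addrC lerD2r//.
Qed.

Lemma circle_interior (c r s e : R) : 0 < r -> 0 < s -> 0 < e ->
  exists N : nat, forall m, (N <= m)%N -> forall w, nr (w - c%:C) <= r - s ->
    nr (cauchy_sum (circle c r) m w - two_pi_i) <= e.
Proof.
move=> r0 s0 e0.
have K0 : 0 <= 4 * pi * r by rewrite !mulr_ge0 ?pi_ge0 ?ltW.
have [N hN] := cauchy_sum_interior K0 s0 e0 (ltW r0) (@circle_lipschitz R c r (ltW r0))
  (@circle_closed R c r) (fun e => @circle_winding_center R c r e r0).
exists N => m /hN h w wr; apply: h => [|z x zc /andP[x0 x1]].
  by rewrite (le_trans wr)// gerBl ltW.
have zr := on_circle (ltW r0) zc.
have := nr_le_sub (z - c%:C) (x%:C * (w - c%:C)).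
rewrite zr nrM nr_real ger0_norm//.
have -> : z - c%:C - (x%:C * (w - c%:C)) = z - (c%:C + x%:C * (w - c%:C)) by ring.
have := ler_pM x0 (nr_ge0 _) x1 wr; lra.
Qed.

Lemma nr_sign_units : [/\ nr (1 : R[i]) = 1, nr (-1 : R[i]) = 1,
  nr (0 +i* 1 : R[i]) = 1 & nr (0 +i* -1 : R[i]) = 1].
Proof.
have h (a b : R) : a ^+ 2 + b ^+ 2 = 1 -> nr (a +i* b) = 1.
  by move=> e; apply: nr_eq_sqr; rewrite ?expr1n.
split; [exact: nr1|by rewrite nrN nr1|apply: h|apply: h];
  by rewrite ?sqrrN expr0n expr1n add0r.
Qed.

Lemma rect_exterior (x1 x2 y1 y2 s e : R) : x1 < x2 -> y1 < y2 -> 0 < s -> 0 < e ->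
  exists N : nat, forall m, (N <= m)%N -> forall w,
    [\/ x2 + s <= complex.Re w, complex.Re w <= x1 - s,
      y2 + s <= complex.Im w | complex.Im w <= y1 - s] ->
    nr (cauchy_sum (rectangle x1 x2 y1 y2) m w) <= e.
Proof.
move=> x12 y12 s0 e0.
have K0 : 0 <= (x2 - x1) + (y2 - y1) by rewrite addr_ge0// subr_ge0 ltW.
have [N hN] := cauchy_sum_exterior K0 s0 e0 (rectangle_lipschitz (ltW x12) (ltW y12))
  (@rectangle_closed R x1 x2 y1 y2).
have [n1 n2 n3 n4] := nr_sign_units.
exists N => m /hN h w [] hw; [apply: (h _ _ n1)|apply: (h _ _ n2)|
   apply: (h _ _ n3)|apply: (h _ _ n4)] => z /(on_rectangle (ltW x12) (ltW y12))[hx hy _];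
   rewrite Re_mul_conj !raddfB /=; move: hx hy => /andP[? ?] /andP[? ?]; lra.
Qed.

Lemma rect_interior (x1 x2 y1 y2 s e : R) : x1 < x2 -> y1 < y2 -> 0 < s -> 0 < e ->
  exists N : nat, forall m, (N <= m)%N -> forall w,
    x1 + s <= complex.Re w <= x2 - s -> y1 + s <= complex.Im w <= y2 - s ->
    nr (cauchy_sum (rectangle x1 x2 y1 y2) m w - two_pi_i) <= e.
Proof.
move=> x12 y12 s0 e0.
have K0 : 0 <= (x2 - x1) + (y2 - y1) by rewrite addr_ge0// subr_ge0 ltW.
have [N hN] := cauchy_sum_interior K0 s0 e0 K0
  (rectangle_lipschitz (ltW x12) (ltW y12))
  (@rectangle_closed R x1 x2 y1 y2) (fun e => @rectangle_winding_center R x1 x2 y1 y2 e x12 y12).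
exists N => m /hN h w /andP[wx1 wx2] /andP[wy1 wy2]; apply: h.
  rewrite (le_trans (nr_ReIm _))//; case: w wx1 wx2 wy1 wy2 => a b /= *.
  by rewrite lerD// ler_norml; apply/andP; split; lra.
move=> z x /(on_rectangle (ltW x12) (ltW y12))[zx zy /or4P side] /andP[t0 t1].
set p := z - _.
have hR : complex.Re p = complex.Re z - ((x1 + x2) / 2 + x * (complex.Re w - (x1 + x2) / 2)).
  by rewrite /p; case: (z) (w) => [a b] [c d] /=; ring.
have hI : complex.Im p = complex.Im z - ((y1 + y2) / 2 + x * (complex.Im w - (y1 + y2) / 2)).
  by rewrite /p; case: (z) (w) => [a b] [c d] /=; ring.
have := nr_Re p; have := nr_Im p; rewrite !ler_norml => /andP[i1 i2] /andP[r1 r2].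
rewrite hR in r1 r2; rewrite hI in i1 i2.
case: side => /eqP side; rewrite side in r1 r2 i1 i2; nra.
Qed.

Lemma near_circle (c r s : R) : 0 <= s ->
  near_contours (s * (4 * pi + 2)) (circle c (r - s)) (circle c r).
Proof.
move=> s0 /=; split => //.
- have h := @circle_lipschitz R 0 s s0 _ (mem_head _ [::]).
  move=> x y x1 y1; have := h x y x1 y1; rewrite nrB /= => h'.
  rewrite [X in nr X](_ : _ = (0 + s * cos (2 * pi * y)) +i* (s * sin (2 * pi * y)) -
    (0 + s * cos (2 * pi * x)) +i* (s * sin (2 * pi * x))); last first.
    by apply: eq_ReIm => /=; ring.
  rewrite (le_trans h')// ler_wpM2r//.
  by rewrite mulrC ler_wpM2l// lerDl.
- move=> t _; rewrite (le_trans (nr_ReIm _))//=.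
  have -> : c + (r - s) * cos (2 * pi * t) - (c + r * cos (2 * pi * t)) =
     - (s * cos (2 * pi * t)) by ring.
  have -> : (r - s) * sin (2 * pi * t) - r * sin (2 * pi * t) =
     - (s * sin (2 * pi * t)) by ring.
  have c1 : `|cos (2 * pi * t)| <= 1 by rewrite ler_norml cos_geN1 cos_le1.
  have s1 : `|sin (2 * pi * t)| <= 1 by rewrite ler_norml sin_geN1 sin_le1.
  rewrite !normrN !normrM (ger0_norm s0) -mulrDr ler_wpM2l//.
  have := @pi_ge0 R; lra.
Qed.

Lemma near_segment (d : R) (p q p' q' : R[i]) : nr (p - p') <= d -> nr (q - q') <= d ->
  lipschitz_path (2 * d) (fun t => segment p q t - segment p' q' t) /\
  forall t, 0 <= t <= 1 -> nr (segment p q t - segment p' q' t) <= 2 * d.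
Proof.
move=> pd qd.
have d0 : 0 <= d by exact: le_trans (nr_ge0 _) pd.
have e t : segment p q t - segment p' q' t = segment (p - p') (q - q') t.
  by rewrite /segment; ring.
have k : nr ((q - q') - (p - p')) <= 2 * d.
  by rewrite (le_trans (nr_subr _ _))//; lra.
split.
  by move=> x y x1 y1; rewrite !e; exact: segment_lipschitz.
move=> t /andP[t0 t1]; rewrite e.
have -> : segment (p - p') (q - q') t = (1 - t)%:C * (p - p') + t%:C * (q - q').
  by rewrite /segment rmorphB /=; ring.
rewrite (le_trans (nrD _ _))// !nrM !nr_real !ger0_norm ?subr_ge0//.
have t10 : 0 <= 1 - t by rewrite subr_ge0.
have := ler_wpM2l t0 qd; have := ler_wpM2l t10 pd; lra.
Qed.

Lemma near_rectangle (x1 x2 y1 y2 s : R) : 0 <= s ->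
  near_contours (s * 4) (rectangle (x1 + s) (x2 - s) (y1 + s) (y2 - s))
    (rectangle x1 x2 y1 y2).
Proof.
move=> s0.
have corner (a b a' b' : R) : `|a - a'| <= s -> `|b - b'| <= s ->
    nr ((a +i* b) - (a' +i* b')) <= 2 * s.
  move=> h1 h2; rewrite (le_trans (nr_ReIm _))//=; lra.
have ns (a : R) : `|a - s - a| <= s by rewrite addrAC subrr sub0r normrN ger0_norm.
have ps (a : R) : `|a + s - a| <= s by rewrite addrAC subrr add0r ger0_norm.
have -> : s * 4 = 2 * (2 * s) by ring.
have c1 := corner _ _ _ _ (ps x1) (ps y1); have c2 := corner _ _ _ _ (ns x2) (ps y1).
have c3 := corner _ _ _ _ (ns x2) (ns y2); have c4 := corner _ _ _ _ (ps x1) (ns y2).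
have [l1 m1] := near_segment c1 c2; have [l2 m2] := near_segment c2 c3.
have [l3 m3] := near_segment c3 c4; have [l4 m4] := near_segment c4 c1.
by split => //; split => //; split => //; split.
Qed.

End WindingNumbers.

(** * Distance to the spectrum of A *)

Section Gaps.
Context {R : realType}.
Variables (mu : nat -> R).
Hypotheses (mu_pos : forall n, 0 < mu n) (mu_incr : forall n, mu n < mu n.+1).
Implicit Types (z : R[i]).

Local Notation dist z j := (nr (z - (mu j)%:C)).

Lemma gap_succ n : 2 * gap mu n <= mu n.+1 - mu n.
Proof.
case: n => [|n] /=; first by rewrite mulrC divfK.
by rewrite mulrC divfK// ge_min lexx orbT.
Qed.

Lemma gap_pred n : 2 * gap mu n.+1 <= mu n.+1 - mu n.
Proof. by rewrite mulrC /= divfK// ge_min lexx. Qed.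

Lemma gap_gt0 n : 0 < gap mu n.
Proof.
by case: n => [|n]; rewrite /= divr_gt0// ?lt_min ?subr_gt0 ?mu_incr.
Qed.

(** The denominators of the gap condition. *)
Definition spread (n j : nat) : R :=
  if j == n then gap mu n else `|mu n - mu j|.

Lemma mu_dist_gap n j : j != n -> 2 * gap mu n <= `|mu n - mu j|.
Proof.
case: (ltngtP j n) => // jn _.
  rewrite (le_trans _ (ler_norm _))//; case: n jn => // n jn.
  by rewrite (le_trans (gap_pred n))// lerD2l lerN2 mu_le.
rewrite distrC (le_trans _ (ler_norm _))// (le_trans (gap_succ n))// lerD2r.
exact: mu_le.
Qed.

Lemma spread_ge n j : gap mu n <= spread n j.
Proof.
rewrite /spread; case: eqVneq => // /mu_dist_gap h.
by rewrite (le_trans _ h)// ler_peMl// ?ler1n// ltW ?gap_gt0.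
Qed.

Lemma spread_gt0 n j : 0 < spread n j.
Proof. exact: lt_le_trans (gap_gt0 n) (spread_ge n j). Qed.

Lemma spread_sym n j : j != n -> spread n j = spread j n.
Proof. by move=> jn; rewrite /spread (negbTE jn) eq_sym (negbTE jn) distrC. Qed.

Lemma nr_dist_Re z j : `|complex.Re z - mu j| <= dist z j.
Proof. by have := nr_Re (z - (mu j)%:C); rewrite raddfB. Qed.

Lemma nr_dist_Im z j : `|complex.Im z| <= dist z j.
Proof. by have := nr_Im (z - (mu j)%:C); rewrite raddfB /= subr0. Qed.

(** Up to a factor 2, the distances from the eigenvalues to z are those that occur
   in the gap condition for mu_m. The circles of radius between half the gap and the
   gap have this property ([annulus_near]), and so do the sides of the rectangle. *)
Definition near_eigenvalue (m : nat) z : Prop :=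
  forall j, spread m j / 2 <= dist z j.

Lemma annulus_near m z : gap mu m / 2 <= dist z m <= gap mu m ->
  near_eigenvalue m z.
Proof.
move=> /andP[h1 h2] j; rewrite /spread; have [->//|jm] := eqVneq j m.
have := mu_dist_gap jm.
have : `|mu m - mu j| <= dist z j + dist z m.
  rewrite -nr_real rmorphB /= (le_trans (nr_triangle z _ _))//.
  by rewrite nrB addrC.
lra.
Qed.

(** The abscissa of the right side of the rectangle. *)
Definition edge (N : nat) : R := mu N + gap mu N.

Lemma edge_gt0 N : 0 < edge N.
Proof. by rewrite addr_gt0 ?mu_pos ?gap_gt0. Qed.

Lemma mu_edge N j : (j <= N)%N -> mu j + gap mu N <= edge N.
Proof. by move=> jN; rewrite lerD2r mu_le. Qed.

Lemma edge_mu N j : (N < j)%N -> edge N + gap mu j <= mu j.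
Proof.
move=> Nj; case: j Nj => // j Nj; rewrite /edge.
have := gap_succ N; have := gap_pred j.
have : mu N <= mu j by exact: mu_le.
have : mu N.+1 <= mu j.+1 by exact: mu_le.
lra.
Qed.

Lemma edge_dist_gt0 N j : 0 < `|edge N - mu j|.
Proof.
rewrite normr_gt0 subr_eq0; case: (leqP j N) => h.
  by rewrite gt_eqF// (lt_le_trans _ (mu_edge h))// ltrDl gap_gt0.
by rewrite lt_eqF// (lt_le_trans _ (edge_mu h))// ltrDl gap_gt0.
Qed.

Lemma edge_dist_ge N j : gap mu N <= `|edge N - mu j|.
Proof.
case: (leqP j N) => h.
  by rewrite (le_trans _ (ler_norm _))// lerBrDl mu_edge.
rewrite distrC (le_trans _ (ler_norm _))//.
have := edge_mu h; case: j h => // j h; rewrite /edge.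
have := gap_succ N; have : mu N.+1 <= mu j.+1 by exact: mu_le.
lra.
Qed.

Lemma edge_dist_spread N j : spread N j / 2 <= `|edge N - mu j|.
Proof.
rewrite /spread; have [->|jN] := eqVneq j N.
  by rewrite /edge addrAC subrr add0r ger0_norm ?(ltW (gap_gt0 _))// ler_pdivrMr// ler_peMr// ?(ltW (gap_gt0 _))// ler1n.
have := mu_dist_gap jN.
have : `|mu N - mu j| <= `|edge N - mu j| + gap mu N.
  rewrite [X in `|X| <= _](_ : _ = (edge N - mu j) + - gap mu N); last by rewrite /edge; ring.
  by rewrite (le_trans (ler_normD _ _))// normrN (ger0_norm (ltW (gap_gt0 N))).
lra.
Qed.

(** On and beyond the left, upper and lower sides, z is farther from mu_j than the
   foot of the right side is. *)
Lemma outer_dist N h z j : edge N <= h -> complex.Re z <= edge N ->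
  complex.Re z <= - h \/ h <= `|complex.Im z| ->
  `|edge N - mu j| <= dist z j.
Proof.
move=> eh zN hz; have mj := mu_pos j; have eN := edge_gt0 N.
have hR := nr_dist_Re z j; have hI := nr_dist_Im z j.
have [je|ej] := leP (mu j) (edge N); last first.
  rewrite distrC gtr0_norm ?subr_gt0// (le_trans _ hR)// distrC.
  rewrite (le_trans _ (ler_norm _))// lerD2l lerN2//.
rewrite ger0_norm ?subr_ge0//; case: hz => hz.
  by rewrite (le_trans _ hR)// distrC (le_trans _ (ler_norm _))//; lra.
by rewrite (le_trans _ hI)//; lra.
Qed.

Lemma outer_dist_h N h z j : edge N <= h -> 
  complex.Re z <= - h \/ h <= `|complex.Im z| -> h <= dist z j.
Proof.
move=> eh hz; have mj := mu_pos j; have eN := edge_gt0 N.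
case: hz => hz; last exact: le_trans (nr_dist_Im z j).
rewrite (le_trans _ (nr_dist_Re z j))// distrC (le_trans _ (ler_norm _))//; lra.
Qed.

Lemma outer_near N h z : edge N <= h -> complex.Re z <= edge N ->
  complex.Re z <= - h \/ h <= `|complex.Im z| -> near_eigenvalue N z.
Proof.
move=> eh zN hz j; exact: le_trans (edge_dist_spread N j) (outer_dist j eh zN hz).
Qed.

Lemma right_side_near N z : edge N - gap mu N / 2 <= complex.Re z <= edge N ->
  near_eigenvalue N z.
Proof.
move=> /andP[z1 z2] j; apply: le_trans (nr_dist_Re z j).
have gN := gap_gt0 N.
case: (ltngtP j N) => h.
- rewrite /spread (ltn_eqF h) (le_trans _ (ler_norm _))//.
  have m := mu_lt mu_incr h.
  rewrite gtr0_norm ?subr_gt0//; move: z1; rewrite /edge; lra.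
- rewrite (le_trans (edge_dist_spread N j))// distrC [leRHS]distrC.
  have e := edge_mu h; have gj := gap_gt0 j.
  by rewrite !ger0_norm ?subr_ge0//; lra.
- rewrite h /spread eqxx (le_trans _ (ler_norm _))//; move: z1; rewrite /edge; lra.
Qed.

(** To the right of the edge and outside the discs, compare with the
   eigenvalue nearest to Re z. *)
Lemma right_near N z : (forall B : R, exists n, B < mu n) ->
  edge N <= complex.Re z ->
  (forall k, (N < k)%N -> gap mu k <= dist z k) ->
  exists2 m, (N <= m)%N & near_eigenvalue m z.
Proof.
move=> unb zN hz; set x := complex.Re z in zN *.
have [p px pmin] : exists2 p, x < mu p & forall q, (q < p)%N -> mu q <= x.
  have ex : exists n, x < mu n by exact: unb.
  exists (ex_minn ex); first by case: ex_minnP.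
  case: ex_minnP => m _ hm q qm; rewrite leNgt; apply/negP => /hm.
  by rewrite leqNgt qm.
have gN := gap_gt0 N.
have Np : (N < p)%N.
  rewrite ltnNge; apply/negP => /(mu_le mu_incr) h.
  by move: zN px h; rewrite /edge; lra.
case: p Np px pmin => // n Nn px pmin.
have nx : mu n <= x by exact: pmin.
have [m nm hm] : exists2 m, (N <= m)%N & forall j, `|x - mu m| <= `|x - mu j|.
  have far j : (j <= n)%N -> `|x - mu n| <= `|x - mu j|.
    move=> jn; have := mu_le mu_incr jn; move=> ?.
    by rewrite !ger0_norm ?subr_ge0//; lra.
  have far' j : (n < j)%N -> `|x - mu n.+1| <= `|x - mu j|.
    move=> nj; have := mu_le mu_incr nj; move=> ?.
    by rewrite distrC [leRHS]distrC !ger0_norm ?subr_ge0//; lra.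
  have [le|lt] := leP `|x - mu n| `|x - mu n.+1|.
    exists n => // j; case: (leqP j n) => [/far//|/far']; exact: le_trans.
  exists n.+1; first exact: leqW.
  move=> j; case: (leqP j n) => [/far|/far'//]; apply: le_trans; exact: ltW.
exists m => // j; rewrite /spread; have [->|jm] := eqVneq j m.
  rewrite (@le_trans _ _ (gap mu m))//.
    by rewrite ler_pdivrMr// ler_peMr ?ler1n// ltW// gap_gt0.
  move: nm; rewrite leq_eqVlt => /orP[/eqP <-|/hz//].
  by rewrite (le_trans _ (nr_dist_Re z N))// (le_trans _ (ler_norm _))// lerBrDl.
have := nr_dist_Re z j; have := hm j; rewrite -/x.
have : `|mu m - mu j| <= `|x - mu m| + `|x - mu j|.
  by rewrite -[mu m - mu j](subrKA x) (le_trans (ler_normD _ _))// distrC.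
lra.
Qed.

Variables (omega : nat -> R) (N : nat) (eta : R).
Hypothesis omega_eta : forall m n, (N <= m)%N ->
  \sum_(j < n) omega j ^+ 2 / spread m j <= eta.

(** Here q bounds the norm of the perturbation relative to z - A, since the matrix of
   v is dominated by the rank one matrix omega_j omega_k. *)
Definition small_sum (z : R[i]) (q d : R) : Prop :=
  (forall n, \sum_(k < n) omega k ^+ 2 / dist z k <= q) /\
  (forall j, d <= dist z j).

Lemma near_small_sum m z : (N <= m)%N -> near_eigenvalue m z ->
  small_sum z (2 * eta) (gap mu m / 2).
Proof.
move=> Nm near; split => [n|j]; last first.
  by rewrite (le_trans _ (near j))// ler_wpM2r ?invr_ge0// spread_ge.
rewrite (le_trans _ (ler_wpM2l _ (omega_eta n Nm)))// mulr_sumr ler_sum// => j _.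
rewrite mulrCA ler_wpM2l ?sqr_ge0//.
have sp := spread_gt0 m j.
rewrite -invf_div lef_pV2 ?posrE ?divr_gt0//.
by rewrite (lt_le_trans _ (near j))// divr_gt0.
Qed.

(** The union of the regions where the perturbation is small, cut down so that all
   resolvents on it have a common bound. *)
Definition good_set (d : R) : set R[i] :=
  [set z | exists m, [/\ (N <= m)%N, near_eigenvalue m z & d <= gap mu m / 2]].

Lemma good_small_sum d z : good_set d z -> small_sum z (2 * eta) d.
Proof.
move=> [m [Nm near dm]]; have [h1 h2] := near_small_sum Nm near.
by split => // j; exact: le_trans dm (h2 j).
Qed.

End Gaps.

(** * The resolvent of the perturbed operator *)

Section PerturbedForm.
Context {R : realType} {H : completeNormedModType R[i]}.
Variables (dot : {dot H for Num.conj}) (dotE : hilbert_dot dot).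
Variables (mu : nat -> R) (psi : nat -> H) (S : operator H).
Hypotheses (mu_pos : forall n, 0 < mu n) (S_root : diagonal_root dot mu psi S).
Variables (v : H -> H -> R[i]) (omega : nat -> R) (Com : R) (T : operator H).
Hypotheses (v_sesqui : sesquilinear_on (dom S) v) (v_bounded : bounded_form S v)
  (omega_ge0 : forall j, 0 <= omega j)
  (v_omega : forall j k, `|v (psi j) (psi k)| <= (omega j * omega k)%:C)
  (omega_sum : forall n, \sum_(j < n) omega j ^+ 2 / mu j <= Com)
  (T_assoc : associated_operator dot (dom S)
      (fun f g => sqrt_form dot S f g + v f g) T).

Local Notation co f j := (dot f (psi j)).
Local Notation dist z j := (nr (z - (mu j)%:C)).
Local Notation small z q d := (small_sum mu omega z q d).
Local Notation tr := (truncation dot psi).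

Let psi_on := root_orthonormal S_root.
Let psi_tot := root_total S_root.
Let dS := root_dom S_root.

Lemma form_bound : exists2 M : R, 0 <= M & forall f g, dom S f -> dom S g ->
  nr (v f g) <= M * (nr (S f) * nr (S g)).
Proof.
have [M hM] := v_bounded; exists `|M| => // f g df dg.
have := hM _ _ df dg; rewrite !nrE -!real_complexM ler_complex => /le_trans; apply.
by rewrite ler_wpM2r ?mulr_ge0// ler_norm.
Qed.

Lemma form_nr j k : nr (v (psi j) (psi k)) <= omega j * omega k.
Proof. by rewrite -ler_complex -nrE. Qed.

Lemma form0l g : dom S g -> v 0 g = 0.
Proof.
move=> dg; have := v_sesqui.1 (-1) 0 0 g (dom0 S) (dom0 S) dg.
by rewrite scaler0 addr0 mulN1r addNr.
Qed.

Lemma form0r f : dom S f -> v f 0 = 0.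
Proof.
move=> df; have := v_sesqui.2 (-1) f 0 0 df (dom0 S) (dom0 S).
by rewrite scaler0 addr0 rmorphN1 mulN1r addNr.
Qed.

Lemma formBl f f' g : dom S f -> dom S f' -> dom S g -> v (f - f') g = v f g - v f' g.
Proof.
move=> df df' dg; have := v_sesqui.1 (-1) f' f g df' df dg.
by rewrite scaleN1r addrC mulN1r [RHS]addrC.
Qed.

Lemma formBr f g g' : dom S f -> dom S g -> dom S g' -> v f (g - g') = v f g - v f g'.
Proof.
move=> df dg dg'; have := v_sesqui.2 (-1) f g' g df dg' dg.
by rewrite scaleN1r addrC rmorphN1 mulN1r [RHS]addrC.
Qed.

Lemma dom_tr f n : dom S (tr f n).
Proof.
apply: (@dom_sum _ _ S n (fun j => co f j *: psi j)) => j; exact: domZ.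
Qed.

Lemma form_truncl f g n : dom S g ->
  v (tr f n) g = \sum_(j < n) co f j * v (psi j) g.
Proof.
move=> dg; elim: n => [|n ih].
  by rewrite /truncation /expansion !big_ord0 form0l.
have dt := dom_tr f n; move: ih dt.
rewrite /truncation /expansion !big_ord_recr /= => ih dt.
by rewrite addrC (v_sesqui.1 _ _ _ _ (dS n) dt dg) ih addrC.
Qed.

Lemma form_truncr f g n : dom S f ->
  v f (tr g n) = \sum_(j < n) Num.conj (co g j) * v f (psi j).
Proof.
move=> df; elim: n => [|n ih].
  by rewrite /truncation /expansion !big_ord0 form0r.
have dt := dom_tr g n; move: ih dt.
rewrite /truncation /expansion !big_ord_recr /= => ih dt.
by rewrite addrC (v_sesqui.2 _ _ _ _ df (dS n) dt) ih addrC.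
Qed.

Lemma Com_ge0 : 0 <= Com.
Proof. by have := omega_sum 0; rewrite big_ord0. Qed.

(** Cauchy-Schwarz with weights: sqrt(mu_k) |f_k| is square summable. *)
Lemma omega_l1 f n : dom S f ->
  \sum_(k < n) omega k * nr (co f k) <= Num.sqrt Com * nr (S f).
Proof.
move=> df.
rewrite (eq_bigr (fun k : 'I_n => (omega k / Num.sqrt (mu k)) * nr (co (S f) k))); last first.
  move=> k _; rewrite (root_coord S_root)// nrM nr_real ger0_norm ?sqrtr_ge0//.
  by rewrite mulrA divfK// gt_eqF// sqrtr_gt0.
apply: (sum_cauchy_schwarz_le (a := fun k => omega k / Num.sqrt (mu k))
   (b := fun k => nr (co (S f) k))); rewrite ?sqrtr_ge0//.
  rewrite sqr_sqrtr ?Com_ge0// (le_trans _ (omega_sum n))// ler_sum// => k _.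
  by rewrite expr_div_n sqr_sqrtr// ltW.
exact: bessel psi_on _ _.
Qed.

(** For truncations of f this is the bound on the entries of v; boundedness of v on
   the form domain extends it to f. *)
Lemma form_psi_le f j (M : R) : dom S f ->
  (forall n, \sum_(k < n) omega k * nr (co f k) <= M) ->
  nr (v f (psi j)) <= omega j * M.
Proof.
move=> df fM; have [Mv Mv0 vM] := form_bound.
apply: nr_le_lim => e e0.
pose Q := Mv * nr (S (psi j)) + 1.
have Q0 : 0 < Q by rewrite ltr_wpDl// mulr_ge0.
have [n [_ hn]] := root_truncation S_root df (divr_gt0 e0 Q0).
exists (v (tr f n) (psi j)).
  rewrite -formBl//; last exact: dom_tr.
  rewrite (le_trans (vM _ _ _ _))//; first by apply: domB => //; exact: dom_tr.
  rewrite mulrCA (le_trans (ler_wpM2r _ hn)) ?mulr_ge0//.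
  by rewrite mulrAC ler_pdivrMr// ler_wpM2l ?(ltW e0)// /Q lerDl.
rewrite form_truncl// (le_trans (nr_sum _ _ _))//.
rewrite (le_trans _ (ler_wpM2l (omega_ge0 j) (fM n)))// mulr_sumr ler_sum// => k _.
rewrite nrM mulrC mulrA ler_wpM2r// (le_trans (form_nr _ _))//.
by rewrite mulrC.
Qed.

(** The equation (z - T) f = h in coordinates. *)
Definition solves (z : R[i]) (h f : H) : Prop :=
  dom S f /\ forall j, (z - (mu j)%:C) * co f j = co h j + v f (psi j).

Lemma solvesP z h f : solves z h f <-> dom T f /\ z *: f - T f = h.
Proof.
have coS g j : dom S g -> dot (S g) (S (psi j)) = (mu j)%:C * co g j.
  move=> dg; rewrite dotC; have := root_coord S_root.
  have -> : S (psi j) = (Num.sqrt (mu j))%:C *: psi j.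
    apply: (coord_ext psi_tot) => k; rewrite (root_coord S_root)// dotZl psi_on.
    by have [->|] := eqVneq j k; rewrite ?mulr0.
  move=> hr; rewrite dotZl rmorphM /= -dotC hr// conj_real mulrA.
  by rewrite -real_complexM -expr2 sqr_sqrtr// ltW.
split; last first.
  move=> [dTf <-]; have [df eq] := (T_assoc f (T f)).1 (conj dTf erefl).
  split => // j; have := eq _ (dS j); rewrite /sqrt_form coS//.
  rewrite dotBl dotZl => <-; ring.
move=> [df eq].
have : dom T f /\ T f = z *: f - h.
  apply/T_assoc; split => // g dg; apply/eqP; rewrite -subr_eq0; apply/eqP.
  have [Mv Mv0 vM] := form_bound.
  apply: nr_small0 => e e0.
  pose Q := nr (S f) + Mv * nr (S f) + nr (z *: f - h) + 1.
  have Q0 : 0 < Q by rewrite ltr_wpDl// !addr_ge0 ?mulr_ge0.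
  have [n [h1 h2]] := root_truncation S_root dg (divr_gt0 e0 Q0).
  have dt := dom_tr g n.
  have zero : dot (S f) (S (tr g n)) + v f (tr g n) - dot (z *: f - h) (tr g n) = 0.
    rewrite form_truncr// /truncation /expansion.
    rewrite (@app_sum _ _ S n (fun j => co g j *: psi j)); last by move=> j; exact: domZ.
    rewrite (dotC dot (S f)) (dotC dot (_ - _)) !dot_suml !rmorph_sum -big_split -sumrB /=.
    apply: big1 => j _; rewrite appZ// !dotZl !rmorphM /= -!dotC.
    have -> : dot (z *: f - h) (psi j) = z * co f j - co h j by rewrite dotBl dotZl.
    have -> : dot (S f) (S (psi j)) = (mu j)%:C * co f j by rewrite coS.
    have -> : v f (psi j) = (z - (mu j)%:C) * co f j - co h j by rewrite eq addrC addKr.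
    ring.
  have -> : sqrt_form dot S f g + v f g - dot (z *: f - h) g =
    dot (S f) (S (g - tr g n)) + v f (g - tr g n) + - dot (z *: f - h) (g - tr g n).
    rewrite -[LHS]subr0 -zero /sqrt_form appB// formBr// !dotBr; ring.
  have dd : dom S (g - tr g n) by exact: domB.
  have t1 := dot_cauchy_schwarz dotE (S f) (S (g - tr g n)).
  have t2 := vM _ _ df dd.
  have t3 := dot_cauchy_schwarz dotE (z *: f - h) (g - tr g n).
  rewrite (le_trans (nrD _ _))// nrN (le_trans (lerD (le_trans (nrD _ _) (lerD t1 t2)) t3))//.
  have u1 := ler_wpM2l (nr_ge0 (S f)) h2.
  have u2 := ler_wpM2l Mv0 u1; have u3 := ler_wpM2l (nr_ge0 (z *: f - h)) h1.
  rewrite (le_trans (lerD (lerD u1 u2) u3))//.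
  rewrite [leLHS](_ : _ = e / Q * (Q - 1)); last by rewrite /Q; ring.
  rewrite mulrAC ler_pdivrMr// ler_wpM2l ?(ltW e0)//; lra.
by move=> [dT ->]; split => //; rewrite opprB addrC subrK.
Qed.

Lemma solves_coord_le z q d h f j (L : R) : 0 < d -> small z q d ->
  solves z h f -> (forall n, \sum_(k < n) omega k * nr (co f k) <= L) ->
  nr (co f j) <= nr (co h j) / dist z j + omega j / dist z j * L.
Proof.
move=> d0 [zq zd] [df eq] fL.
have zj : 0 < dist z j by exact: lt_le_trans (zd j).
have := form_psi_le j df fL; have := congr1 (@nr R _) (eq j).
rewrite nrM => e1 e2; rewrite mulrAC -mulrDl ler_pdivlMr// mulrC e1.
by rewrite (le_trans (nrD _ _))// lerD2l.
Qed.

(** The supremum L of these sums is finite by [omega_l1], and the coordinates of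
   the equation give L <= M + q L. *)
Lemma a_priori z q d h f (M : R) : 0 < d -> q <= 2^-1 -> small z q d ->
  solves z h f ->
  (forall n, \sum_(k < n) omega k / dist z k * nr (co h k) <= M) ->
  forall n, \sum_(k < n) omega k * nr (co f k) <= 2 * M.
Proof.
move=> d0 q2 zz sf hM.
have [zq zd] := zz; have [df eq] := sf.
pose s n := \sum_(k < n) omega k * nr (co f k).
have sb : has_sup (range s).
  split; first by exists (s 0%N), 0%N.
  by exists (Num.sqrt Com * nr (S f)) => _ [n _ <-]; exact: omega_l1.
pose L := sup (range s).
have sL n : s n <= L by apply: ub_le_sup; [exact: sb.2|exists n].
have L0 : 0 <= L by have := sL 0; rewrite /s big_ord0.
have step n : s n <= M + q * L.
  rewrite /s (@le_trans _ _ (\sum_(k < n) (omega k / dist z k * nr (co h k)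
      + omega k ^+ 2 / dist z k * L)))//.
    apply: ler_sum => k _.
    rewrite (le_trans (ler_wpM2l (omega_ge0 k) (solves_coord_le k d0 zz sf sL)))//.
    by apply: le_of_eq; ring.
  rewrite big_split /=; apply: lerD; first exact: hM.
  rewrite -mulr_suml.
  by apply: ler_wpM2r => //; exact: zq.
have LM : L <= M + q * L.
  by apply: ge_sup => [|_ [n _ <-]]; [exact: sb.1|exact: step].
move=> n; apply: (le_trans (sL n)).
have := ler_wpM2r L0 q2; lra.
Qed.

Lemma solves_unique z q d h f f' : 0 < d -> q <= 2^-1 -> small z q d ->
  solves z h f -> solves z h f' -> f = f'.
Proof.
move=> d0 q2 zz [df e] [df' e'].
have s0 : solves z 0 (f - f').
  split; first exact: domB.
  move=> j; rewrite dotBl mulrBr e e' dot0l formBl//; ring.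
have [zq zd] := zz; have [dff eff] := s0.
have L0 n : \sum_(k < n) omega k * nr (co (f - f') k) <= 0.
  rewrite -[leRHS](mulr0 2); apply: (a_priori d0 q2 zz s0) => m.
  by rewrite big1// => k _; rewrite dot0l nr0 mulr0.
apply/eqP; rewrite -subr_eq0; apply/eqP; apply: psi_tot => j.
have := solves_coord_le j d0 zz s0 L0.
rewrite dot0l nr0 mul0r mulr0 addr0 => h0.
exact: nr_le0.
Qed.

Lemma small_sum_ge0 z q d : small z q d -> 0 <= q.
Proof. by move=> [/(_ 0%N)]; rewrite big_ord0. Qed.

Lemma mu_le_dist z q d j : 0 < d -> small z q d ->
  mu j <= (nr z / d + 1) * dist z j.
Proof.
move=> d0 [_ zd]; have muE : mu j = nr ((mu j)%:C : R[i]).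
  by rewrite nr_real ger0_norm// ltW.
rewrite {1}muE mulrDl mul1r (le_trans (nr_le_sub _ z))// nrB lerD2r.
rewrite mulrAC ler_pdivlMr// ler_wpM2l//.
Qed.

(** With u_j = |z - mu_j|^(-1/2) and f_j = u_j x_j the equation reads x = b + D x,
   where the matrix of D is dominated by (omega_j u_j) (omega_k u_k), whose norm is
   the sum of the omega_j^2 / |z - mu_j|. *)
Lemma solves_exists z q d h : 0 < d -> q <= 2^-1 -> small z q d ->
  exists f, solves z h f /\ nr f <= 2 / d * nr h.
Proof.
move=> d0 q2 zz; have q0 := small_sum_ge0 zz.
have rpos j : 0 < dist z j by exact: lt_le_trans (zz.2 j).
pose u j : R := (Num.sqrt (dist z j))^-1; pose w j : R[i] := (u j)^-1%:C / (z - (mu j)%:C).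
have upos j : 0 < u j by rewrite invr_gt0 sqrtr_gt0.
have uu j : u j ^+ 2 = (dist z j)^-1 by rewrite exprVn sqr_sqrtr// ltW.
have wu j : nr (w j) = u j.
  rewrite nrf_div nr_real ger0_norm ?invr_ge0 ?(ltW (upos j))//.
  by rewrite invrK -[X in _ / X](sqr_sqrtr (ltW (rpos j))) expr2 invfM mulVKf// gt_eqF// sqrtr_gt0.
have ud j : u j <= Num.sqrt d^-1.
  by rewrite -ler_sqr ?nnegrE ?sqrtr_ge0 ?(ltW (upos j))// uu sqr_sqrtr ?invr_ge0 ?(ltW d0)//
    lef_pV2 ?posrE//; exact: zz.2.
have kap0 : 0 <= nr z / d + 1 by rewrite addr_ge0// divr_ge0// ltW.
have UE x : exists f, dom S f /\ forall j, co f j = (u j)%:C * co x j.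
  have [|n|f [df fE _]] := @root_exists _ _ _ _ _ _ S_root (fun j => (u j)%:C * co x j)
      (Num.sqrt (nr z / d + 1) * nr x); first by rewrite mulr_ge0 ?sqrtr_ge0.
    rewrite exprMn sqr_sqrtr// (le_trans _ (ler_wpM2l kap0 (bessel dotE psi_on x n)))//.
    rewrite mulr_sumr ler_sum// => j _; rewrite nrM nr_real.
    rewrite exprMn real_normK ?num_real// uu mulrA ler_wpM2r ?sqr_ge0// ler_pdivrMr//.
    exact: mu_le_dist zz.
  by exists f.
pose U x := sval (cid (UE x)).
have UP x : dom S (U x) /\ forall j, co (U x) j = (u j)%:C * co x j := svalP (cid (UE x)).
have DE x : exists y, (forall j, co y j = - (w j * v (U x) (psi j))) /\
    nr y <= 2^-1 * nr x.
  have [dU Uc] := UP x.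
  have Ul n : \sum_(k < n) omega k * nr (co (U x) k) <= Num.sqrt q * nr x.
    under eq_bigr do rewrite Uc nrM nr_real ger0_norm ?(ltW (upos _))// mulrA.
    apply: (sum_cauchy_schwarz_le (a := fun k => omega k * u k)
      (b := fun k => nr (co x k))); rewrite ?sqrtr_ge0//.
      by rewrite sqr_sqrtr// (le_trans _ (zz.1 n))// ler_sum// => k _; rewrite exprMn uu.
    exact: bessel.
  apply: (coord_exists dotE psi_on psi_tot) => [|n]; first by rewrite mulr_ge0 ?invr_ge0.
  rewrite (@le_trans _ _ (q * (q * nr x ^+ 2)))//; last first.
    rewrite exprMn [2^-1 ^+ 2]expr2 -mulrA ler_pM ?mulr_ge0 ?sqr_ge0 ?ler_wpM2r ?sqr_ge0//.
  rewrite (le_trans _ (ler_wpM2r _ (zz.1 n))) ?(mulr_ge0 q0) ?sqr_ge0// mulr_suml ler_sum// => j _.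
  rewrite nrN nrM wu exprMn uu mulrAC mulrC ler_wpM2r ?invr_ge0//.
  have le := form_psi_le j dU Ul.
  rewrite -ler_sqr ?nnegrE ?mulr_ge0 ?sqrtr_ge0// in le.
  by rewrite (le_trans le)// !exprMn sqr_sqrtr.
pose D x := sval (cid (DE x)).
have DP x : (forall j, co (D x) j = - (w j * v (U x) (psi j))) /\ nr (D x) <= 2^-1 * nr x
  := svalP (cid (DE x)).
have lU : linear U.
  move=> a x y; apply: (coord_ext psi_tot) => j.
  by rewrite dotDl dotZl !(UP _).2 dotDl dotZl; ring.
have lD : linear D.
  move=> a x y; apply: (coord_ext psi_tot) => j.
  rewrite dotDl dotZl !(DP _).1 lU (v_sesqui.1 _ _ _ _ (UP x).1 (UP y).1 (dS j)); ring.
have [Winv [_ _ _ WK]] := neumann lD (fun x => (DP x).2).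
have [b [bE bn]] : exists b, (forall j, co b j = w j * co h j) /\
    nr b <= Num.sqrt d^-1 * nr h.
  by apply: (diagonal_map dotE psi_on psi_tot) => [|j]; rewrite ?sqrtr_ge0 ?wu.
pose x := Winv b; have xE : x + D x = b := WK b.
have [dU Uc] := UP x; exists (U x); split.
  split => // j; rewrite Uc.
  have -> : co x j = w j * co h j + w j * v (U x) (psi j).
    by rewrite -bE -xE dotDl (DP x).1 addrNK.
  have uw : (z - (mu j)%:C) * ((u j)%:C * w j) = 1.
    have zj := nr_neq0 (rpos j); have uj : (u j)%:C != 0 :> R[i].
      by rewrite -[0]/(0%:C) (inj_eq (@complexI R)) gt_eqF.
    by rewrite /w [X in X / _](fmorphV _ (u j)) mulVKf// divff//.
  by rewrite -mulrDr (mulrA (u j)%:C) mulrA uw mul1r.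
have xb : nr x <= 2 * nr b.
  have := nr_le_sub x b; rewrite -[X in nr (x - X)]xE opprD addrA subrr sub0r nrN.
  have := (DP x).2; lra.
have [j|g [gE gn]] := @diagonal_map _ _ _ dotE _ psi_on psi_tot (fun j => (u j)%:C) _ x
  (sqrtr_ge0 d^-1); first by rewrite nr_real ger0_norm// ltW.
rewrite (coord_ext psi_tot (f := U x) (g := g)); last by move=> j; rewrite Uc gE.
rewrite (le_trans gn)// (le_trans (ler_wpM2l (sqrtr_ge0 _) (le_trans xb (ler_wpM2l _ bn))))//.
rewrite [leLHS](_ : _ = Num.sqrt d^-1 ^+ 2 * (2 * nr h)); last by ring.
rewrite sqr_sqrtr ?invr_ge0 ?(ltW d0)//; apply: le_of_eq; ring.
Qed.

Lemma small_sum_resolvent z q d : 0 < d -> q <= 2^-1 -> small z q d ->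
  [/\ resolvent_set T z, linear (resolvent T z),
      forall h, solves z h (resolvent T z h) &
      forall h, nr (resolvent T z h) <= 2 / d * nr h].
Proof.
move=> d0 q2 zz.
pose B h := sval (cid (solves_exists h d0 q2 zz)).
have BP h : solves z h (B h) := (svalP (cid (solves_exists h d0 q2 zz))).1.
have lB : linear B.
  move=> a f g; apply: (solves_unique d0 q2 zz (BP _)).
  have [d1 e1] := BP f; have [d2 e2] := BP g.
  split; first exact: domP.
  move=> j; rewrite !dotDl !dotZl mulrDr mulrCA e1 e2 (v_sesqui.1 _ _ _ _ d1 d2 (dS j)); ring.
have Bd h : nr (B h) <= 2 / d * nr h := (svalP (cid (solves_exists h d0 q2 zz))).2.
have Br : is_resolvent T z B.
  split.
  - split => //; exists (2 / d) => f.
    by rewrite !nrE -real_complexM ler_complex.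
  - by move=> f; apply/solvesP.
  - move=> f df; apply: (solves_unique d0 q2 zz (BP _)).
    by apply/solvesP.
have RB h : resolvent T z h = B h := resolventE h Br.
split; first by exists B.
- by move=> a f g; rewrite !RB lB.
- by move=> h; rewrite RB.
- by move=> h; rewrite RB.
Qed.

(** In terms of matrices: (z - T)^-1 - (z - A)^-1 is dominated entrywise by the rank
   one matrix 2 (omega_j / |z - mu_j|) (omega_k / |z - mu_k|). Coordinates of f are
   (v(f, psi_j) + h_j) / (z - mu_j), and [a_priori] bounds the numerators. *)
Lemma resolvent_diff z q d h f j (M : R) : 0 < d -> q <= 2^-1 -> small z q d ->
  solves z h f ->
  (forall n, \sum_(k < n) omega k / dist z k * nr (co h k) <= M) ->
  nr (co f j - co h j / (z - (mu j)%:C)) <= omega j / dist z j * (2 * M).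
Proof.
move=> d0 q2 zz sf hM; have [df eq] := sf.
have zp : 0 < dist z j by exact: lt_le_trans (zz.2 j).
have zne := nr_neq0 zp.
have -> : co f j - co h j / (z - (mu j)%:C) = v f (psi j) / (z - (mu j)%:C).
  by apply: (mulIf zne); rewrite mulrBl !divfK// mulrC eq addrC addKr.
rewrite nrf_div mulrAC ler_wpM2r ?invr_ge0//.
exact: form_psi_le df (a_priori d0 q2 zz sf hM).
Qed.

Hypothesis mu_incr : forall n, mu n < mu n.+1.
Variables (N : nat) (eta : R).
Hypotheses (omega_eta : forall m n, (N <= m)%N ->
     \sum_(j < n) omega j ^+ 2 / spread mu m j <= eta) (eta4 : 2 * eta <= 2^-1).

Let good_res d z (d0 : 0 < d) (zg : good_set mu N d z) :=
  small_sum_resolvent d0 eta4 (good_small_sum mu_incr omega_eta zg).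

Lemma good_in_resolvent_set d z : 0 < d -> good_set mu N d z -> resolvent_set T z.
Proof. by move=> d0 zg; have [] := good_res d0 zg. Qed.

Lemma near_in_resolvent_set m z : (N <= m)%N -> near_eigenvalue mu m z -> resolvent_set T z.
Proof.
move=> Nm near; apply: (@good_in_resolvent_set (gap mu m / 2)).
  by rewrite divr_gt0// gap_gt0.
by exists m; split.
Qed.

Lemma resolvent_family (d : R) : 0 < d ->
  exists M, bounded_resolvent (good_set mu N d) (resolvent T) M.
Proof.
move=> d0; exists (2 / d); split.
- by rewrite divr_ge0// ltW.
- by move=> z zg; have [] := good_res d0 zg.
- move=> z w f zg wg; apply: resolvent_identity; exact: good_in_resolvent_set d0 _.
- by move=> z f zg; have [] := good_res d0 zg.
Qed.

Lemma resolvent_coord (d M : R) z f j : 0 < d -> good_set mu N d z ->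
  (forall n, \sum_(k < n) omega k / dist z k * nr (dot f (psi k)) <= M) ->
  nr (dot (resolvent T z f) (psi j) - dot f (psi j) / (z - (mu j)%:C))
    <= omega j / dist z j * (2 * M).
Proof.
move=> d0 zg hM; have [_ _ sol _] := good_res d0 zg.
exact: (resolvent_diff j d0 eta4 (good_small_sum mu_incr omega_eta zg) (sol f) hM).
Qed.

Lemma resolvent_diagonal (d : R) z f j : (forall f g, v f g = 0) -> 0 < d ->
  good_set mu N d z -> dot (resolvent T z f) (psi j) = dot f (psi j) / (z - (mu j)%:C).
Proof.
move=> v0 d0 zg; have [_ _ sol _] := good_res d0 zg.
have [_ /(_ j)] := sol f; rewrite v0 addr0 => <-.
have [_ /(_ j) dz] := good_small_sum mu_incr omega_eta zg.
by rewrite mulrC mulKf// nr_neq0// (lt_le_trans d0).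
Qed.

End PerturbedForm.

(** * The Riesz projections are disjoint projections *)

Section Relations.
Context {R : realType} {H : completeNormedModType R[i]}.
Variables (mu : nat -> R) (N : nat) (h : R).
Hypotheses (mu_pos : forall n, 0 < mu n) (mu_incr : forall n, mu n < mu n.+1).
Hypothesis (hE : h = edge mu N + 1).

Local Notation dist z j := (nr (z - (mu j)%:C)).

Lemma circle_good k s d : (N <= k)%N -> 0 <= s <= gap mu k / 2 -> d <= gap mu k / 2 ->
  on_contour (circle (mu k) (gap mu k - s)) `<=` good_set mu N d.
Proof.
move=> Nk /andP[s0 sk] dk z.
have gk := gap_gt0 mu_incr k.
have rs : 0 <= gap mu k - s by lra.
move=> /(on_circle rs) zr; exists k; split => //.
by apply: annulus_near => //; rewrite zr; apply/andP; split; lra.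
Qed.

Lemma rectangle_good s d : 0 <= s <= 1 -> s <= gap mu N / 2 -> d <= gap mu N / 2 ->
  on_contour (rectangle (- h + s) (edge mu N - s) (- h + s) (h - s)) `<=` good_set mu N d.
Proof.
move=> /andP[s0 s1] sN dN z.
have gN := gap_gt0 mu_incr N; have eN := edge_gt0 mu_pos mu_incr N.
have mN := mu_pos N.
have x12 : - h + s <= edge mu N - s by rewrite hE /edge; lra.
have y12 : - h + s <= h - s by rewrite hE; lra.
move=> /(on_rectangle x12 y12)[/andP[z1 z2] /andP[z3 z4] side].
exists N; split => //.
have eh : edge mu N <= h - s by rewrite hE; lra.
have zN : complex.Re z <= edge mu N by lra.
case/or4P: side => /eqP side.
- by apply: (outer_near mu_pos mu_incr eh zN); left; rewrite side; lra.
- apply: right_side_near => //; rewrite side; apply/andP; split; lra.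
- apply: (outer_near mu_pos mu_incr eh zN); right; rewrite side.
  by rewrite -normrN opprD opprK ler_norm.
- by apply: (outer_near mu_pos mu_incr eh zN); right; rewrite side ler_norm.
Qed.

Variables (F : R[i] -> H -> H).
Hypothesis F_res : forall d : R, 0 < d -> exists M, bounded_resolvent (good_set mu N d) F M.

Local Notation rect := (rectangle (- h) (edge mu N) (- h) h).
Local Notation circ k := (circle (mu k) (gap mu k)).

Let K k : R := 4 * pi * gap mu k.
Let K0 : R := (edge mu N + h) + (h + h).

Lemma lipschitz_contour_le (k k' : R) c : k <= k' -> lipschitz_contour k c ->
  lipschitz_contour k' c.
Proof.
move=> kk hc g /hc hg x y x1 y1; rewrite (le_trans (hg _ _ x1 y1))//.
by rewrite ler_wpM2r.
Qed.

Lemma K_ge0 k : 0 <= K k.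
Proof. by rewrite /K !mulr_ge0 ?pi_ge0// ltW// gap_gt0. Qed.

Lemma h_gt1 : 1 <= h.
Proof. by rewrite hE lerDr ltW// edge_gt0. Qed.

Lemma K0_ge0 : 0 <= K0.
Proof. have := h_gt1; have := edge_gt0 mu_pos mu_incr N; rewrite /K0; lra. Qed.

Lemma circle_lip k s : 0 <= s <= gap mu k / 2 ->
  lipschitz_contour (K k) (circle (mu k) (gap mu k - s)).
Proof.
move=> /andP[s0 sk]; have gk := gap_gt0 mu_incr k.
apply: (lipschitz_contour_le _ (@circle_lipschitz R _ (gap mu k - s) _)); last by lra.
by rewrite /K ler_wpM2l ?mulr_ge0 ?pi_ge0// gerBl.
Qed.

Lemma rectangle_lip s : 0 <= s <= 1 -> s <= gap mu N / 2 ->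
  lipschitz_contour K0 (rectangle (- h + s) (edge mu N - s) (- h + s) (h - s)).
Proof.
move=> /andP[s0 s1] sN; have mN := mu_pos N; have gN := gap_gt0 mu_incr N.
have x12 : - h + s <= edge mu N - s by rewrite hE /edge; lra.
have y12 : - h + s <= h - s by rewrite hE; move: (edge_gt0 mu_pos mu_incr N); lra.
apply: (lipschitz_contour_le _ (rectangle_lipschitz x12 y12)).
rewrite /K0; lra.
Qed.

Lemma circE k : circle (mu k) (gap mu k - 0) = circ k.
Proof. by rewrite subr0. Qed.
Lemma rectE : rectangle (- h + 0) (edge mu N - 0) (- h + 0) (h - 0) = rect.
Proof. by rewrite addr0 !subr0. Qed.

Lemma half_gap k : 0 <= (0 : R) <= gap mu k / 2.
Proof. by rewrite lexx divr_ge0// ltW// gap_gt0. Qed.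

Lemma zero01 : 0 <= (0 : R) <= 1.
Proof. by rewrite lexx ler01. Qed.

Lemma circ_good k d : (N <= k)%N -> d <= gap mu k / 2 -> on_contour (circ k) `<=` good_set mu N d.
Proof. by rewrite -circE => Nk dk; apply: circle_good => //; exact: half_gap. Qed.

Lemma rect_good d : d <= gap mu N / 2 -> on_contour rect `<=` good_set mu N d.
Proof.
rewrite -rectE => dN; apply: rectangle_good => //; first exact: zero01.
by have /andP[] := half_gap N.
Qed.

Lemma circ_lip k : lipschitz_contour (K k) (circ k).
Proof. by rewrite -circE; apply/circle_lip/half_gap. Qed.

Lemma rect_lip : lipschitz_contour K0 rect.
Proof.
rewrite -rectE; apply: rectangle_lip; first exact: zero01.
by have /andP[] := half_gap N.
Qed.

Lemma circ_integral k : (N <= k)%N ->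
  exists B, contour_integral (circ k) F B /\ contour_limit (circ k) F B.
Proof.
move=> Nk; have gk : 0 < gap mu k / 2 by rewrite divr_gt0// gap_gt0.
have [M FM] := F_res gk.
exact: (resolvent_integral_exists (K_ge0 k) FM (@circ_lip k) (circ_good Nk (lexx _))).
Qed.

Lemma rect_integral : exists B, contour_integral rect F B /\ contour_limit rect F B.
Proof.
have gk : 0 < gap mu N / 2 by rewrite divr_gt0// gap_gt0.
have [M FM] := F_res gk.
exact: (resolvent_integral_exists K0_ge0 FM rect_lip (rect_good (lexx _))).
Qed.

Lemma good_depth j k : exists d, [/\ 0 < d, d <= gap mu j / 2 & d <= gap mu k / 2].
Proof.
exists (Num.min (gap mu j / 2) (gap mu k / 2)).
by rewrite lt_min !divr_gt0 ?gap_gt0// !ge_min !lexx orbT.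
Qed.

(** The circle is shrunk: the smaller circles avoid c, which winds around none or
   all of them, while they do not wind around any point of c. *)
Lemma circ_product k c d (K1 : R) (I I' : H -> H) (a : R[i]) f : (N < k)%N ->
  0 < d -> d <= gap mu k / 2 -> 0 <= K1 ->
  lipschitz_contour K1 c -> on_contour c `<=` good_set mu N d ->
  contour_limit (circ k) F I -> contour_limit c F I' ->
  (forall w, on_contour c w -> gap mu k <= dist w k) ->
  (forall s e : R, 0 < s <= gap mu k / 2 -> 0 < e -> exists n : nat, forall m,
     (n <= m)%N -> forall z, dist z k = gap mu k - s -> nr (cauchy_sum c m z - a) <= e) ->
  I (I' f) = a *: I f.
Proof.
move=> Nk d0 dk K10 cK cE Il Il' off wind.
have gk := gap_gt0 mu_incr k; have g2 : 0 < gap mu k / 2 by rewrite divr_gt0.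
have [M FM] := F_res d0.
have Kk : K k <= K k + K1 by rewrite lerDl.
have K1' : K1 <= K k + K1 by rewrite lerDr K_ge0.
apply: (@resolvent_product_limit _ _ _ _ _ (K k + K1) (4 * pi + 2) (gap mu k / 2) (circ k)
  c (fun s => circle (mu k) (gap mu k - s)) I I' a (le_trans K10 K1') g2 FM) => //.
- exact: lipschitz_contour_le Kk (@circ_lip k).
- exact: lipschitz_contour_le K1' cK.
- exact: (circ_good (ltnW Nk) dk).
move=> s s0k; have /andP[s0 s1] := s0k.
have s01 : 0 <= s <= gap mu k / 2 by rewrite (ltW s0).
have rs : 0 <= gap mu k - s by lra.
split.
- exact: lipschitz_contour_le Kk (circle_lip s01).
- exact: (circle_good (ltnW Nk) s01 dk).
- by apply: near_circle; exact: ltW.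
- move=> z w /(on_circle rs) zr /off wr; apply/eqP => e; move: wr; rewrite e zr; lra.
- move=> e e0; have [n1 h1] := wind s e s0k e0.
  have [n2 h2] := circle_exterior (mu k) rs s0 e0.
  exists (maxn n1 n2) => m; rewrite geq_max => /andP[/h1 m1 /h2 m2].
  split => [z /(on_circle rs)/m1//|w /off wr].
  by apply: m2; rewrite subrK.
Qed.

(** The same with the rectangle shrunk from all sides. *)
Lemma rect_product c d (K1 : R) (I I' : H -> H) (a : R[i]) f :
  0 < d -> d <= gap mu N / 2 -> 0 <= K1 ->
  lipschitz_contour K1 c -> on_contour c `<=` good_set mu N d ->
  contour_limit rect F I -> contour_limit c F I' ->
  (forall w, on_contour c w -> [\/ edge mu N <= complex.Re w,
     complex.Re w <= - h, h <= complex.Im w | complex.Im w <= - h]) ->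
  (forall s e : R, 0 < s -> 0 < e -> exists n : nat, forall m,
     (n <= m)%N -> forall z, - h + s <= complex.Re z <= edge mu N - s ->
     - h + s <= complex.Im z <= h - s -> nr (cauchy_sum c m z - a) <= e) ->
  I (I' f) = a *: I f.
Proof.
move=> d0 dN K10 cK cE Il Il' off wind.
have [M FM] := F_res d0; have mN := mu_pos N; have gN := gap_gt0 mu_incr N.
have K0' : K0 <= K0 + K1 by rewrite lerDl.
have K1' : K1 <= K0 + K1 by rewrite lerDr K0_ge0.
pose s0 := Num.min 1 (gap mu N / 2).
have s00 : 0 < s0 by rewrite lt_min ltr01 divr_gt0.
apply: (@resolvent_product_limit _ _ _ _ _ (K0 + K1) 4 s0 rect c
  (fun s => rectangle (- h + s) (edge mu N - s) (- h + s) (h - s)) I I' a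
  (le_trans K10 K1') s00 FM) => //.
- exact: lipschitz_contour_le K0' rect_lip.
- exact: lipschitz_contour_le K1' cK.
- exact: (rect_good dN).
move=> s /andP[sp]; rewrite le_min => /andP[s1 s2].
have s01 : 0 <= s <= 1 by rewrite (ltW sp).
have sx : - h + s < edge mu N - s by rewrite hE /edge; lra.
have sy : - h + s < h - s by rewrite hE /edge; lra.
split.
- exact: lipschitz_contour_le K0' (rectangle_lip s01 s2).
- exact: (rectangle_good s01 s2 dN).
- by apply: near_rectangle; exact: ltW.
- move=> z w /(on_rectangle (ltW sx) (ltW sy))[/andP[z1 z2] /andP[z3 z4] _] /off ws.
  by apply/eqP => e; move: ws; rewrite e; case; lra.
- move=> e e0; have [n1 h1] := wind s e sp e0.
  have [n2 h2] := rect_exterior sx sy sp e0.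
  exists (maxn n1 n2) => m; rewrite geq_max => /andP[/h1 m1 /h2 m2].
  split => [z /(on_rectangle (ltW sx) (ltW sy))[zx zy _]|w /off]; first exact: m1.
  by move=> ws; apply: m2; rewrite !subrK !addrK.
Qed.

Lemma edge_left : - h < edge mu N.
Proof. have := h_gt1; have := edge_gt0 mu_pos mu_incr N; lra. Qed.

Lemma h_sym : - h < h.
Proof. have := h_gt1; lra. Qed.

Lemma dist_left z k : mu k - complex.Re z <= dist z k.
Proof.
by have := nr_dist_Re mu z k; rewrite ler_norml => /andP[z1 _]; lra.
Qed.

Section Products.
Variables (j k : nat) (Nj : (N < j)%N) (Nk : (N < k)%N).
Variables (I0 Ij Ik : H -> H).
Hypotheses (I0l : contour_limit rect F I0) (Ijl : contour_limit (circ j) F Ij)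
  (Ikl : contour_limit (circ k) F Ik).

Let gk := gap_gt0 mu_incr k.

Lemma circ_circ_same f : Ik (Ik f) = two_pi_i *: Ik f.
Proof.
have [d [d0 dk _]] := good_depth k k.
apply: (circ_product f Nk d0 dk (K_ge0 k) (@circ_lip k) (circ_good (ltnW Nk) dk) Ikl Ikl).
  by move=> w /(on_circle (ltW gk)) ->.
move=> s e /andP[s0 _] e0; have [n hn] := circle_interior (mu k) gk s0 e0.
by exists n => m /hn hm z zs; apply: hm; rewrite zs.
Qed.

Lemma mu_dist_gaps : j != k -> gap mu j + gap mu k <= `|mu j - mu k|.
Proof.
move=> jk; have := mu_dist_gap mu_incr jk.
have := mu_dist_gap mu_incr (_ : k != j); rewrite eq_sym => /(_ jk).
rewrite distrC; lra.
Qed.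

Lemma dist_between z : `|mu j - mu k| <= dist z j + dist z k.
Proof. by rewrite -nr_real rmorphB /= (nrB z) nr_triangle. Qed.

Lemma circ_circ_disjoint f : j != k -> Ij (Ik f) = 0.
Proof.
move=> /mu_dist_gaps jk; rewrite -(scale0r (Ij f)).
have [d [d0 dj dk]] := good_depth j k.
apply: (circ_product f Nj d0 dj (K_ge0 k) (@circ_lip k) (circ_good (ltnW Nk) dk) Ijl Ikl).
  by move=> w /(on_circle (ltW gk)) wr; have := dist_between w; lra.
move=> s e /andP[s0 _] e0; have [n hn] := circle_exterior (mu k) (ltW gk) s0 e0.
exists n => m /hn hm z zs; rewrite subr0; apply: hm.
have := dist_between z; lra.
Qed.

Lemma circ_rect f : Ik (I0 f) = 0.
Proof.
rewrite -(scale0r (Ik f)); have [d [d0 dk dN]] := good_depth k N.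
have ek := edge_mu mu_incr Nk.
apply: (circ_product f Nk d0 dk K0_ge0 rect_lip (rect_good dN) Ikl I0l).
  move=> w /(on_rectangle (ltW edge_left) (ltW h_sym))[/andP[_ w2] _ _].
  have := dist_left w k; lra.
move=> s e /andP[s0 _] e0; have [n hn] := rect_exterior edge_left h_sym s0 e0.
exists n => m /hn hm z zs; rewrite subr0; apply: hm; apply: Or41.
have := dist_left z k; lra.
Qed.

Lemma rect_circ f : I0 (Ik f) = 0.
Proof.
rewrite -(scale0r (I0 f)); have [d [d0 dk dN]] := good_depth k N.
have ek := edge_mu mu_incr Nk.
apply: (rect_product f d0 dN (K_ge0 k) (@circ_lip k) (circ_good (ltnW Nk) dk) I0l Ikl).
  move=> w /(on_circle (ltW gk)) wr; apply: Or41; have := dist_left w k; lra.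
move=> s e s0 e0; have [n hn] := circle_exterior (mu k) (ltW gk) s0 e0.
exists n => m /hn hm z /andP[_ z2] _; rewrite subr0; apply: hm.
have := dist_left z k; lra.
Qed.

Lemma rect_rect f : I0 (I0 f) = two_pi_i *: I0 f.
Proof.
have [d [d0 dN _]] := good_depth N N.
apply: (rect_product f d0 dN K0_ge0 rect_lip (rect_good dN) I0l I0l).
  move=> w /(on_rectangle (ltW edge_left) (ltW h_sym))[_ _ /or4P[]/eqP->].
  - by apply: Or42.
  - by apply: Or41.
  - by apply: Or44.
  - by apply: Or43.
move=> s e s0 e0; have [n hn] := rect_interior edge_left h_sym s0 e0.
by exists n => m /hn.
Qed.

End Products.
End Relations.

(** * The Riesz projections of T are close to those of A *)

Section LimitLinear.
Context {R : realType} {H : completeNormedModType R[i]}.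
Implicit Types (c : seq (R -> R[i])) (F : R[i] -> H -> H).

Lemma contour_limit_bounded E F M K c B : 0 <= K -> bounded_resolvent E F M ->
  lipschitz_contour K c -> on_contour c `<=` E -> contour_limit c F B ->
  bounded_operator B.
Proof.
move=> K0 FM cK cE [C BC]; have [M0 Flin _ Fle] := FM.
split.
  move=> a f g; apply: nr_small_eq => e e0.
  have [n hn] := archi_inv (C * (nr (a *: f + g) + nr a * nr f + nr g)) e0.
  apply: le_trans (hn n (leqnn n)).
  have lin : contour_sum c (F^~ (a *: f + g)) n =
      a *: contour_sum c (F^~ f) n + contour_sum c (F^~ g) n.
    rewrite -contour_sumZ -contour_sumD; apply: eq_contour_sum => z /cE Ez.
    by rewrite (linear_funD _ _ (Flin _ Ez)) (linear_funZ _ _ (Flin _ Ez)).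
  have -> : B (a *: f + g) - (a *: B f + B g) =
    - (contour_sum c (F^~ (a *: f + g)) n - B (a *: f + g)) +
    (a *: (contour_sum c (F^~ f) n - B f) + (contour_sum c (F^~ g) n - B g)).
    rewrite lin scalerBr opprB [X in _ = _ + X]addrACA.
    by rewrite -[in X in _ = _ + X]opprD subrKA.
  have t1 := BC n (a *: f + g); have t2 := BC n f; have t3 := BC n g.
  rewrite (le_trans (nrD _ _))// nrN.
  have t4 := nrD (a *: (contour_sum c (F^~ f) n - B f)) (contour_sum c (F^~ g) n - B g).
  rewrite nrZ in t4; have t5 := ler_wpM2l (nr_ge0 a) t2.
  rewrite (le_trans (lerD t1 (le_trans t4 (lerD t5 t3))))//.
  by apply: le_of_eq; ring.
exists (K * (size c)%:R * M + C) => f; rewrite !nrE -real_complexM ler_complex.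
rewrite (le_trans (nr_le_sub _ (contour_sum c (F^~ f) 0%N)))// nrB mulrDl lerD//.
  rewrite -(mulrA _ M); apply: contour_sum_le => // z /cE; exact: Fle.
by have := BC 0%N f; rewrite divr1.
Qed.

End LimitLinear.

Section Estimates.
Context {R : realType} {H : completeNormedModType R[i]}.
Variables (dot : {dot H for Num.conj}) (dotE : hilbert_dot dot).
Variables (psi : nat -> H) (psi_on : forall i j, dot (psi i) (psi j) = (i == j)%:R)
  (psi_tot : forall f, (forall j, dot f (psi j) = 0) -> f = 0).
Variables (mu : nat -> R) (N : nat) (h : R).
Hypotheses (mu_pos : forall n, 0 < mu n) (mu_incr : forall n, mu n < mu n.+1).
Local Notation dist z j := (nr (z - (mu j)%:C)).
Hypothesis (hE : h = edge mu N + 1).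
Variables (omega : nat -> R) (eta : R).
Hypotheses (omega_ge0 : forall j, 0 <= omega j)
  (omega_eta : forall m n, (N <= m)%N ->
     \sum_(j < n) omega j ^+ 2 / spread mu m j <= eta).
Variables (F G : R[i] -> H -> H).
Hypotheses
  (F_res : forall d : R, 0 < d -> exists M, bounded_resolvent (good_set mu N d) F M)
  (G_coord : forall (d : R) z f j, 0 < d -> good_set mu N d z ->
     dot (G z f) (psi j) = dot f (psi j) / (z - (mu j)%:C))
  (F_coord : forall (d M : R) z f j, 0 < d -> good_set mu N d z ->
     (forall n, \sum_(k < n) omega k / dist z k * nr (dot f (psi k)) <= M) ->
     nr (dot (F z f) (psi j) - dot f (psi j) / (z - (mu j)%:C))
       <= omega j / dist z j * (2 * M)).

Local Notation co f j := (dot f (psi j)).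
Local Notation rect := (rectangle (- h) (edge mu N) (- h) h).
Local Notation circ k := (circle (mu k) (gap mu k)).

(** On psi_j the resolvent of A is the scalar 1 / (z - mu_j), so that its integral is
   a winding number. *)
Lemma diagonal_integral c d I f j (a : R[i]) : 0 < d -> on_contour c `<=` good_set mu N d ->
  contour_limit c G I ->
  (forall e : R, 0 < e -> exists n : nat, forall m, (n <= m)%N ->
     nr (cauchy_sum c m (mu j)%:C - a) <= e) ->
  co (I f) j = a * co f j.
Proof.
move=> d0 cE [C IC] wind; apply: nr_small_eq => e e0.
pose Q := nr (co f j) + 1.
have Q0 : 0 < Q by rewrite ltr_wpDl// nr_ge0.
have e2 : 0 < e / 2 by rewrite divr_gt0.
have [n1 h1] := wind _ (divr_gt0 e2 Q0).
have [n2 h2] := archi_inv (C * nr f) e2.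
pose m := maxn n1 n2.
have {}h1 := h1 m (leq_maxl _ _); have {}h2 := h2 m (leq_maxr _ _).
have sE : co (contour_sum c (G^~ f) m) j = cauchy_sum c m (mu j)%:C * co f j.
  rewrite /contour_sum dot_suml mulr_suml; apply: eq_big_seq => g gc.
  rewrite dot_suml mulr_suml; apply: eq_bigr => i _.
  rewrite dotZl (G_coord _ _ d0 (cE _ (on_node gc (ltnW (ltn_ord i))))).
  by rewrite mulrA mulrAC.
have -> : co (I f) j - a * co f j = - co (contour_sum c (G^~ f) m - I f) j +
    (cauchy_sum c m (mu j)%:C - a) * co f j.
  by rewrite dotBl sE; ring.
rewrite (le_trans (nrD _ _))// nrN nrM [leRHS]splitr lerD//.
  by rewrite (le_trans (coord_nr dotE psi_on _ _))// (le_trans (IC _ _))// mulrAC.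
rewrite (le_trans (ler_wpM2r (nr_ge0 _) h1))// mulrAC ler_pdivrMr//.
by rewrite ler_wpM2l ?(ltW e2)// /Q lerDl.
Qed.

(** A dense set of f, for which the sums over the coordinates in the estimates of
   integrals are finite and can be exchanged with the integrals. *)
Definition vanishes_from (p : nat) f : Prop := forall k, (p <= k)%N -> co f k = 0.

Lemma finite_support_sum (w : nat -> R) p f n : (forall k, 0 <= w k) ->
  vanishes_from p f ->
  \sum_(k < n) w k * nr (co f k) <= \sum_(k < p) w k * nr (co f k).
Proof.
move=> w0 fp.
have z k : (p <= k)%N -> w k * nr (co f k) = 0 by move=> /fp->; rewrite nr0 mulr0.
rewrite -!(big_mkord xpredT (fun k => w k * nr (co f k))).
have [np|pn] := leqP n p.
  rewrite [leRHS](big_cat_nat (leq0n n) np)//= lerDl; apply: sumr_ge0 => k _.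
  by rewrite mulr_ge0.
rewrite (big_cat_nat (leq0n p) (ltnW pn))//= gerDl big_nat_cond big1// => k /andP[/andP[pk _] _].
exact: z.
Qed.

(** The entrywise bound of the difference of the resolvents, integrated along c. *)
Lemma integral_diff c d I I' f j p (B : R) : 0 < d -> on_contour c `<=` good_set mu N d ->
  contour_limit c F I -> contour_limit c G I' -> vanishes_from p f ->
  (exists n : nat, forall m, (n <= m)%N ->
     \sum_(g <- c) \sum_(i < m.+1) nr (step g m i) *
      (omega j / dist (g (node m i)) j *
       (2 * \sum_(k < p) omega k / dist (g (node m i)) k * nr (co f k))) <= B) ->
  nr (co (I f) j - co (I' f) j) <= B.
Proof.
move=> d0 cE [C IC] [C' IC'] fp [n hB].
apply: nr_le_lim => e e0.
have [n2 h2] := archi_inv (C * nr f + C' * nr f) e0.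
pose m := maxn n n2.
have {}hB := hB m (leq_maxl _ _); have {}h2 := h2 m (leq_maxr _ _).
exists (co (contour_sum c (F^~ f) m) j - co (contour_sum c (G^~ f) m) j).
  have -> : co (I f) j - co (I' f) j - (co (contour_sum c (F^~ f) m) j -
      co (contour_sum c (G^~ f) m) j) =
      - co (contour_sum c (F^~ f) m - I f) j + co (contour_sum c (G^~ f) m - I' f) j.
    by rewrite !dotBl; ring.
  rewrite (le_trans (nrD _ _))// nrN (le_trans (lerD (coord_nr dotE psi_on _ _) (coord_nr dotE psi_on _ _)))//.
  rewrite (le_trans (lerD (IC _ _) (IC' _ _)))//.
  by apply: le_trans h2; apply: le_of_eq; ring.
apply: le_trans hB.
rewrite /contour_sum !dot_suml -sumrB (le_trans (nr_sum _ _ _))//.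
rewrite big_seq [leRHS]big_seq; apply: ler_sum => g gc.
rewrite !dot_suml -sumrB (le_trans (nr_sum _ _ _))//.
apply: ler_sum => i _; rewrite !dotZl -mulrBr nrM ler_wpM2l//.
have zE := cE _ (on_node gc (ltnW (ltn_ord i))).
rewrite (G_coord _ _ d0 zE); apply: (F_coord j d0 zE) => q.
apply: (finite_support_sum (w := fun k => omega k / dist (g (node m i)) k)) => // k.
by rewrite divr_ge0.
Qed.

(** ** Discs *)

(** On the circle |z - mu_k| is the gap, which cancels against the length, and
   |z - mu_i| is at least half the spread. The constant is 4 pi (the Lipschitz
   constant of the parametrisation divided by the radius), times the 2 of the
   resolvent bound, times the 2 lost with the spread. *)
Lemma circle_diff k I I' f p : (N < k)%N -> contour_limit (circ k) F I ->
  contour_limit (circ k) G I' -> vanishes_from p f ->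
  nr (co (I f) k - co (I' f) k) <=
  16 * pi * omega k * \sum_(i < p) omega i / spread mu k i * nr (co f i).
Proof.
move=> Nk Il Il' fp; have gk := gap_gt0 mu_incr k.
have g2 : 0 < gap mu k / 2 by rewrite divr_gt0.
have cE := circ_good mu_incr (ltnW Nk) (lexx (gap mu k / 2)).
apply: (integral_diff g2 cE Il Il' fp); exists 0%N => m _.
have [g gE] : exists g, circ k = [:: g] by eexists.
have gc : g \in circ k by rewrite gE mem_head.
rewrite gE big_seq1.
set s := \sum_(i < p) _.
have s0 : 0 <= s.
  by apply: sumr_ge0 => i _; rewrite mulr_ge0// divr_ge0// ltW// spread_gt0.
rewrite (@le_trans _ _ (\sum_(i < m.+1) (4 * pi * gap mu k) / m.+1%:R *
   (omega k / gap mu k * (2 * (2 * s)))))//; last first.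
  rewrite sumr_const card_ord -[leLHS]mulr_natr; apply: le_of_eq.
  have cancel (y w x q : R) : y != 0 -> q != 0 ->
      4 * pi * y / q * (w / y * (2 * (2 * x))) * q = 16 * pi * w * x.
    by move=> y0 q0; field; rewrite ?y0 ?q0.
  by rewrite cancel ?pnatr_eq0// gt_eqF.
apply: ler_sum => i _.
have zc : on_contour (circ k) (g (node m i)) by apply: on_node => //; rewrite ltnW.
have zr := on_circle (ltW gk) zc.
rewrite ler_pM ?mulr_ge0 ?divr_ge0//.
- by rewrite invr_ge0 nr_ge0.
- by apply: sumr_ge0 => q _; rewrite mulr_ge0 ?divr_ge0.
- exact: (step_le (circ_lip mu_incr gc) (ltn_ord i)).
rewrite zr ler_wpM2l ?divr_ge0 ?(ltW gk)// ler_wpM2l// mulr_sumr ler_sum// => q _.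
rewrite mulrA ler_wpM2r// mulrCA ler_wpM2l//.
have near : near_eigenvalue mu k (g (node m i)).
  by apply: annulus_near => //; rewrite zr lexx andbT ler_pdivrMr// ler_peMr ?ler1n// ltW.
have sp := spread_gt0 mu_incr k q.
rewrite -invf_div lef_pV2 ?posrE ?divr_gt0//.
by rewrite (lt_le_trans _ (near q))// divr_gt0.
Qed.

(** The gap condition bounds row sums. The spread is symmetric, so that columns with
   i >= N are rows; for i < N the entries are smaller than in column N. *)
Lemma column_sum i n : 
  \sum_(k < n | (N < k)%N) omega k ^+ 2 / spread mu k i <= eta.
Proof.
have [Ni|iN] := leqP N i.
  rewrite (le_trans _ (omega_eta n Ni))// big_mkcond ler_sum// => k _.
  have t : 0 <= omega k ^+ 2 / spread mu i k.
    by rewrite divr_ge0 ?sqr_ge0// ltW// spread_gt0.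
  case: ifP => // Nk; have [->//|ki] := eqVneq (val k) i.
  by rewrite (spread_sym mu ki).
rewrite (le_trans _ (omega_eta n (leqnn N)))// big_mkcond ler_sum// => k _.
have t : 0 <= omega k ^+ 2 / spread mu N k.
  by rewrite divr_ge0 ?sqr_ge0// ltW// spread_gt0.
case: ifP => // Nk; rewrite ler_wpM2l ?sqr_ge0// lef_pV2 ?posrE ?spread_gt0//.
rewrite /spread (gtn_eqF Nk) (ltn_eqF (ltn_trans iN Nk)) distrC.
rewrite !ger0_norm ?subr_ge0 ?(mu_le mu_incr)// ?(ltnW Nk) ?(ltnW (ltn_trans iN Nk))//.
by rewrite lerD2l lerN2 (mu_le mu_incr)// ltnW.
Qed.

Lemma eta_ge0 : 0 <= eta.
Proof. by have := omega_eta 0 (leqnn N); rewrite big_ord0. Qed.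

(** Schur's test: the sums of omega_i^2 / spread k i over i and those of
   omega_k^2 / spread k i over k are at most eta. *)
Lemma schur_test p n f : 
  \sum_(k < n | (N < k)%N) (omega k * \sum_(i < p) omega i / spread mu k i * nr (co f i)) ^+ 2
   <= eta ^+ 2 * nr f ^+ 2.
Proof.
apply: (@le_trans _ _ (\sum_(k < n | (N < k)%N) omega k ^+ 2 * (eta *
   \sum_(i < p) nr (co f i) ^+ 2 / spread mu k i))).
  apply: ler_sum => k Nk; rewrite exprMn ler_wpM2l ?sqr_ge0//.
  have sp i := spread_gt0 mu_incr k i.
  rewrite (eq_bigr (fun i : 'I_p => omega i / Num.sqrt (spread mu k i) *
     (nr (co f i) / Num.sqrt (spread mu k i)))); last first.
    move=> i _; rewrite mulrACA mulrAC; congr (_ * _).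
    by rewrite -invfM -expr2 sqr_sqrtr// ltW.
  rewrite (le_trans (sum_cauchy_schwarz (fun i => omega i / Num.sqrt (spread mu k i))
     (fun i => nr (co f i) / Num.sqrt (spread mu k i)) p))//.
  under eq_bigr do rewrite expr_div_n sqr_sqrtr ?(ltW (sp _))//.
  under [X in _ * X <= _]eq_bigr do rewrite expr_div_n sqr_sqrtr ?(ltW (sp _))//.
  rewrite ler_wpM2r ?omega_eta ?(ltnW Nk)//.
  by apply: sumr_ge0 => i _; rewrite divr_ge0 ?sqr_ge0// ltW.
rewrite (eq_bigr (fun k : 'I_n => eta * \sum_(i < p) nr (co f i) ^+ 2 *
   (omega k ^+ 2 / spread mu k i))); last first.
  move=> k _; rewrite mulrCA; congr (_ * _); rewrite mulr_sumr; apply: eq_bigr => i _.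
  ring.
rewrite -mulr_sumr expr2 -mulrA ler_wpM2l ?eta_ge0// exchange_big /=.
rewrite (@le_trans _ _ (\sum_(i < p) nr (co f i) ^+ 2 * eta))//.
  by apply: ler_sum => i _; rewrite -mulr_sumr ler_wpM2l ?sqr_ge0// column_sum.
by rewrite -mulr_suml mulrC ler_wpM2l ?eta_ge0//; exact: bessel.
Qed.

(** ** The rectangle *)

(** Between b and b + 1 the square of x is such that 1 + x^2 <= 3 (1 + b^2). *)
Lemma atan_step (b t : R) : 0 <= t <= 1 -> t / (1 + b ^+ 2) <= 3 * (atan (b + t) - atan b).
Proof.
move=> /andP[t0 t1].
have bt : b <= b + t by rewrite lerDl.
have [x /andP[x1 x2] ->] := mvt (@is_derive1_atan R) bt.
have pb : 0 < 1 + b ^+ 2 by rewrite ltr_wpDr ?sqr_ge0.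
have px : 0 < 1 + x ^+ 2 by rewrite ltr_wpDr ?sqr_ge0.
have -> : b + t - b = t by ring.
rewrite mulrA [leRHS]mulrC ler_wpM2l// -[3]invrK -invfM lef_pV2 ?posrE ?mulr_gt0//.
rewrite ler_pdivrMl//.
have := sqr_ge0 (x - 2 * b); have := sqr_ge0 (x - b); nra.
Qed.

(** The integral of dy / (a^2 + y^2) is at most pi / a; the factor 3 of [atan_step]
   accounts for the Riemann sum, and 3 pi <= 12. *)
Lemma right_side_sum (a l : R) m : 0 < a -> 0 < l -> 2 * l / m.+1%:R <= a ->
  \sum_(i < m.+1) 2 * l / m.+1%:R / (a ^+ 2 + (- l + node m i * (2 * l)) ^+ 2) <= 12 / a.
Proof.
move=> a0 l0 la; pose y i : R := - l + node m i * (2 * l).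
pose t := 2 * l / m.+1%:R / a.
have t0 : 0 <= t by rewrite !divr_ge0 ?mulr_ge0 ?(ltW l0) ?(ltW a0).
have t1 : t <= 1 by rewrite ler_pdivrMr// mul1r.
have ys i : y i.+1 / a = y i / a + t.
  have -> : y i.+1 = y i + 2 * l / m.+1%:R.
    have -> : y i.+1 = y i + (node m i.+1 - node m i) * (2 * l) by rewrite /y; ring.
    by rewrite node_step [_^-1 * _]mulrC.
  by rewrite mulrDl.
apply: (@le_trans _ _ (\sum_(i < m.+1) 3 / a * (atan (y i.+1 / a) - atan (y i / a)))).
  apply: ler_sum => i _; rewrite ys -/(y i).
  have -> : 2 * l / m.+1%:R / (a ^+ 2 + y i ^+ 2) = a^-1 * (t / (1 + (y i / a) ^+ 2)).
    have d1 : a ^+ 2 + y i ^+ 2 != 0 by rewrite gt_eqF// ltr_wpDr ?sqr_ge0// exprn_gt0.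
    have d2 : 1 + (y i / a) ^+ 2 = (a ^+ 2 + y i ^+ 2) / a ^+ 2.
      by field; rewrite gt_eqF.
    rewrite d2 /t; move: d1; move: (a ^+ 2 + _) (2 * l / m.+1%:R) => w x w0.
    by field; rewrite ?w0 ?gt_eqF.
  rewrite [leRHS](_ : _ = a^-1 * (3 * (atan (y i / a + t) - atan (y i / a)))); last by ring.
  rewrite ler_wpM2l ?invr_ge0 ?(ltW a0)//.
  by apply: atan_step; rewrite t0.
rewrite -mulr_sumr -(big_mkord xpredT (fun i => atan (y i.+1 / a) - atan (y i / a))).
rewrite (telescope_sumr (fun i => atan (y i / a)))//.
rewrite mulrAC ler_wpM2r ?invr_ge0 ?(ltW a0)//.
have := atan_ltpi2 (y m.+1 / a); have := atan_gtNpi2 (y 0%N / a).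
have [/andP[_ p2] _] := pihalf_02_cos_pihalf R; lra.
Qed.

Let a j : R := `|edge mu N - mu j|.

Lemma a_gt0 j : 0 < a j.
Proof. exact: edge_dist_gt0. Qed.

(** Here |z - mu_j| is at least h and at least a j, so that its square is at least
   their product; the side has length at most 2 h. *)
Lemma outer_side_sum (p q : R[i]) j m :
  nr (q - p) <= 2 * h ->
  (forall t, 0 <= t <= 1 -> complex.Re (segment p q t) <= edge mu N /\
    (complex.Re (segment p q t) <= - h \/ h <= `|complex.Im (segment p q t)|)) ->
  \sum_(i < m.+1) nr (step (segment p q) m i) /
     nr (segment p q (node m i) - (mu j)%:C) ^+ 2 <= 2 / a j.
Proof.
move=> pq out; have aj := a_gt0 j.
have h0 : 0 < h by rewrite hE addr_gt0// edge_gt0.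
have eh : edge mu N <= h by rewrite hE lerDl.
apply: (@le_trans _ _ (\sum_(i < m.+1) 2 / a j / m.+1%:R)); last first.
  by rewrite sum_div_const.
apply: ler_sum => i _.
have i1 : 0 <= (node m i : R) <= 1 by rewrite node_in01// ltnW.
have [u1 u2] := out _ i1.
have d1 := outer_dist mu_pos mu_incr j eh u1 u2.
have d2 := outer_dist_h mu_pos mu_incr j eh u2.
have st : nr (step (segment p q) m i) <= 2 * h / m.+1%:R.
  by apply: step_le => //; exact: segment_lipschitz.
set x := nr (_ - _) in d1 d2 *.
have xx : h * a j <= x ^+ 2 by rewrite expr2 ler_pM// ltW.
have x2 : 0 < x ^+ 2 by rewrite (lt_le_trans _ xx)// mulr_gt0.
rewrite ler_pdivrMr// (le_trans st)//.
rewrite (@le_trans _ _ (2 / a j / m.+1%:R * (h * a j)))//; last first.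
  by rewrite ler_wpM2l// !divr_ge0// ltW.
by apply: le_of_eq; field_nat R m.
Qed.

(** The right side contributes 12 / a j and each of the other three 2 / a j. *)
Lemma rect_square_sum : exists n : nat, forall m, (n <= m)%N -> forall j,
  \sum_(g <- rect) \sum_(i < m.+1) nr (step g m i) / dist (g (node m i)) j ^+ 2
    <= 18 / a j.
Proof.
have h0 : 0 < h by rewrite hE addr_gt0// edge_gt0.
have eN := edge_gt0 mu_pos mu_incr N.
have eh : edge mu N <= h by rewrite hE lerDl.
have [n hn] := archi_inv (2 * h) (gap_gt0 mu_incr N).
exists n => m /hn hm j; have aj := a_gt0 j.
rewrite !big_cons big_nil addr0.
have b1 : \sum_(i < m.+1) nr (step (segment ((- h) +i* - h) (edge mu N +i* - h)) m i) /
    nr (segment ((- h) +i* - h) (edge mu N +i* - h) (node m i) - (mu j)%:C) ^+ 2 <= 2 / a j.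
  apply: outer_side_sum => [|t /andP[t0 t1]].
    by rewrite (le_trans (nr_ReIm _))//= subrr normr0 addr0 ger0_norm; lra.
  rewrite /segment /=; split; first by nra.
  right; rewrite subrr !(mulr0, mul0r, addr0, subr0) normrN ler_norm//.
have b3 : \sum_(i < m.+1) nr (step (segment (edge mu N +i* h) ((- h) +i* h)) m i) /
    nr (segment (edge mu N +i* h) ((- h) +i* h) (node m i) - (mu j)%:C) ^+ 2 <= 2 / a j.
  apply: outer_side_sum => [|t /andP[t0 t1]].
    by rewrite (le_trans (nr_ReIm _))//= subrr normr0 addr0 distrC ger0_norm; lra.
  rewrite /segment /=; split; first by nra.
  right; rewrite subrr !(mulr0, mul0r, addr0, subr0) ler_norm//.
have b4 : \sum_(i < m.+1) nr (step (segment ((- h) +i* h) ((- h) +i* - h)) m i) /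
    nr (segment ((- h) +i* h) ((- h) +i* - h) (node m i) - (mu j)%:C) ^+ 2 <= 2 / a j.
  apply: outer_side_sum => [|t /andP[t0 t1]].
    by rewrite (le_trans (nr_ReIm _))//= subrr normr0 add0r distrC ger0_norm; lra.
  rewrite /segment /=; split; first by nra.
  left; nra.
have b2 : \sum_(i < m.+1) nr (step (segment (edge mu N +i* - h) (edge mu N +i* h)) m i) /
    nr (segment (edge mu N +i* - h) (edge mu N +i* h) (node m i) - (mu j)%:C) ^+ 2 <= 12 / a j.
  have hl : 2 * h / m.+1%:R <= a j by rewrite (le_trans hm)// edge_dist_ge.
  apply: le_trans (right_side_sum aj h0 hl); apply: ler_sum => i _.
  have -> : step (segment (edge mu N +i* - h) (edge mu N +i* h)) m i =
      (node m i.+1 - node m i)%:C * (0 +i* (2 * h)).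
    by rewrite /step /segment; apply: eq_ReIm => /=; ring.
  rewrite node_step nrM nr_real ger0_norm//.
  have -> : nr (0 +i* (2 * h)) = 2 * h.
    by apply: nr_eq_sqr; rewrite ?mulr_ge0 ?(ltW h0)//= expr0n add0r.
  rewrite [_^-1 * _]mulrC nr_sqr.
  have -> : complex.Re (segment (edge mu N +i* - h) (edge mu N +i* h) (node m i) - (mu j)%:C)
     = edge mu N - mu j by rewrite /segment /=; ring.
  have -> : complex.Im (segment (edge mu N +i* - h) (edge mu N +i* h) (node m i) - (mu j)%:C)
     = - h + node m i * (2 * h) by rewrite /segment /=; ring.
  by rewrite -(real_normK (num_real (edge mu N - mu j))).
have -> : 18 / a j = 2 / a j + (12 / a j + (2 / a j + 2 / a j)).
  by rewrite -!mulrDl; congr (_ / _); ring.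
by rewrite lerD// lerD// lerD.
Qed.

Lemma rect_dist_gt0 m (g : R -> R[i]) (i : 'I_m.+1) j : g \in rect ->
  0 < dist (g (node m i)) j.
Proof.
move=> gc; have := rect_good mu_pos mu_incr hE (lexx _) (on_node gc (ltnW (ltn_ord i))).
move=> [q [Nq near _]]; apply: lt_le_trans (near j).
by rewrite divr_gt0// spread_gt0.
Qed.

(** The inequality 2 x y <= t x^2 + y^2 / t, with the t that equalises the two
   bounds of [rect_square_sum]. *)
Lemma rect_product_sum : exists n : nat, forall m, (n <= m)%N -> forall j k,
  \sum_(g <- rect) \sum_(i < m.+1) nr (step g m i) /
    (dist (g (node m i)) j * dist (g (node m i)) k)
    <= 18 / (Num.sqrt (a j) * Num.sqrt (a k)).
Proof.
have [n hn] := rect_square_sum; exists n => m /hn hm j k.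
have sj : 0 < Num.sqrt (a j) by rewrite sqrtr_gt0 a_gt0.
have sk : 0 < Num.sqrt (a k) by rewrite sqrtr_gt0 a_gt0.
pose t := Num.sqrt (a j) / Num.sqrt (a k).
have t0 : 0 < t by rewrite divr_gt0.
apply: (@le_trans _ _ (2^-1 * (t * (18 / a j) + t^-1 * (18 / a k)))); last first.
  have e (x y : R) : 0 < x -> 0 < y ->
      2^-1 * (x / y * (18 / x ^+ 2) + (x / y)^-1 * (18 / y ^+ 2)) = 18 / (x * y).
    by move=> x0 y0; field; rewrite !gt_eqF.
  have := e _ _ sj sk; rewrite !sqr_sqrtr ?(ltW (a_gt0 _))// -/t => ->.
  exact: lexx.
have t1 := ler_wpM2l (ltW t0) (hm j).
have ti0 : 0 <= t^-1 by rewrite invr_ge0 ltW.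
have t2 := ler_wpM2l ti0 (hm k).
have half0 : 0 <= 2^-1 :> R by rewrite invr_ge0.
apply: le_trans (ler_wpM2l half0 (lerD t1 t2)).
rewrite !mulr_sumr -big_split /= mulr_sumr big_seq [leRHS]big_seq; apply: ler_sum => g gc.
rewrite !mulr_sumr -big_split /= mulr_sumr; apply: ler_sum => i _.
have xj := rect_dist_gt0 i j gc; have xk := rect_dist_gt0 i k gc.
move: (dist (g (node m i)) j) (dist (g (node m i)) k) xj xk => x y x0 y0.
have s0 := nr_ge0 (step g m i); move: (nr (step g m i)) s0 => s s0.
have -> : 2^-1 * (t * (s / x ^+ 2) + t^-1 * (s / y ^+ 2)) =
   s / (x * y) + s / (2 * t * x ^+ 2 * y ^+ 2) * (t * y - x) ^+ 2.
  by field; rewrite !gt_eqF.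
rewrite lerDl mulr_ge0 ?sqr_ge0// divr_ge0//.
by rewrite mulr_ge0 ?sqr_ge0// mulr_ge0 ?sqr_ge0// mulr_ge0// ltW.
Qed.

Lemma rect_diff j I I' f p : contour_limit rect F I ->
  contour_limit rect G I' -> vanishes_from p f ->
  nr (co (I f) j - co (I' f) j) <=
  36 * (omega j / Num.sqrt (a j)) *
    \sum_(k < p) omega k / Num.sqrt (a k) * nr (co f k).
Proof.
move=> Il Il' fp.
have gN := gap_gt0 mu_incr N; have g2 : 0 < gap mu N / 2 by rewrite divr_gt0.
have cE := rect_good mu_pos mu_incr hE (lexx (gap mu N / 2)).
apply: (integral_diff g2 cE Il Il' fp).
have [n hn] := rect_product_sum; exists n => m /hn hm.
rewrite (eq_bigr (fun g : R -> R[i] => \sum_(k < p) 2 * omega j * omega k * nr (co f k) *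
  \sum_(i < m.+1) nr (step g m i) / (dist (g (node m i)) j *
     dist (g (node m i)) k))); last first.
  move=> g _; under [RHS]eq_bigr do rewrite mulr_sumr.
  rewrite [RHS]exchange_big; apply: eq_bigr => i _ /=.
  rewrite mulrA mulrA !mulr_sumr; apply: eq_bigr => k _.
  by rewrite invfM; ring.
rewrite exchange_big mulr_sumr /=; apply: ler_sum => k _.
rewrite -mulr_sumr.
have c0 : 0 <= 2 * omega j * omega k * nr (co f k) by rewrite !mulr_ge0.
rewrite (le_trans (ler_wpM2l c0 (hm j k)))//.
by rewrite invfM; apply: le_of_eq; ring.
Qed.

Lemma edge_sum n : \sum_(k < n) (omega k / Num.sqrt (a k)) ^+ 2 <= 2 * eta.
Proof.
rewrite (le_trans _ (ler_wpM2l _ (omega_eta n (leqnn N))))// mulr_sumr ler_sum// => k _.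
rewrite expr_div_n sqr_sqrtr ?(ltW (a_gt0 k))// mulrCA ler_wpM2l ?sqr_ge0//.
rewrite -invf_div lef_pV2 ?posrE ?a_gt0 ?divr_gt0 ?spread_gt0//.
exact: edge_dist_spread.
Qed.

Lemma rect_sum_sq p n f :
  \sum_(j < n) (omega j / Num.sqrt (a j) *
    \sum_(k < p) omega k / Num.sqrt (a k) * nr (co f k)) ^+ 2 <= 4 * eta ^+ 2 * nr f ^+ 2.
Proof.
under eq_bigr do rewrite exprMn.
rewrite -mulr_suml; set s := \sum_(k < p) _.
have s2 : s ^+ 2 <= 2 * eta * nr f ^+ 2.
  rewrite (le_trans (sum_cauchy_schwarz (fun k => omega k / Num.sqrt (a k))
    (fun k => nr (co f k)) p))// ler_pM//.
  - by apply: sumr_ge0 => i _; exact: sqr_ge0.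
  - by apply: sumr_ge0 => i _; exact: sqr_ge0.
  - exact: edge_sum.
  - exact: bessel.
rewrite [leRHS](_ : _ = (2 * eta) * (2 * eta * nr f ^+ 2)); last by ring.
rewrite ler_pM ?sqr_ge0 ?edge_sum//.
by apply: sumr_ge0 => i _; exact: sqr_ge0.
Qed.

(** * The similarity *)

Hypothesis eta_small : eta <= 40^-1.
Variables (I0 J0 : H -> H) (I J : nat -> H -> H).
Hypotheses (I0l : contour_limit rect F I0) (J0l : contour_limit rect G J0)
  (Il : forall k, (N < k)%N -> contour_limit (circ k) F (I k))
  (Jl : forall k, (N < k)%N -> contour_limit (circ k) G (J k)).

Let c : R[i] := two_pi_i^-1.

Lemma two_pi_i_neq0 : two_pi_i != 0 :> R[i].
Proof. by rewrite eq_complex /= negb_and mulf_neq0 ?orbT// gt_eqF// pi_gt0. Qed.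

Lemma nr_c : nr c = (2 * pi)^-1.
Proof.
rewrite /c nrV; congr (_^-1).
by apply: nr_eq_sqr; rewrite ?mulr_ge0 ?pi_ge0//= expr0n add0r.
Qed.

(** The Riesz projection of T for the region that contains mu_j. *)
Let P (j : nat) (f : H) : H := c *: (if (j <= N)%N then I0 f else I j f).
Let Q0 (f : H) : H := c *: J0 f.
Let Q (k : nat) (f : H) : H := c *: J k f.

Lemma I0_bounded : bounded_operator I0.
Proof.
have gN : 0 < gap mu N / 2 by rewrite divr_gt0// gap_gt0.
have [M FM] := F_res gN.
exact: (contour_limit_bounded (K0_ge0 mu_pos mu_incr hE) FM
  (rect_lip mu_pos mu_incr hE) (rect_good mu_pos mu_incr hE (lexx _)) I0l).
Qed.

Lemma Ik_bounded k : (N < k)%N -> bounded_operator (I k).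
Proof.
move=> Nk; have gk : 0 < gap mu k / 2 by rewrite divr_gt0// gap_gt0.
have [M FM] := F_res gk.
exact: (contour_limit_bounded (K_ge0 mu_incr k) FM (@circ_lip _ _ mu_incr k)
  (circ_good mu_incr (ltnW Nk) (lexx _)) (Il Nk)).
Qed.

Lemma P_linear j : linear (P j).
Proof.
move=> x f g; rewrite /P scalerA mulrC -scalerA -scalerDr; congr (_ *: _).
case: leqP => jN; first by have [l _] := I0_bounded; exact: l.
by have [l _] := Ik_bounded jN; exact: l.
Qed.

Lemma P_bounded j : exists2 M : R, 0 <= M & forall f, nr (P j f) <= M * nr f.
Proof.
have [M M0 hM] : exists2 M : R, 0 <= M &
    forall f, nr (if (j <= N)%N then I0 f else I j f) <= M * nr f.
  case: leqP => jN; first exact: bounded_operator_nr I0_bounded.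
  exact: bounded_operator_nr (Ik_bounded jN).
exists (nr c * M); first by rewrite mulr_ge0.
by move=> f; rewrite nrZ -mulrA ler_wpM2l.
Qed.

Lemma Q0_coord f j : co (Q0 f) j = if (j <= N)%N then co f j else 0.
Proof.
have gN := gap_gt0 mu_incr N; have g2 : 0 < gap mu N / 2 by rewrite divr_gt0.
have cE := rect_good mu_pos mu_incr hE (lexx (gap mu N / 2)).
have eN := edge_gt0 mu_pos mu_incr N; have mj := mu_pos j.
have x12 := edge_left mu_pos mu_incr hE.
have y12 := h_sym mu_pos mu_incr hE.
rewrite /Q0 dotZl; have [jN|Nj] := leqP j N.
  have s0 : 0 < Num.min (gap mu N) 1 by rewrite lt_min gN ltr01.
  have s1 : Num.min (gap mu N) 1 <= gap mu N by rewrite ge_min lexx.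
  have s2 : Num.min (gap mu N) 1 <= 1 by rewrite ge_min lexx orbT.
  have me := mu_edge mu_incr jN.
  rewrite (diagonal_integral f (a := two_pi_i) g2 cE J0l).
    by rewrite mulrA /c mulVf ?two_pi_i_neq0// mul1r.
  move=> e e0; have [n hn] := rect_interior x12 y12 s0 e0.
  exists n => m /hn; apply => /=; apply/andP; split; rewrite ?hE; lra.
rewrite (diagonal_integral f (a := 0) g2 cE J0l).
  by rewrite mul0r mulr0.
move=> e e0; have [n hn] := rect_exterior x12 y12 (gap_gt0 mu_incr j) e0.
exists n => m /hn hm; rewrite subr0; apply: hm; apply: Or41 => /=.
exact: edge_mu.
Qed.

Lemma Q_coord k f j : (N < k)%N -> co (Q k f) j = if j == k then co f j else 0.
Proof.
move=> Nk; have gk := gap_gt0 mu_incr k; have g2 : 0 < gap mu k / 2 by rewrite divr_gt0.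
have cE := circ_good mu_incr (ltnW Nk) (lexx (gap mu k / 2)).
rewrite /Q dotZl; have [->|jk] := eqVneq j k.
  rewrite (diagonal_integral f (a := two_pi_i) g2 cE (Jl Nk)).
    by rewrite mulrA /c mulVf ?two_pi_i_neq0// mul1r.
  move=> e e0; have [n hn] := circle_interior (mu k) gk gk e0.
  by exists n => m /hn; apply; rewrite !subrr nr0.
rewrite (diagonal_integral f (a := 0) g2 cE (Jl Nk)).
  by rewrite mul0r mulr0.
move=> e e0; have [n hn] := circle_exterior (mu k) (ltW gk) gk e0.
exists n => m /hn hm; rewrite subr0; apply: hm.
rewrite -rmorphB nr_real distrC.
by have := mu_dist_gap mu_incr jk; lra.
Qed.

Definition dev j (f : H) : R[i] := co (P j f) j - co f j.

Lemma dev_linear j x f g : dev j (x *: f + g) = x * dev j f + dev j g.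
Proof. by rewrite /dev P_linear !dotDl !dotZl; ring. Qed.

Lemma dev_bounded j : exists2 M : R, 0 <= M & forall f, nr (dev j f) <= M * nr f.
Proof.
have [M M0 hM] := P_bounded j; exists (M + 1); first by rewrite addr_ge0.
move=> f; rewrite (le_trans (nr_subr _ _))// mulrDl mul1r lerD//.
  by rewrite (le_trans (coord_nr dotE psi_on _ _)).
exact: coord_nr.
Qed.

(** With eta = 1/40 the discs contribute (8 eta)^2 and the rectangle (18 eta)^2,
   388 eta^2 in all, which is less than 1/4. *)
Lemma dev_finite p n f : vanishes_from p f ->
  \sum_(j < n) nr (dev j f) ^+ 2 <= (2^-1 * nr f) ^+ 2.
Proof.
move=> fp; have eta0 := eta_ge0.
have pi2 : 2 <= pi :> R := @pi_ge2 R.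
have pi0 : 0 < (2 * pi : R) by rewrite mulr_gt0// pi_gt0.
rewrite (bigID (fun j : 'I_n => (N < j)%N)) /=.
have big : \sum_(j < n | (N < j)%N) nr (dev j f) ^+ 2 <= 64 * (eta ^+ 2 * nr f ^+ 2).
  rewrite (le_trans _ (ler_wpM2l _ (schur_test p n f)))//.
  rewrite mulr_sumr; apply: ler_sum => j Nj.
  set s := omega j * _.
  have -> : 64 * s ^+ 2 = (8 * s) ^+ 2 by ring.
  have -> : dev j f = c * (co (I j f) j - co (J j f) j).
    have := Q_coord f j Nj; rewrite eqxx /Q dotZl mulrBr => ->.
    by rewrite /dev /P leqNgt Nj /= dotZl.
  have df := circle_diff Nj (Il Nj) (Jl Nj) fp.
  have le : nr (c * (co (I j f) j - co (J j f) j)) <= 8 * s.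
    rewrite nrM nr_c ler_pdivrMl// (le_trans df)//; apply: le_of_eq.
    by rewrite /s; ring.
  by rewrite ler_pXn2r ?nnegrE// (le_trans _ le)// nr_ge0.
have small : \sum_(j < n | ~~ (N < j)%N) nr (dev j f) ^+ 2 <= 81 * (4 * eta ^+ 2 * nr f ^+ 2).
  rewrite (le_trans _ (ler_wpM2l _ (rect_sum_sq p n f)))//.
  rewrite mulr_sumr big_mkcond /=; apply: ler_sum => j _.
  set s := _ * \sum_(_ < p) _.
  have s81 : 0 <= 81 * s ^+ 2 by rewrite mulr_ge0// sqr_ge0.
  case: ifP => //; rewrite -leqNgt => jN.
  have -> : 81 * s ^+ 2 = (9 * s) ^+ 2 by ring.
  have -> : dev j f = c * (co (I0 f) j - co (J0 f) j).
    have := Q0_coord f j; rewrite jN /Q0 dotZl mulrBr => ->.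
    by rewrite /dev /P jN dotZl.
  have df := rect_diff j I0l J0l fp.
  have le : nr (c * (co (I0 f) j - co (J0 f) j)) <= 9 * s.
    rewrite nrM nr_c ler_pdivrMl// (le_trans df)//.
    have s0 : 0 <= s.
      rewrite mulr_ge0 ?divr_ge0 ?sqrtr_ge0//; apply: sumr_ge0 => k _.
      by rewrite mulr_ge0 ?divr_ge0 ?sqrtr_ge0.
    rewrite -mulrA -/s; have := ler_wpM2r s0 pi2; lra.
  by rewrite ler_pXn2r ?nnegrE// (le_trans _ le)// nr_ge0.
rewrite (le_trans (lerD big small))//.
have e2 : eta ^+ 2 <= 1600^-1.
  rewrite (le_trans (ler_pM eta0 eta0 eta_small eta_small))//; lra.
have e3 := ler_wpM2r (sqr_ge0 (nr f)) e2; move: e3.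
have -> : (2^-1 * nr f) ^+ 2 = 4^-1 * nr f ^+ 2 by field.
rewrite -(mulrA 4); have := sqr_ge0 (nr f).
set x := eta ^+ 2 * nr f ^+ 2; set y := nr f ^+ 2; lra.
Qed.

(** By continuity: finitely many coordinates depend boundedly on f. *)
Lemma dev_le n f : \sum_(j < n) nr (dev j f) ^+ 2 <= (2^-1 * nr f) ^+ 2.
Proof.
pose W g := expansion psi (dev^~ g) n.
have WE g : nr (W g) ^+ 2 = \sum_(j < n) nr (dev j g) ^+ 2.
  have := nr_expansionB dotE psi_on (dev^~ g) (leq0n n).
  by rewrite {2}/expansion big_ord0 subr0 [X in _ - X]big_ord0 subr0 => ->.
rewrite -WE; suff le : nr (W f) <= 2^-1 * nr f.
  by rewrite ler_pXn2r ?nnegrE// (le_trans _ le)// nr_ge0.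
have lW : linear W.
  move=> x g g'; rewrite /W /expansion scaler_sumr -big_split /=.
  by apply: eq_bigr => j _; rewrite dev_linear scalerDl scalerA.
have bnd k : exists2 C : R, 0 <= C &
    forall g, nr (expansion psi (dev^~ g) k) <= C * nr g.
  rewrite /expansion; elim: k => [|k [C C0 ih]].
    by exists 0 => // g; rewrite big_ord0 nr0 mul0r.
  have [M M0 hM] := dev_bounded k; exists (C + M); first exact: addr_ge0.
  move=> g; rewrite big_ord_recr /= (le_trans (nrD _ _))// mulrDl lerD//.
  by rewrite nrZ (nr_basis dotE psi_on) mulr1.
have [C C0 WC] := bnd n.
apply: nr_le_lim => e e0.
have C1 : 0 < C + 1 by rewrite ltr_wpDl.
have [p /(_ p (leqnn p)) hp] := truncation_cvg dotE psi_on psi_tot f (divr_gt0 e0 C1).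
exists (W (truncation dot psi f p)).
  rewrite -(linear_funB _ _ lW) (le_trans (WC _))// (le_trans (ler_wpM2l C0 hp))//.
  by rewrite mulrCA ler_piMr ?(ltW e0)// ler_pdivrMr// mul1r lerDl.
apply: (@le_trans _ _ (2^-1 * nr (truncation dot psi f p))); last first.
  by rewrite ler_wpM2l ?(truncation_nr dotE psi_on)// invr_ge0.
rewrite -ler_sqr ?nnegrE ?mulr_ge0 ?invr_ge0//.
rewrite WE; apply: (@dev_finite p) => k pk.
by rewrite /truncation (dot_expansion psi_on) ltnNge pk.
Qed.

Lemma P_idem j f : P j (P j f) = P j f.
Proof.
rewrite /P; case: leqP => jN.
  have [l _] := I0_bounded; rewrite (linear_funZ _ _ l).
  rewrite (rect_rect mu_pos mu_incr hE F_res I0l) !scalerA.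
  by rewrite -mulrA /c mulVf ?two_pi_i_neq0// mulr1.
have [l _] := Ik_bounded jN; rewrite (linear_funZ _ _ l).
rewrite (circ_circ_same mu_incr F_res jN (Il jN)) !scalerA.
by rewrite -mulrA /c mulVf ?two_pi_i_neq0// mulr1.
Qed.

Lemma P_same i j f : (i <= N)%N -> (j <= N)%N -> P i f = P j f.
Proof. by rewrite /P => -> ->. Qed.

Lemma P_disjoint i j f : ~~ ((i <= N)%N && (j <= N)%N) -> i != j -> P i (P j f) = 0.
Proof.
move=> ij ne; rewrite /P.
have [iN|Ni] := leqP i N; have [jN|Nj] := leqP j N.
- by rewrite iN jN in ij.
- have [l _] := I0_bounded; rewrite (linear_funZ _ _ l).
  by rewrite (rect_circ mu_pos mu_incr hE F_res Nj I0l (Il Nj)) !scaler0.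
- have [l _] := Ik_bounded Ni; rewrite (linear_funZ _ _ l).
  by rewrite (circ_rect mu_pos mu_incr hE F_res Ni I0l (Il Ni)) !scaler0.
- have [l _] := Ik_bounded Ni; rewrite (linear_funZ _ _ l).
  by rewrite (circ_circ_disjoint mu_incr F_res Ni Nj (Il Ni) (Il Nj) f ne) !scaler0.
Qed.

(** W f has the coordinates <P_j f, psi_j>, that is, W is the sum of S_0^0 S_0 and of
   the P_k^0 P_k. It is close to the identity by [dev_le], and P_k^0 W = P_k^0 P_k = W P_k
   because in each family the products of different projections vanish. *)
Lemma similarity : exists W Winv, [/\ boundedly_invertible W Winv,
  P 0%N = Winv \o Q0 \o W &
  forall k, (N < k)%N -> P k = Winv \o Q k \o W].
Proof.
have DE f : exists g, (forall j, co g j = dev j f) /\ nr g <= 2^-1 * nr f.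
  by apply: (coord_exists dotE psi_on psi_tot) => [|n]; [rewrite mulr_ge0 ?invr_ge0|
    exact: dev_le].
pose D f := sval (cid (DE f)).
have DP f : (forall j, co (D f) j = dev j f) /\ nr (D f) <= 2^-1 * nr f
  := svalP (cid (DE f)).
have lD : linear D.
  move=> x f g; apply: (coord_ext psi_tot) => j.
  have [e1 _] := DP (x *: f + g); have [e2 _] := DP f; have [e3 _] := DP g.
  by rewrite e1 dotDl dotZl e2 e3 dev_linear.
have Dle f : nr (D f) <= 2^-1 * nr f by have [] := DP f.
have [Winv Winv_inv] := neumann lD Dle.
pose W f := f + D f.
have WE f j : co (W f) j = co (P j f) j.
  by rewrite /W dotDl; have [-> _] := DP f; rewrite /dev addrC subrK.
exists W, Winv; split => //.
  apply/funext => f /=; have [_ _ K _] := Winv_inv.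
  rewrite -[LHS]K; congr (Winv _); apply: (coord_ext psi_tot) => j.
  rewrite -/(W (P 0 f)) WE Q0_coord WE; case: leqP => jN.
    by rewrite (P_same f (leq0n N) jN) P_idem.
  rewrite P_disjoint ?dot0l//; first by rewrite negb_and -ltnNge jN.
  by rewrite gtn_eqF// (leq_ltn_trans _ jN).
move=> k Nk; apply/funext => f /=; have [_ _ K _] := Winv_inv.
rewrite -[LHS]K; congr (Winv _); apply: (coord_ext psi_tot) => j.
rewrite -/(W (P k f)) WE Q_coord// WE; have [->|jk] := eqVneq j k.
  by rewrite P_idem.
by rewrite P_disjoint ?dot0l// negb_and -(ltnNge N k) Nk orbT.
Qed.

End Estimates.

(** * The gap condition for partial sums; the boundaries of the regions *)

Section Hypotheses.
Context {R : realType}.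
Implicit Types (mu omega : nat -> R).

Lemma series_partial_le (u : nat -> R) (p : pred nat) (M : \bar R) n :
  (forall j, p j -> 0 <= u j) ->
  (\sum_(0 <= j <oo | p j) (u j)%:E <= M)%E ->
  ((\sum_(j < n | p j) u j)%:E <= M)%E.
Proof.
move=> u0; apply: le_trans.
have := @nneseries_lim_ge R (fun j => (u j)%:E) p 0%N n.
rewrite big_mkord sumEFin; apply => j _ pj; rewrite lee_fin; exact: u0.
Qed.

Lemma series_bounded (u : nat -> R) : (forall j, 0 <= u j) ->
  (\sum_(0 <= j <oo) (u j)%:E < +oo)%E ->
  exists C, forall n, \sum_(j < n) u j <= C.
Proof.
move=> u0 fin; set s := (\sum_(0 <= j <oo) _)%E in fin.
have h n : ((\sum_(j < n) u j)%:E <= s)%E.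
  exact: (@series_partial_le u xpredT s n (fun j _ => u0 j) (lexx s)).
case: s fin h => [r _ h|//|_ h].
  by exists r => n; have := h n; rewrite lee_fin.
by have := h 0%N; rewrite leeNy_eq.
Qed.

Lemma unbounded_of_sum mu (p : R) : (forall n, 0 < mu n) -> 0 < p ->
  (\sum_(0 <= n <oo) (mu n `^ (- p))%:E < +oo)%E ->
  forall B : R, exists n, B < mu n.
Proof.
move=> mu_pos p0 fin B; apply: contrapT => hB.
have le n : mu n <= B by rewrite leNgt; apply/negP => h; apply: hB; exists n.
have [C hC] := series_bounded (fun n => powR_ge0 _ _) fin.
have B0 : 0 < B by exact: lt_le_trans (mu_pos 0%N) (le 0%N).
have b0 : 0 < B `^ (- p) by rewrite powR_gt0.
have ge n : B `^ (- p) <= mu n `^ (- p).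
  rewrite !powRN lef_pV2 ?posrE ?powR_gt0//.
  by apply: ge0_ler_powR; rewrite ?nnegrE ?(ltW p0) ?(ltW (mu_pos n)) ?(ltW B0).
have [n hn] := archi_inv (C + 1) b0.
have h1 : \sum_(j < n.+1) B `^ (- p) <= C.
  by rewrite (le_trans _ (hC n.+1))// ler_sum.
have := hn n (leqnn n); rewrite ler_pdivrMr//.
rewrite sumr_const card_ord -[leLHS]mulr_natr in h1; lra.
Qed.

Lemma gap_condition mu omega (e : R) : (forall n, mu n < mu n.+1) ->
  (forall j, 0 <= omega j) ->
  ((\sum_(0 <= j <oo | j != n) (omega j ^+ 2 / `|mu n - mu j|)%:E
        + (omega n ^+ 2 / gap mu n)%:E)%E @[n --> \oo] --> 0%E) ->
  0 < e ->
  exists N : nat, forall m n, (N <= m)%N ->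
     \sum_(j < n) omega j ^+ 2 / spread mu m j <= e.
Proof.
move=> mu_incr omega_ge0 lim e0.
have nb : nbhs (0%E : \bar R) [set x | (x < e%:E)%E].
  by apply: open_nbhs_nbhs; split; [exact: open_ereal_lt_ereal|rewrite /= lte_fin].
have [N _ hN] := lim _ nb.
exists N => m n Nm; have /= := hN m Nm.
set S := (\sum_(0 <= j <oo | _) _)%E => lt.
have gm := gap_gt0 mu_incr m.
have t0 : 0 <= omega m ^+ 2 / gap mu m by rewrite divr_ge0 ?sqr_ge0 ?ltW.
have h : ((\sum_(j < n | j != m :> nat) omega j ^+ 2 / `|mu m - mu j|)%:E <= S)%E.
  apply: (@series_partial_le (fun j => omega j ^+ 2 / `|mu m - mu j|) (fun j => j != m)) => //.
  by move=> j _; rewrite divr_ge0 ?sqr_ge0.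
have : ((\sum_(j < n | j != m :> nat) omega j ^+ 2 / `|mu m - mu j|)%:E
   + (omega m ^+ 2 / gap mu m)%:E < e%:E)%E.
  by apply: le_lt_trans lt; rewrite leeD2r.
rewrite -EFinD lte_fin => /ltW; apply: le_trans.
rewrite (bigID (fun j : 'I_n => j != m :> nat)) /= lerD//.
  by apply: ler_sum => j jm; rewrite /spread (negbTE jm).
have [mn|nm] := ltnP m n.
  rewrite (bigD1 (Ordinal mn)) /=; last by rewrite negbK.
  rewrite /spread eqxx big1 ?addr0// => j /andP[]; rewrite negbK => /eqP jm.
  by rewrite -val_eqE /= jm eqxx.
rewrite big1// => j; rewrite negbK => /eqP jm.
by have := ltn_ord j; rewrite jm ltnNge nm.
Qed.

End Hypotheses.

Section Boundaries.
Context {R : realType}.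
Implicit Types (z : R[i]) (E : set R[i]).

Lemma nbhs_complexP z (B : set R[i]) : nbhs (z : R[i]^o) (B : set R[i]^o) <->
  exists2 e : R, 0 < e & forall w : R[i], nr (z - w) < e -> B w.
Proof.
split.
  move=> /nbhs_ballP[e /= e0 h]; exists (complex.Re e).
    by move: e0; rewrite ltcE => /andP[].
  move=> w zw; apply: h; rewrite -ball_normE /= nrE ltcE /= zw andbT.
  by move: e0; rewrite ltcE => /andP[].
move=> [e e0 h]; apply/nbhs_ballP; exists e%:C => /=.
  by rewrite -[0]/(0%:C) ltr_complex.
by move=> w; rewrite -ball_normE /= nrE ltr_complex => /h.
Qed.

Lemma boundary_closed_ball z E (e : R) : boundary E z -> 0 < e ->
  exists2 w, E w & nr (z - w) < e.
Proof.
move=> [cl _] e0.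
have [|w [Ew zw]] := cl [set w : R[i] | nr (z - w) < e]; last by exists w.
by apply/nbhs_complexP; exists e.
Qed.

Lemma boundary_not_inside z E : boundary E z ->
  ~ exists2 e : R, 0 < e & forall w : R[i], nr (z - w) < e -> E w.
Proof. by move=> [_ ni] h; apply: ni; apply/nbhs_complexP. Qed.

Lemma disc_boundary (mu : nat -> R) k z : boundary (PiD mu k) z ->
  nr (z - (mu k)%:C) = gap mu k.
Proof.
move=> bz; apply/eqP; rewrite eq_le; apply/andP; split.
  apply/ler_addgt0Pr => e e0; have [w Ew zw] := boundary_closed_ball bz e0.
  move: Ew; rewrite /PiD /= nrE ltr_complex => wk.
  rewrite (le_trans (nr_triangle w _ _))// addrC lerD ?ltW//.
rewrite leNgt; apply/negP => lt; apply: (boundary_not_inside bz).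
exists (gap mu k - nr (z - (mu k)%:C)); first by rewrite subr_gt0.
move=> w zw; rewrite /PiD /= nrE ltr_complex.
have := nr_triangle z w (mu k)%:C; rewrite (nrB w z); lra.
Qed.

Lemma rect_boundary (mu : nat -> R) N (h1 h2 : R) z : boundary (Pi0 mu N h1 h2) z ->
  complex.Re z <= edge mu N /\
  [\/ complex.Re z <= - h1, edge mu N <= complex.Re z | h2 <= `|complex.Im z|].
Proof.
move=> bz; split.
  apply/ler_addgt0Pr => e e0; have [w [/andP[_ w2] _] zw] := boundary_closed_ball bz e0.
  have := nr_Re (z - w); rewrite raddfB /= ler_norml => /andP[_].
  by move: w2; rewrite -/(edge mu N); lra.
apply: contrapT => h.
have [n1 n2 n3] : [/\ - h1 < complex.Re z, complex.Re z < edge mu N &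
   `|complex.Im z| < h2].
  by split; rewrite ltNge; apply/negP => hh; apply: h; [apply: Or31|apply: Or32|apply: Or33].
apply: (boundary_not_inside bz).
pose e := Num.min (complex.Re z + h1) (Num.min (edge mu N - complex.Re z)
  (h2 - `|complex.Im z|)).
exists e; first by rewrite !lt_min; apply/and3P; split; lra.
move=> w; rewrite !lt_min => /and3P[e1 e2 e3].
have := nr_Re (z - w); have := nr_Im (z - w); rewrite !raddfB /= => i1.
rewrite ler_norml => /andP[r1 r2]; split.
  by rewrite -/(edge mu N); apply/andP; split; lra.
have := ler_normD (complex.Im z) (complex.Im w - complex.Im z).
rewrite addrC subrK distrC; lra.
Qed.

End Boundaries.

Theorem theorem3p4 (R : realType) (H : completeNormedModType R[i])
    (dot : {dot H for Num.conj})
    (H_hilbert : hilbert_dot dot)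
    (H_infinite : infinite_dimensional H) (H_separable : separable H)
    (A : operator H) (mu : nat -> R) (psi : nat -> H)
    (A_sa : self_adjoint dot A) (A_compact : compact_resolvent A)
    (mu_pos : forall n, 0 < mu n) (mu_incr : forall n, mu n < mu n.+1)
    (A_spectrum : spectrum A = [set z | exists n, z = (mu n)%:C])
    (A_simple : forall n, simple_eigenpair A (mu n) (psi n))
    (sqrtA : operator H) (A_sqrt : is_sqrt dot A sqrtA)
    (v : H -> H -> R[i])
    (v_sesqui : sesquilinear_on (dom sqrtA) v) (v_bounded : bounded_form sqrtA v)
    (omega : nat -> R) (omega_ge0 : forall j, 0 <= omega j)
    (v_omega : forall j k, `|v (psi j) (psi k)| <= (omega j * omega k)%:C)
    (omega_sum :
      (\sum_(0 <= j <oo) (omega j ^+ 2 / mu j)%:E < +oo)%E)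
    (mu_sum : exists2 p : R, 0 < p &
      (\sum_(0 <= n <oo) (mu n `^ (- p))%:E < +oo)%E)
    (omega_lim :
      ((\sum_(0 <= j <oo | j != n) (omega j ^+ 2 / `|mu n - mu j|)%:E
        + (omega n ^+ 2 / gap mu n)%:E)%E @[n --> \oo] --> 0%E))
    (T : operator H)
    (T_assoc : associated_operator dot (dom sqrtA)
      (fun f g => sqrt_form dot sqrtA f g + v f g) T) :
  exists (N0 : nat) (h1 h2 : R), [/\ 0 < h1, 0 < h2,
    spectrum T `<=`
      Pi0 mu N0 h1 h2 `|` \bigcup_(k in [set k | (N0 < k)%N]) PiD mu k,
    boundary (Pi0 mu N0 h1 h2) `<=` resolvent_set T /\
    (forall k, (N0 < k)%N -> boundary (PiD mu k) `<=` resolvent_set T) &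
    exists W Winv : H -> H, boundedly_invertible W Winv /\
      (exists S00 S0 : H -> H,
         [/\ riesz_projection A (Pi0_contour mu N0 h1 h2) S00,
             riesz_projection T (Pi0_contour mu N0 h1 h2) S0 &
             S0 = Winv \o S00 \o W]) /\
      (forall k, (N0 < k)%N -> exists Pk0 Pk : H -> H,
         [/\ riesz_projection A (PiD_contour mu k) Pk0,
             riesz_projection T (PiD_contour mu k) Pk &
             Pk = Winv \o Pk0 \o W])].
Proof.
have [p p0 mu_p] := mu_sum.
have unb := unbounded_of_sum mu_pos p0 mu_p.
have [Com hCom] : exists C, forall n, \sum_(j < n) omega j ^+ 2 / mu j <= C.
  apply: (@series_bounded _ (fun j => omega j ^+ 2 / mu j)) => // j.
  by rewrite divr_ge0 ?sqr_ge0// ltW.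
(* 1/40 is the smallness asked for by the similarity. *)
have e40 : 0 < 40^-1 :> R by rewrite invr_gt0.
have [N hN] := gap_condition mu_incr omega_ge0 omega_lim e40.
have psi_on := psi_orthonormal H_hilbert A_sa mu_incr A_simple.
have psi_tot := psi_total H_hilbert A_sa A_compact mu_pos mu_incr A_spectrum A_simple.
have S_root := sqrt_diagonal_root H_hilbert A_sa A_compact mu_pos mu_incr A_spectrum A_simple
  A_sqrt.
have eta4 : 2 * 40^-1 <= 2^-1 :> R by lra.
(* A itself is the case v = 0 of the same theory. *)
pose v0 : H -> H -> R[i] := fun _ _ => 0.
have v0_sesqui : sesquilinear_on (dom sqrtA) v0.
  by split => *; rewrite /v0 mulr0 addr0.
have v0_bounded : bounded_form sqrtA v0.
  by exists 0 => f g _ _; rewrite /v0 normr0 mul0r.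
have v0_omega j k : `|v0 (psi j) (psi k)| <= (omega j * omega k)%:C.
  by rewrite /v0 normr0 -[0]/(0%:C) ler_complex mulr_ge0.
have A_assoc := A_associated A_sqrt.
have F_res := resolvent_family H_hilbert mu_pos S_root v_sesqui v_bounded omega_ge0
  v_omega hCom T_assoc mu_incr hN eta4.
have F_coord := resolvent_coord H_hilbert mu_pos S_root v_sesqui v_bounded omega_ge0
  v_omega hCom T_assoc mu_incr hN eta4.
have T_near := near_in_resolvent_set H_hilbert mu_pos S_root v_sesqui v_bounded omega_ge0
  v_omega hCom T_assoc mu_incr hN eta4.
have T_good := good_in_resolvent_set H_hilbert mu_pos S_root v_sesqui v_bounded omega_ge0
  v_omega hCom T_assoc mu_incr hN eta4.
have G_res := resolvent_family H_hilbert mu_pos S_root v0_sesqui v0_bounded omega_ge0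
  v0_omega hCom A_assoc mu_incr hN eta4.
have A_good := good_in_resolvent_set H_hilbert mu_pos S_root v0_sesqui v0_bounded omega_ge0
  v0_omega hCom A_assoc mu_incr hN eta4.
have G_coord (d : R) z f j := resolvent_diagonal H_hilbert mu_pos S_root v0_sesqui v0_bounded
  omega_ge0 v0_omega hCom A_assoc mu_incr hN eta4 (d := d) (z := z) f j (fun _ _ => erefl).
(* The outer sides are farther from each eigenvalue than the foot of the right side
   is, even after the rectangle shrinks by at most 1. *)
pose h := edge mu N + 1.
have hE : h = edge mu N + 1 by [].
have eN := edge_gt0 mu_pos mu_incr N.
have h0 : 0 < h by rewrite hE; lra.
have eh : edge mu N <= h by rewrite hE; lra.
have gN2 : 0 < gap mu N / 2 by rewrite divr_gt0// gap_gt0.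
have gk2 k : 0 < gap mu k / 2 by rewrite divr_gt0// gap_gt0.
have rectE := rect_good mu_pos mu_incr hE (lexx (gap mu N / 2)).
have circE k (Nk : (N < k)%N) := circ_good mu_incr (ltnW Nk) (lexx (gap mu k / 2)).
exists N, h, h; split => //.
- move=> z Tz; apply: contrapT => nz; apply: Tz.
  have off k : (N < k)%N -> gap mu k <= nr (z - (mu k)%:C).
    move=> Nk; rewrite leNgt; apply/negP => lt; apply: nz; right; exists k => //.
    by rewrite /PiD /= nrE ltr_complex.
  (* A point outside of all regions is to the right of the rectangle, or on or beyond
     one of its other sides. *)
  have [zN|Nz] := leP (complex.Re z) (edge mu N); last first.
    by have [m Nm near] := right_near mu_incr unb (ltW Nz) off; exact: T_near near.
  apply: (T_near N) => //; apply: (outer_near mu_pos mu_incr eh zN).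
  apply: contrapT => /not_orP[n1 n2]; apply: nz; left.
  split; last by rewrite ltW// ltNge; exact/negP.
  by rewrite zN andbT ltNge; exact/negP.
- split=> [z bz|k Nk z /disc_boundary zk].
    apply: (T_near N) => //; have [zN] := rect_boundary bz.
    case=> side.
    + by apply: (outer_near mu_pos mu_incr eh zN); left.
    + apply: right_side_near => //; rewrite zN andbT (le_trans _ side)//.
      by rewrite gerBl ltW.
    + by apply: (outer_near mu_pos mu_incr eh zN); right.
  apply: (T_near k); first exact: ltnW.
  by apply: annulus_near => //; rewrite zk lexx andbT; have := gk2 k; lra.
have [I0 [I0i I0l]] := rect_integral mu_pos mu_incr hE F_res.
have [J0 [J0i J0l]] := rect_integral mu_pos mu_incr hE G_res.
have Iex k : exists I, (N < k)%N -> contour_integral (PiD_contour mu k) (resolvent T) I /\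
    contour_limit (PiD_contour mu k) (resolvent T) I.
  case: (ltnP N k) => [Nk|_]; last by exists id.
  by have [I Ip] := circ_integral mu_incr F_res (ltnW Nk); exists I.
have Jex k : exists J, (N < k)%N -> contour_integral (PiD_contour mu k) (resolvent A) J /\
    contour_limit (PiD_contour mu k) (resolvent A) J.
  case: (ltnP N k) => [Nk|_]; last by exists id.
  by have [I Ip] := circ_integral mu_incr G_res (ltnW Nk); exists I.
pose I k := sval (cid (Iex k)); pose J k := sval (cid (Jex k)).
have IP k (Nk : (N < k)%N) : contour_integral (PiD_contour mu k) (resolvent T) (I k) /\
    contour_limit (PiD_contour mu k) (resolvent T) (I k) := svalP (cid (Iex k)) Nk.
have JP k (Nk : (N < k)%N) : contour_integral (PiD_contour mu k) (resolvent A) (J k) /\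
    contour_limit (PiD_contour mu k) (resolvent A) (J k) := svalP (cid (Jex k)) Nk.
have [W [Winv [inv S0E PkE]]] := similarity H_hilbert psi_on psi_tot mu_pos mu_incr hE
  omega_ge0 hN F_res G_coord F_coord (lexx _) I0l J0l
  (fun k Nk => (IP k Nk).2) (fun k Nk => (JP k Nk).2).
exists W, Winv; split => //; split.
  exists (fun f => two_pi_i^-1 *: J0 f), (fun f => two_pi_i^-1 *: I0 f); split => //.
  - split; last by exists J0.
    by move=> z /rectE; exact: A_good.
  - split; last by exists I0.
    by move=> z /rectE; exact: T_good.
move=> k Nk; exists (fun f => two_pi_i^-1 *: J k f), (fun f => two_pi_i^-1 *: I k f).
split.
- split; last by exists (J k) => //; exact: (JP k Nk).1.
  by move=> z /(circE k Nk); exact: A_good.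
- split; last by exists (I k) => //; exact: (IP k Nk).1.
  by move=> z /(circE k Nk); exact: T_good.
- have := PkE k Nk; rewrite leqNgt Nk; exact.
Qed.
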